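(* Let $n\ge 1$, $\mathfrak g=\mathfrak{osp}(2|2n)$, and let $\mathcal A\subset U(\mathfrak g)^\circ$ be the sub-Hopf-superalgebra generated by the matrix elements $t_{ab}$ ($1\le a,b\le 2n+2$) of the defining representation $t$ of $\mathfrak g$. Let $\int_0$ be a non-zero left integral on $\mathcal A_e=\mathcal P(\mathcal A)$ (it is unique up to scalar multiples), where $\mathcal P$ is restriction of linear forms to $U(\mathfrak g_{\bar 0})$. Let $\mathbb E$ and $\mathbb F$ be non-zero elements of the one-dimensional subspaces of highest Grassmann degree of $U(\mathfrak g_{\bar 1+})$ and $U(\mathfrak g_{\bar 1-})$, respectively, and let $\Gamma=\mathbb E\,\mathbb F\in U(\mathfrak g)$. Then the linear form $\int=\nu(\Gamma)\cdot(\int_0\circ\mathcal P|_{\mathcal A})$ is a non-trivial (i.e. non-zero) left and right integral on $\mathcal A$.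
   Context: Everything is over $\mathbb C$ and $\mathbb Z_2$-graded, with the super sign rule; $[x]$ is the degree of a homogeneous element. $\mathfrak g_{\bar 0}=\mathfrak{sp}(2n)\oplus\mathfrak{gl}(1)$, and $\mathfrak g_{\bar 1}=\mathfrak g_{\bar 1+}\oplus\mathfrak g_{\bar 1-}$ is the decomposition into the two $\mathfrak g_{\bar 0}$-submodules (the eigenspaces of $\mathfrak{gl}(1)$), which satisfies $[\mathfrak g_{\bar 1\pm},\mathfrak g_{\bar 1\pm}]=0$ and $[\mathfrak g_{\bar 1+},\mathfrak g_{\bar 1-}]\subset\mathfrak g_{\bar 0}$; $U(\mathfrak g_{\bar 1\pm})$ are Grassmann algebras on $2n$ generators. $t_{ab}(x)$ is the $(a,b)$ entry of $t(x)$, $x\in U(\mathfrak g)$, in a homogeneous basis. The finite dual $\mathcal U^\circ\subset\mathcal U^*$ of a Hopf superalgebra $\mathcal U$ consists of the matrix elements of finite-dimensional graded representations, with Hopf superalgebra structure obtained by transposition: $\langle ab,x\rangle=\langle a\otimes b,\Delta(x)\rangle$, $\langle\Delta(a),x\otimes y\rangle=\langle a,xy\rangle$, where $\langle a\otimes b,x\otimes y\rangle=(-1)^{[b][x]}\langle a,x\rangle\langle b,y\rangle$. The map $\mathcal P:U(\mathfrak g)^\circ\to U(\mathfrak g_{\bar 0})^\circ$ is restriction. The map $\nu:U(\mathfrak g)\to\mathcal A^\circ\subset\mathcal A^*$ is $\langle\nu(x),a\rangle=(-1)^{[x][a]}\langle a,x\rangle$, and $\langle f\cdot g,a\rangle=\langle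 f\otimes g,\Delta(a)\rangle$ is the product in $\mathcal A^*$. A left (resp. right) integral on a Hopf superalgebra $\mathcal B$ is a linear form $\int$ on $\mathcal B$ with $(\mathrm{id}\otimes\int)\Delta(b)=1_{\mathcal B}\int(b)$ (resp. $(\int\otimes\mathrm{id})\Delta(b)=1_{\mathcal B}\int(b)$) for all $b$. *)

(* Defs.v *)
From HB Require Import structures.
From mathcomp Require Import all_boot all_order all_algebra.
From mathcomp Require Import boolp classical_sets functions.
From mathcomp Require Import ring.

Set Implicit Arguments.
Unset Strict Implicit.
Unset Printing Implicit Defensive.

Import Order.TTheory GRing.Theory Num.Theory.
Local Open Scope ring_scope.
Local Open Scope classical_set_scope.
Local Open Scope quotient_scope.

(* A Z_2-grading on a vector space is given by its parity involution
   s : v |-> (-1)^[v] v; [hpart s p v] is the component of v of degree p. *)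
Section Grading.
Variables (K : numFieldType) (V : lmodType K) (s : V -> V).

Definition homog (p : bool) (v : V) : Prop := s v = (-1) ^+ p *: v.

Definition hpart (p : bool) (v : V) : V := 2^-1 *: (v + (-1) ^+ p *: s v).

Hypotheses (s_lin : linear s) (sK : involutive s).

Lemma hpart_linear p : linear (hpart p).
Proof.
move=> k x y; rewrite /hpart s_lin !scalerDr !scalerA.
rewrite addrACA; congr (_ + _ + _); rewrite mulrC // -?mulrA.
by congr (_ *: _); rewrite mulrC -mulrA.
Qed.

Lemma hpart_homog p v : homog p (hpart p v).
Proof.
have sZ k x : s (k *: x) = k *: s x.
  have s0 : s 0 = 0 by have := s_lin (-1) 0 0; rewrite !scaleN1r !addNr.
  by have := s_lin k x 0; rewrite s0 !addr0.
have sD x y : s (x + y) = s x + s y by have := s_lin 1 x y; rewrite !scale1r.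
rewrite /homog /hpart sZ sD sZ sK scalerA mulrC -scalerA; congr (_ *: _).
by rewrite scalerDr scalerA -expr2 sqrr_sign scale1r addrC.
Qed.

Lemma hpart_sum v : \sum_(p : bool) hpart p v = v.
Proof.
rewrite big_bool /= /hpart expr0 expr1 scale1r scaleN1r -scalerDr addrACA addNr.
by rewrite addr0 -mulr2n -scaler_nat scalerA mulVf ?scale1r // pnatr_eq0.
Qed.

Lemma hpart_id p q v : homog p v -> hpart q v = if q == p then v else 0.
Proof.
rewrite /homog /hpart => ->; rewrite scalerA -signr_addb.
case: eqP => [->|/eqP]; rewrite ?addbb ?expr0 ?scale1r.
  by rewrite -mulr2n -scaler_nat scalerA mulVf ?scale1r // pnatr_eq0.
by case: p q => [] [] // _; rewrite /= expr1 scaleN1r subrr scaler0.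
Qed.

End Grading.

(* The bilinear map equal to (-1)^([x][y]) f x y on homogeneous x, y
   (see [ssum_homog]). *)
Definition ssum (K : numFieldType) (V W M : lmodType K) (sV : V -> V)
    (sW : W -> W) (f : V -> W -> M) (x : V) (y : W) : M :=
  \sum_(p : bool) \sum_(q : bool)
     (-1) ^+ (p && q) *: f (hpart sV p x) (hpart sW q y).

Definition bilin (K : numFieldType) (V W M : lmodType K) (f : V -> W -> M) :=
  (forall y, linear (f^~ y)) /\ (forall x, linear (f x)).

Section Ssum.
Variables (K : numFieldType) (V W M : lmodType K) (sV : V -> V) (sW : W -> W).
Hypotheses (sV_lin : linear sV) (sW_lin : linear sW).

Lemma linear0' (A B : lmodType K) (f : A -> B) : linear f -> f 0 = 0.
Proof. by move=> fl; have := fl (-1) 0 0; rewrite !scaleN1r !addNr. Qed.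

Lemma linearZ' (A B : lmodType K) (f : A -> B) k x : linear f -> f (k *: x) = k *: f x.
Proof. by move=> fl; have := fl k x 0; rewrite (linear0' fl) !addr0. Qed.

Lemma linearD' (A B : lmodType K) (f : A -> B) x y : linear f -> f (x + y) = f x + f y.
Proof. by move=> fl; have := fl 1 x y; rewrite !scale1r. Qed.

Lemma ssum_bilin (f : V -> W -> M) : bilin f -> bilin (ssum sV sW f).
Proof.
move=> [fl fr]; split=> [y k x x'|x k y y']; rewrite /ssum.
all: rewrite scaler_sumr -big_split; apply: eq_bigr => p _ /=.
all: rewrite scaler_sumr -big_split; apply: eq_bigr => q _ /=.
  by rewrite hpart_linear // fl scalerDr !scalerA mulrC.
by rewrite hpart_linear // fr scalerDr !scalerA mulrC.
Qed.

Lemma ssum_homog (f : V -> W -> M) p q x y : bilin f ->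
  homog sV p x -> homog sW q y -> ssum sV sW f x y = (-1) ^+ (p && q) *: f x y.
Proof.
move=> [fl fr] hx hy; rewrite /ssum (bigD1 p) //= (bigD1 q) //=.
rewrite (hpart_id _ hx) (hpart_id _ hy) !eqxx.
rewrite !big1 ?addr0 // => [p' /negPf np|q' /negPf nq].
  rewrite big1 // => q' _; rewrite (hpart_id _ hx) np.
  by rewrite (linear0' (fl _)) scaler0.
by rewrite (hpart_id _ hy) nq (linear0' (fr _)) scaler0.
Qed.

End Ssum.

(* V (x) W: formal expressions in the v (x) w modulo the congruence generated
   by bilinearity and the vector space axioms. *)
Section Tensor.
Variables (K : numFieldType) (V W : lmodType K).

Inductive tterm :=
  | TZero | TPure of V & W | TAdd of tterm & tterm | TScale of K & tterm.

Inductive teq : tterm -> tterm -> Prop :=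
  | teq_refl a : teq a a
  | teq_sym a b : teq a b -> teq b a
  | teq_trans a b c : teq a b -> teq b c -> teq a c
  | teq_add a a' b b' : teq a a' -> teq b b' -> teq (TAdd a b) (TAdd a' b')
  | teq_scale k a a' : teq a a' -> teq (TScale k a) (TScale k a')
  | teq_addA a b c : teq (TAdd a (TAdd b c)) (TAdd (TAdd a b) c)
  | teq_addC a b : teq (TAdd a b) (TAdd b a)
  | teq_add0 a : teq (TAdd TZero a) a
  | teq_addN a : teq (TAdd (TScale (-1) a) a) TZero
  | teq_scaleA k l a : teq (TScale k (TScale l a)) (TScale (k * l) a)
  | teq_scale1 a : teq (TScale 1 a) a
  | teq_scaleDr k a b : teq (TScale k (TAdd a b)) (TAdd (TScale k a) (TScale k b))
  | teq_scaleDl k l a : teq (TScale (k + l) a) (TAdd (TScale k a) (TScale l a))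
  | teq_purel k v v' w :
      teq (TPure (k *: v + v') w) (TAdd (TScale k (TPure v w)) (TPure v' w))
  | teq_purer k v w w' :
      teq (TPure v (k *: w + w')) (TAdd (TScale k (TPure v w)) (TPure v w')).

HB.instance Definition _ := gen_eqMixin tterm.
HB.instance Definition _ := gen_choiceMixin tterm.

Definition teqb : rel tterm := fun a b => `[< teq a b >].

Lemma teqb_refl : reflexive teqb.
Proof. by move=> a; apply/asboolP/teq_refl. Qed.
Lemma teqb_sym : symmetric teqb.
Proof. by move=> a b; apply/asboolP/asboolP; apply: teq_sym. Qed.
Lemma teqb_trans : transitive teqb.
Proof.
by move=> b a c /asboolP ab /asboolP bc; apply/asboolP; apply: teq_trans ab bc.
Qed.

Canonical teqb_equiv := EquivRel teqb teqb_refl teqb_sym teqb_trans.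

Definition tens := {eq_quot teqb}%qT.
HB.instance Definition _ := Choice.on tens.
HB.instance Definition _ := EqQuotient.on tens.

Definition tpi (a : tterm) : tens := \pi_tens a.

Lemma tens_eqP a b : teq a b <-> tpi a = tpi b.
Proof.
by split=> [ab|/eqmodP/asboolP //]; apply/eqmodP/asboolP.
Qed.

Lemma tpiK (x : tens) : tpi (repr x) = x.
Proof. exact: reprK. Qed.

Lemma tens_repr a : teq (repr (tpi a)) a.
Proof. by apply/tens_eqP; rewrite tpiK. Qed.

Definition tadd (x y : tens) : tens := tpi (TAdd (repr x) (repr y)).
Definition tscale (k : K) (x : tens) : tens := tpi (TScale k (repr x)).
Definition tzero : tens := tpi TZero.
Definition topp (x : tens) := tscale (-1) x.

Lemma tadd_pi a b : tadd (tpi a) (tpi b) = tpi (TAdd a b).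
Proof. by apply/tens_eqP/teq_add; apply: tens_repr. Qed.
Lemma tscale_pi k a : tscale k (tpi a) = tpi (TScale k a).
Proof. by apply/tens_eqP/teq_scale; apply: tens_repr. Qed.

Lemma tpiW (P : tens -> Prop) : (forall a, P (tpi a)) -> forall x, P x.
Proof. by move=> Pa x; rewrite -[x]tpiK; apply: Pa. Qed.

Local Opaque tadd tscale.

Ltac tquot := repeat elim/tpiW=> ?; rewrite ?(tadd_pi, tscale_pi).

Lemma taddA : associative tadd.
Proof. by tquot; apply/tens_eqP/teq_addA. Qed.
Lemma taddC : commutative tadd.
Proof. by tquot; apply/tens_eqP/teq_addC. Qed.
Lemma tadd0 : left_id tzero tadd.
Proof. by rewrite /tzero; tquot; apply/tens_eqP/teq_add0. Qed.
Lemma taddN : left_inverse tzero topp tadd.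
Proof. by rewrite /tzero /topp; tquot; apply/tens_eqP/teq_addN. Qed.

HB.instance Definition _ := GRing.isZmodule.Build tens taddA taddC tadd0 taddN.

Lemma taddE (x y : tens) : x + y = tadd x y. Proof. by []. Qed.

Lemma tscaleA k l x : tscale k (tscale l x) = tscale (k * l) x.
Proof. by move: x; tquot; apply/tens_eqP/teq_scaleA. Qed.
Lemma tscale1 : left_id 1 tscale.
Proof. by tquot; apply/tens_eqP/teq_scale1. Qed.
Lemma tscaleDr : right_distributive tscale +%R.
Proof.
move=> k x y; rewrite -[x]tpiK -[y]tpiK -[LHS]/(tscale _ (tadd _ _)).
by rewrite -[RHS]/(tadd _ _) !(tadd_pi, tscale_pi); apply/tens_eqP/teq_scaleDr.
Qed.
Lemma tscaleDl x : {morph tscale^~ x : k l / k + l}.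
Proof.
move=> k l; rewrite -[x]tpiK -[RHS]/(tadd _ _) !(tadd_pi, tscale_pi).
by apply/tens_eqP/teq_scaleDl.
Qed.

HB.instance Definition _ :=
  GRing.Zmodule_isLmodule.Build K tens tscaleA tscale1 tscaleDr tscaleDl.

Lemma tscaleE k (x : tens) : k *: x = tscale k x. Proof. by []. Qed.

Definition pure (v : V) (w : W) : tens := tpi (TPure v w).

Lemma pure_bilin : bilin pure.
Proof.
split=> [w k v v'|v k w w'].
  rewrite /pure -[RHS]/(tadd (tscale _ _) _) !(tscale_pi, tadd_pi).
  exact: (proj1 (tens_eqP _ _) (teq_purel _ _ _ _)).
rewrite /pure -[RHS]/(tadd (tscale _ _) _) !(tscale_pi, tadd_pi).
exact: (proj1 (tens_eqP _ _) (teq_purer _ _ _ _)).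
Qed.

Lemma tens_ind (P : tens -> Prop) :
  (forall v w, P (pure v w)) -> (forall k x y, P x -> P y -> P (k *: x + y)) ->
  P 0 -> forall x, P x.
Proof.
move=> Pp PD P0 x; rewrite -[x]tpiK; elim: (repr x) => {x}.
- exact: P0.
- exact: Pp.
- move=> a Pa b Pb; rewrite -tadd_pi -taddE.
  by rewrite -[X in X + _]scale1r; apply: PD.
- move=> k a Pa; rewrite -tscale_pi -tscaleE.
  by rewrite -[_ *: _]addr0; apply: PD.
Qed.

Variable M : lmodType K.

Fixpoint teval (f : V -> W -> M) (t : tterm) : M :=
  match t with
  | TZero => 0
  | TPure v w => f v w
  | TAdd a b => teval f a + teval f b
  | TScale k a => k *: teval f a
  end.

(* The linear map V (x) W -> M induced by a bilinear f (see [tliftP]). *)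
Definition tlift (f : V -> W -> M) (x : tens) : M := teval f (repr x).

Lemma tevalP f a b : bilin f -> teq a b -> teval f a = teval f b.
Proof.
move=> [fl fr]; elim=> {a b} //=.
- by move=> a b c _ -> _ ->.
- by move=> a a' b b' _ -> _ ->.
- by move=> k a a' _ ->.
- by move=> *; rewrite addrA.
- by move=> *; rewrite addrC.
- by move=> *; rewrite add0r.
- by move=> *; rewrite scaleN1r addNr.
- by move=> *; rewrite scalerA.
- by move=> *; rewrite scale1r.
- by move=> *; rewrite scalerDr.
- by move=> *; rewrite scalerDl.
- by move=> *; rewrite fl.
- by move=> *; rewrite fr.
Qed.

Lemma tliftP f : bilin f ->
  linear (tlift f) /\ (forall v w, tlift f (pure v w) = f v w).
Proof.
move=> fb; have lpi a : tlift f (tpi a) = teval f a.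
  exact/tevalP/tens_repr.
split=> [k x y|v w]; last exact: lpi.
elim/tpiW: x => x; elim/tpiW: y => y.
by rewrite taddE tscaleE tscale_pi tadd_pi !lpi.
Qed.

End Tensor.
Arguments pure {K V W}.

Record is_alg (K : numFieldType) (M : lmodType K) (one : M) (mul : M -> M -> M) :
    Prop := IsAlg {
  alg_bilin : bilin mul;
  alg_mulA : associative mul;
  alg_mul1l : left_id one mul;
  alg_mul1r : right_id one mul
}.

Record lieSuper (K : numFieldType) := LieSuper {
  lie_sort :> lmodType K;
  lie_par : lie_sort -> lie_sort;
  lie_br : lie_sort -> lie_sort -> lie_sort;
  lie_par_linear : linear lie_par;
  lie_parK : involutive lie_par;
  lie_br_bilin : bilin lie_br;
  lie_br_par : forall x y, lie_par (lie_br x y) = lie_br (lie_par x) (lie_par y);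
  lie_br_skew : forall p q x y, homog lie_par p x -> homog lie_par q y ->
    lie_br x y = - ((-1) ^+ (p && q) *: lie_br y x);
  lie_jacobi : forall p q x y z, homog lie_par p x -> homog lie_par q y ->
    lie_br x (lie_br y z) =
    lie_br (lie_br x y) z + (-1) ^+ (p && q) *: lie_br y (lie_br x z)
}.
Arguments lie_par {K l}.
Arguments lie_br {K l}.

(* U(L): the unital associative algebra generated by the elements of L, subject
   to linearity of L -> U(L) and x y - (-1)^([x][y]) y x = [x, y]. *)
Section Enveloping.
Variables (K : numFieldType) (L : lieSuper K).

Inductive uterm :=
  | UGen of L | UZero | UOne
  | UAdd of uterm & uterm | UScale of K & uterm | UMul of uterm & uterm.

Inductive ueq : uterm -> uterm -> Prop :=
  | ueq_refl a : ueq a a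
  | ueq_sym a b : ueq a b -> ueq b a
  | ueq_trans a b c : ueq a b -> ueq b c -> ueq a c
  | ueq_add a a' b b' : ueq a a' -> ueq b b' -> ueq (UAdd a b) (UAdd a' b')
  | ueq_scale k a a' : ueq a a' -> ueq (UScale k a) (UScale k a')
  | ueq_mul a a' b b' : ueq a a' -> ueq b b' -> ueq (UMul a b) (UMul a' b')
  | ueq_addA a b c : ueq (UAdd a (UAdd b c)) (UAdd (UAdd a b) c)
  | ueq_addC a b : ueq (UAdd a b) (UAdd b a)
  | ueq_add0 a : ueq (UAdd UZero a) a
  | ueq_addN a : ueq (UAdd (UScale (-1) a) a) UZero
  | ueq_scaleA k l a : ueq (UScale k (UScale l a)) (UScale (k * l) a)
  | ueq_scale1 a : ueq (UScale 1 a) a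
  | ueq_scaleDr k a b : ueq (UScale k (UAdd a b)) (UAdd (UScale k a) (UScale k b))
  | ueq_scaleDl k l a : ueq (UScale (k + l) a) (UAdd (UScale k a) (UScale l a))
  | ueq_mulA a b c : ueq (UMul a (UMul b c)) (UMul (UMul a b) c)
  | ueq_mul1l a : ueq (UMul UOne a) a
  | ueq_mul1r a : ueq (UMul a UOne) a
  | ueq_mulDl a b c : ueq (UMul (UAdd a b) c) (UAdd (UMul a c) (UMul b c))
  | ueq_mulDr a b c : ueq (UMul a (UAdd b c)) (UAdd (UMul a b) (UMul a c))
  | ueq_scaleAl k a b : ueq (UScale k (UMul a b)) (UMul (UScale k a) b)
  | ueq_scaleAr k a b : ueq (UScale k (UMul a b)) (UMul a (UScale k b))
  | ueq_gen k x y : ueq (UGen (k *: x + y)) (UAdd (UScale k (UGen x)) (UGen y))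
  | ueq_br p q x y : homog lie_par p x -> homog lie_par q y ->
      ueq (UMul (UGen x) (UGen y))
          (UAdd (UScale ((-1) ^+ (p && q)) (UMul (UGen y) (UGen x)))
                (UGen (lie_br x y))).

HB.instance Definition _ := gen_eqMixin uterm.
HB.instance Definition _ := gen_choiceMixin uterm.

Definition ueqb : rel uterm := fun a b => `[< ueq a b >].

Lemma ueqb_refl : reflexive ueqb.
Proof. by move=> a; apply/asboolP/ueq_refl. Qed.
Lemma ueqb_sym : symmetric ueqb.
Proof. by move=> a b; apply/asboolP/asboolP; apply: ueq_sym. Qed.
Lemma ueqb_trans : transitive ueqb.
Proof.
by move=> b a c /asboolP ab /asboolP bc; apply/asboolP; apply: ueq_trans ab bc.
Qed.

Canonical ueqb_equiv := EquivRel ueqb ueqb_refl ueqb_sym ueqb_trans.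

Definition env := {eq_quot ueqb}%qT.
HB.instance Definition _ := Choice.on env.
HB.instance Definition _ := EqQuotient.on env.

Definition upi (a : uterm) : env := \pi_env a.

Lemma env_eqP a b : ueq a b <-> upi a = upi b.
Proof. by split=> [ab|/eqmodP/asboolP //]; apply/eqmodP/asboolP. Qed.

Lemma upiK (x : env) : upi (repr x) = x.
Proof. exact: reprK. Qed.

Lemma env_repr a : ueq (repr (upi a)) a.
Proof. by apply/env_eqP; rewrite upiK. Qed.

Definition uadd (x y : env) : env := upi (UAdd (repr x) (repr y)).
Definition umul (x y : env) : env := upi (UMul (repr x) (repr y)).
Definition uscale (k : K) (x : env) : env := upi (UScale k (repr x)).
Definition uzero : env := upi UZero.
Definition uone : env := upi UOne.
Definition uopp (x : env) := uscale (-1) x.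

Lemma uadd_pi a b : uadd (upi a) (upi b) = upi (UAdd a b).
Proof. by apply/env_eqP/ueq_add; apply: env_repr. Qed.
Lemma umul_pi a b : umul (upi a) (upi b) = upi (UMul a b).
Proof. by apply/env_eqP/ueq_mul; apply: env_repr. Qed.
Lemma uscale_pi k a : uscale k (upi a) = upi (UScale k a).
Proof. by apply/env_eqP/ueq_scale; apply: env_repr. Qed.

Let upiE := (uadd_pi, umul_pi, uscale_pi).
Lemma upiW (P : env -> Prop) : (forall a, P (upi a)) -> forall x, P x.
Proof. by move=> Pa x; rewrite -[x]upiK; apply: Pa. Qed.

Local Opaque uadd umul uscale.

Ltac uquot := rewrite /uzero /uone /uopp; repeat elim/upiW=> ?; rewrite ?upiE.

Lemma uaddA : associative uadd.
Proof. by uquot; apply/env_eqP/ueq_addA. Qed.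
Lemma uaddC : commutative uadd.
Proof. by uquot; apply/env_eqP/ueq_addC. Qed.
Lemma uadd0 : left_id uzero uadd.
Proof. by uquot; apply/env_eqP/ueq_add0. Qed.
Lemma uaddN : left_inverse uzero uopp uadd.
Proof. by uquot; apply/env_eqP/ueq_addN. Qed.

HB.instance Definition _ := GRing.isZmodule.Build env uaddA uaddC uadd0 uaddN.

Lemma uaddE (x y : env) : x + y = uadd x y. Proof. by []. Qed.

Lemma uscaleA k l x : uscale k (uscale l x) = uscale (k * l) x.
Proof. by move: x; uquot; apply/env_eqP/ueq_scaleA. Qed.
Lemma uscale1 : left_id 1 uscale.
Proof. by uquot; apply/env_eqP/ueq_scale1. Qed.
Lemma uscaleDr : right_distributive uscale +%R.
Proof. by move=> k x y; rewrite !uaddE; move: x y; uquot; apply/env_eqP/ueq_scaleDr. Qed.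
Lemma uscaleDl x : {morph uscale^~ x : k l / k + l}.
Proof. by move=> k l; rewrite !uaddE; move: x; uquot; apply/env_eqP/ueq_scaleDl. Qed.

HB.instance Definition _ :=
  GRing.Zmodule_isLmodule.Build K env uscaleA uscale1 uscaleDr uscaleDl.

Lemma uscaleE k (x : env) : k *: x = uscale k x. Proof. by []. Qed.

Section Eval.
Variables (M : lmodType K) (one : M) (mul : M -> M -> M) (f : L -> M).

Fixpoint ueval (t : uterm) : M :=
  match t with
  | UGen x => f x
  | UZero => 0
  | UOne => one
  | UAdd a b => ueval a + ueval b
  | UScale k a => k *: ueval a
  | UMul a b => mul (ueval a) (ueval b)
  end.

(* The algebra morphism U(L) -> (M, one, mul) extending f (see [env_liftP]). *)
Definition env_lift (x : env) : M := ueval (repr x).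

Definition lie_compat := linear f /\
  forall p q x y, homog lie_par p x -> homog lie_par q y ->
    mul (f x) (f y) = (-1) ^+ (p && q) *: mul (f y) (f x) + f (lie_br x y).

Hypotheses (Malg : is_alg one mul) (fP : lie_compat).

Lemma uevalP a b : ueq a b -> ueval a = ueval b.
Proof.
have [[ml mr] mA m1l m1r] := Malg; have [fl fb] := fP.
elim=> {a b} //=.
- by move=> a b c _ -> _ ->.
- by move=> a a' b b' _ -> _ ->.
- by move=> k a a' _ ->.
- by move=> a a' b b' _ -> _ ->.
- by move=> *; rewrite addrA.
- by move=> *; rewrite addrC.
- by move=> *; rewrite add0r.
- by move=> *; rewrite scaleN1r addNr.
- by move=> *; rewrite scalerA.
- by move=> *; rewrite scale1r.
- by move=> *; rewrite scalerDr.
- by move=> *; rewrite scalerDl.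
- by move=> a b c; rewrite (linearD' _ _ (ml _)).
- by move=> a b c; rewrite (linearD' _ _ (mr _)).
- by move=> k a b; rewrite (linearZ' _ _ (ml _)).
- by move=> k a b; rewrite (linearZ' _ _ (mr _)).
Qed.

Lemma env_lift_pi a : env_lift (upi a) = ueval a.
Proof. exact/uevalP/env_repr. Qed.

Lemma env_lift_linear : linear env_lift.
Proof.
move=> k x y; rewrite -[x]upiK -[y]upiK uaddE uscaleE !upiE.
by rewrite !env_lift_pi.
Qed.

Lemma env_lift_one : env_lift uone = one.
Proof. exact: env_lift_pi. Qed.

Lemma env_lift_mul x y : env_lift (umul x y) = mul (env_lift x) (env_lift y).
Proof. by rewrite -[x]upiK -[y]upiK upiE !env_lift_pi. Qed.

Lemma env_lift_gen x : env_lift (upi (UGen x)) = f x.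
Proof. exact: env_lift_pi. Qed.

End Eval.

Lemma umulA : associative umul.
Proof. by uquot; apply/env_eqP/ueq_mulA. Qed.
Lemma umul1l : left_id uone umul.
Proof. by uquot; apply/env_eqP/ueq_mul1l. Qed.
Lemma umul1r : right_id uone umul.
Proof. by uquot; apply/env_eqP/ueq_mul1r. Qed.
Lemma umulDl : left_distributive umul +%R.
Proof. by move=> x y z; rewrite !uaddE; move: x y z; uquot; apply/env_eqP/ueq_mulDl. Qed.
Lemma umulDr : right_distributive umul +%R.
Proof. by move=> x y z; rewrite !uaddE; move: x y z; uquot; apply/env_eqP/ueq_mulDr. Qed.

Lemma regular_alg : is_alg (1 : K^o) *%R.
Proof.
split; [split=> [y k x x'|x k y y'] |exact: mulrA|exact: mul1r|exact: mulr1].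
  by rewrite mulrDl /GRing.scale /= mulrA.
by rewrite mulrDr /GRing.scale /= mulrCA.
Qed.

Lemma counit_compat : lie_compat (M := K^o) *%R (fun=> 0).
Proof.
split=> [k x y|p q x y _ _]; first by rewrite scaler0 addr0.
by rewrite mulr0 scaler0 addr0.
Qed.

Lemma uone_neq0 : uone != uzero.
Proof.
apply/eqP => /(congr1 (env_lift (1 : K^o) *%R (fun=> 0))).
rewrite (env_lift_one regular_alg counit_compat).
rewrite (env_lift_pi regular_alg counit_compat) /=.
by move/eqP; rewrite oner_eq0.
Qed.

HB.instance Definition _ := GRing.Zmodule_isNzRing.Build env
  umulA umul1l umul1r umulDl umulDr uone_neq0.

Lemma uscaleAl k (x y : env) : k *: (x * y) = (k *: x) * y.
Proof. by rewrite !uscaleE -![_ * _]/(umul _ _); move: x y; uquot; apply/env_eqP/ueq_scaleAl. Qed.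
HB.instance Definition _ := GRing.Lmodule_isLalgebra.Build K env uscaleAl.
Lemma uscaleAr k (x y : env) : k *: (x * y) = x * (k *: y).
Proof. by rewrite !uscaleE -![_ * _]/(umul _ _); move: x y; uquot; apply/env_eqP/ueq_scaleAr. Qed.
HB.instance Definition _ := GRing.Lalgebra_isAlgebra.Build K env uscaleAr.

Definition iota_ (x : L) : env := upi (UGen x).

End Enveloping.

Lemma homog_ind (K : numFieldType) (V : lmodType K) (s : V -> V)
    (P : V -> Prop) : linear s -> involutive s ->
  (forall p v, homog s p v -> P v) -> (forall x y, P x -> P y -> P (x + y)) ->
  forall v, P v.
Proof.
move=> sl sK Ph PD v; rewrite -(hpart_sum s v) big_bool /=.
by apply: PD; apply: Ph; apply: hpart_homog.
Qed.

Section HopfEnveloping.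
Variables (K : numFieldType) (L : lieSuper K).
Local Notation U := (env L).
Local Notation i := (@iota_ K L).

Lemma env_alg : is_alg (1 : U) *%R.
Proof.
split; [split=> [y k x x'|x k y y'] |exact: mulrA|exact: mul1r|exact: mulr1].
  by rewrite mulrDl scalerAl.
by rewrite mulrDr scalerAr.
Qed.

Lemma iota_linear : linear i.
Proof.
move=> k x y; rewrite uaddE uscaleE /iota_ uscale_pi uadd_pi.
exact: (proj1 (env_eqP _ _) (ueq_gen _ _ _)).
Qed.

Lemma iota_br p q x y : homog lie_par p x -> homog lie_par q y ->
  i x * i y = (-1) ^+ (p && q) *: (i y * i x) + i (lie_br x y).
Proof.
move=> hx hy; rewrite uaddE uscaleE -![_ * _]/(umul _ _) /iota_.
rewrite !umul_pi uscale_pi uadd_pi.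
exact: (proj1 (env_eqP _ _) (ueq_br hx hy)).
Qed.

Lemma env_ind (P : U -> Prop) : P 1 -> (forall x, P (i x)) ->
  (forall k x y, P x -> P y -> P (k *: x + y)) ->
  (forall x y, P x -> P y -> P (x * y)) -> forall x, P x.
Proof.
move=> P1 Pi PD PM; have P0 : P 0 by have := PD (-1) _ _ P1 P1; rewrite scaleN1r addNr.
elim/upiW; elim=> //.
- move=> a Pa b Pb; rewrite -uadd_pi -uaddE.
  by rewrite -[X in X + _]scale1r; apply: PD.
- move=> k a Pa; rewrite -uscale_pi -uscaleE.
  by rewrite -[_ *: _]addr0; apply: PD.
- by move=> a Pa b Pb; rewrite -umul_pi; apply: PM.
Qed.

Lemma env_liftP (M : lmodType K) (one : M) mul (f : L -> M) :
  is_alg one mul -> lie_compat mul f ->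
  [/\ linear (env_lift one mul f), env_lift one mul f 1 = one,
      forall x y, env_lift one mul f (x * y) =
        mul (env_lift one mul f x) (env_lift one mul f y)
    & forall x, env_lift one mul f (i x) = f x].
Proof.
move=> Malg fP; split; [exact: env_lift_linear|exact: env_lift_one| |].
  exact: env_lift_mul.
exact: env_lift_gen.
Qed.

(* The parity involution x |-> (-1)^[x] x of U(L). *)
Definition upar : U -> U := env_lift 1 *%R (fun x => i (lie_par x)).

Lemma lie_par_homog p x : homog lie_par p x -> homog lie_par p (lie_par x : L).
Proof. by move=> hx; rewrite /homog {1}hx (linearZ' _ _ (@lie_par_linear _ L)). Qed.

Lemma upar_compat : lie_compat *%R (fun x : L => i (lie_par x)).
Proof.
split=> [k x y|p q x y hx hy]; first by rewrite lie_par_linear iota_linear.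
by rewrite lie_br_par; apply: iota_br; apply: lie_par_homog.
Qed.

Let uparP := env_liftP env_alg upar_compat.
Lemma upar_linear : linear upar. Proof. by case: uparP. Qed.
Lemma upar1 : upar 1 = 1. Proof. by case: uparP. Qed.
Lemma uparM x y : upar (x * y) = upar x * upar y. Proof. by case: uparP. Qed.
Lemma upar_iota x : upar (i x) = i (lie_par x). Proof. by case: uparP. Qed.

Lemma uparK : involutive upar.
Proof.
apply: env_ind => [|x|k x y xK yK|x y xK yK]; first by rewrite !upar1.
- by rewrite !upar_iota lie_parK.
- by rewrite !upar_linear xK yK.
- by rewrite !uparM xK yK.
Qed.

Lemma uhomog_ind (P : U -> Prop) : (forall p v, homog upar p v -> P v) ->
  (forall x y, P x -> P y -> P (x + y)) -> forall v, P v.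
Proof. exact: homog_ind upar_linear uparK. Qed.

Lemma homogM p q x y : homog upar p x -> homog upar q y ->
  homog upar (p (+) q) (x * y).
Proof.
by move=> hx hy; rewrite /homog uparM hx hy signr_addb -scalerA
   -scalerAl -scalerAr.
Qed.

Lemma homog1 : homog upar false 1.
Proof. by rewrite /homog upar1 expr0 scale1r. Qed.

Lemma homog_iota p x : homog lie_par p x -> homog upar p (i x).
Proof. by rewrite /homog upar_iota => ->; rewrite (linearZ' _ _ iota_linear). Qed.

Lemma homogD p x y : homog upar p x -> homog upar p y -> homog upar p (x + y).
Proof. by rewrite /homog (linearD' _ _ upar_linear) scalerDr => -> ->. Qed.

Lemma homogZ p k x : homog upar p x -> homog upar p (k *: x).
Proof.
by rewrite /homog (linearZ' _ _ upar_linear) => ->; rewrite !scalerA mulrC.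
Qed.

Definition ueps : U -> K^o := env_lift (1 : K^o) *%R (fun=> 0).

Lemma uepsP : [/\ linear ueps, ueps 1 = 1,
  forall x y, ueps (x * y) = ueps x * ueps y & forall x, ueps (i x) = 0].
Proof. exact: env_liftP (regular_alg K) (counit_compat L). Qed.

(* The product (-1)^([x][y]) y x of the super-opposite algebra, and the
   antipode S, with S(x) = - x on L and S(x y) = (-1)^([x][y]) S(y) S(x). *)
Definition sopmul : U -> U -> U := ssum upar upar (fun x y => y * x).

Definition antipode : U -> U := env_lift 1 sopmul (fun x => - i x).

Lemma mulC_bilin : bilin (fun x y : U => y * x).
Proof. by have [[ml mr] _ _ _] := env_alg; split. Qed.

Lemma sopmul_bilin : bilin sopmul.
Proof. exact: ssum_bilin upar_linear upar_linear _ mulC_bilin. Qed.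

Lemma sopmulE p q x y : homog upar p x -> homog upar q y ->
  sopmul x y = (-1) ^+ (p && q) *: (y * x).
Proof. exact: ssum_homog mulC_bilin. Qed.

Lemma sopmul_homog p q x y : homog upar p x -> homog upar q y ->
  homog upar (p (+) q) (sopmul x y).
Proof.
move=> hx hy; rewrite (sopmulE hx hy); apply: homogZ.
by rewrite addbC; apply: homogM.
Qed.

Lemma sop_alg : is_alg (1 : U) sopmul.
Proof.
have [ml mr] := sopmul_bilin; split=> //.
- move=> x y z; elim/uhomog_ind: x => [p x hx|x x' hx hx'];
    last by rewrite !(linearD' _ _ (ml _)) hx hx'.
  elim/uhomog_ind: y => [q y hy|y y' hy hy'];
    last by rewrite !(linearD' _ _ (ml _)) !(linearD' _ _ (mr _)) !(linearD' _ _ (ml _)) hy hy'.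
  elim/uhomog_ind: z => [r z hz|z z' hz hz'];
    last by rewrite !(linearD' _ _ (mr _)) hz hz'.
  rewrite (sopmulE hx (sopmul_homog hy hz)) (sopmulE hy hz).
  rewrite (sopmulE (sopmul_homog hx hy) hz) (sopmulE hx hy).
  rewrite -!scalerAl -!scalerAr !scalerA -!signr_addb mulrA.
  by congr (_ ^+ _ *: _); case: p q r {hx hy hz} => [] [] [].
- move=> x; elim/uhomog_ind: x => [p x hx|x x' hx hx'].
    by rewrite (sopmulE homog1 hx) expr0 scale1r mulr1.
  by rewrite (linearD' _ _ (mr _)) hx hx'.
- move=> x; elim/uhomog_ind: x => [p x hx|x x' hx hx'].
    by rewrite (sopmulE hx homog1) andbF expr0 scale1r mul1r.
  by rewrite (linearD' _ _ (ml _)) hx hx'.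
Qed.

Lemma antipode_compat : lie_compat sopmul (fun x : L => - i x).
Proof.
have [ml mr] := sopmul_bilin.
have mN x y : sopmul (- x) (- y) = sopmul x y.
  by rewrite -!scaleN1r (linearZ' _ _ (ml _)) (linearZ' _ _ (mr _)) scalerA mulN1r opprK scale1r.
split=> [k x y|p q x y hx hy]; first by rewrite iota_linear opprD scalerN.
rewrite !mN (sopmulE (homog_iota hx) (homog_iota hy)).
rewrite (sopmulE (homog_iota hy) (homog_iota hx)) scalerA [q && p]andbC.
by rewrite -expr2 sqrr_sign scale1r (iota_br hx hy) addrK.
Qed.

Lemma antipodeP : [/\ linear antipode, antipode 1 = 1,
  forall x y, antipode (x * y) = sopmul (antipode x) (antipode y)
  & forall x, antipode (i x) = - i x].
Proof. exact: env_liftP sop_alg antipode_compat. Qed.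

(* The product (x (x) y)(x' (x) y') = (-1)^([y][x']) xx' (x) yy' of U (x) U. *)
Definition tmul_pure (x y x' y' : U) : tens U U :=
  ssum upar upar (fun y x' => pure (x * x') (y * y')) y x'.

Definition tmul (z z' : tens U U) : tens U U :=
  tlift (fun x y => tlift (fun x' y' => tmul_pure x y x' y') z') z.

(* The coproduct: x |-> x (x) 1 + 1 (x) x on L. *)
Definition Delta : U -> tens U U :=
  env_lift (pure 1 1) tmul (fun x => pure (i x) 1 + pure 1 (i x)).

Lemma tmul_pure_bilin x y : bilin (tmul_pure x y).
Proof.
have [ml mr] := alg_bilin env_alg; have [pl pr] := @pure_bilin K U U.
have b y' : bilin (fun y x' : U => pure (x * x') (y * y')).
  by split=> [x' k a b|y0 k a b]; rewrite ?ml ?mr ?pl ?pr.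
split=> [y'|x' k a c].
  by have [_] := ssum_bilin upar_linear upar_linear (b y'); apply.
rewrite /tmul_pure /ssum scaler_sumr -big_split; apply: eq_bigr => p _ /=.
rewrite scaler_sumr -big_split; apply: eq_bigr => q _ /=.
by rewrite mr pr scalerDr !scalerA mulrC.
Qed.

Lemma tmul_pure_bilin' x' y' : bilin (fun x y => tmul_pure x y x' y').
Proof.
have [ml mr] := alg_bilin env_alg; have [pl pr] := @pure_bilin K U U.
have b x : bilin (fun y x' : U => pure (x * x') (y * y')).
  by split=> [x0 k a b|y0 k a b]; rewrite ?ml ?mr ?pl ?pr.
split=> [y k a c|x].
  rewrite /tmul_pure /ssum scaler_sumr -big_split; apply: eq_bigr => p _ /=.
  rewrite scaler_sumr -big_split; apply: eq_bigr => q _ /=.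
  by rewrite ml pl scalerDr !scalerA mulrC.
by have [+ _] := ssum_bilin upar_linear upar_linear (b x); apply.
Qed.

Lemma tlift_fun_linear (V W M : lmodType K) (f g h : V -> W -> M) k z :
  bilin f -> bilin g -> bilin h ->
  (forall v w, h v w = k *: f v w + g v w) ->
  tlift h z = k *: tlift f z + tlift g z.
Proof.
move=> /tliftP[fl fp] /tliftP[gl gp] /tliftP[hl hp] e.
elim/tens_ind: z => [v w|l x y xP yP|]; first by rewrite hp fp gp.
  rewrite hl fl gl xP yP !scalerDr !scalerA addrACA; congr (_ + _ + _).
  by rewrite mulrC.
by rewrite (linear0' fl) (linear0' gl) (linear0' hl) scaler0 addr0.
Qed.

Lemma tmul_bilin : bilin tmul.
Proof.
have b z' : bilin (fun x y => tlift (fun x' y' => tmul_pure x y x' y') z').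
  split=> [y k a c|x k a c]; apply: tlift_fun_linear => [||| v w];
    try exact: tmul_pure_bilin.
    by have [+ _] := tmul_pure_bilin' v w; apply.
  by have [_ +] := tmul_pure_bilin' v w; apply.
split=> [z'|z]; first by have [] := tliftP (b z').
move=> k x y; apply: tlift_fun_linear => // v w.
by have [+ _] := tliftP (tmul_pure_bilin v w); apply.
Qed.

Lemma tmulE q p' x y x' y' : homog upar q y -> homog upar p' x' ->
  tmul (pure x y) (pure x' y') =
  (-1) ^+ (q && p') *: pure (x * x') (y * y').
Proof.
have [ml mr] := alg_bilin env_alg; have [pl pr] := @pure_bilin K U U.
move=> hy hx'; have b z' : bilin (fun x y => tlift (fun x' y' => tmul_pure x y x' y') z').
  split=> [y0 k a c|x0 k a c]; apply: tlift_fun_linear => [||| v w];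
    try exact: tmul_pure_bilin.
    by have [+ _] := tmul_pure_bilin' v w; apply.
  by have [_ +] := tmul_pure_bilin' v w; apply.
rewrite /tmul (proj2 (tliftP (b _))) (proj2 (tliftP (tmul_pure_bilin _ _))).
rewrite /tmul_pure; apply: ssum_homog => //.
by split=> [x0 k a c|y0 k a c]; rewrite ?ml ?mr ?pl ?pr.
Qed.

Lemma tens_homog_ind (P : tens U U -> Prop) :
  (forall p q x y, homog upar p x -> homog upar q y -> P (pure x y)) ->
  (forall k z z', P z -> P z' -> P (k *: z + z')) -> forall z, P z.
Proof.
move=> Pp PD; have [pl pr] := @pure_bilin K U U.
have P0 : P 0.
  have := Pp _ _ _ _ homog1 homog1 => /[dup] h /(PD (-1) _ _ h).
  by rewrite scaleN1r addNr.
have PD' z z' : P z -> P z' -> P (z + z').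
  by move=> hz; rewrite -[z]scale1r; apply: PD.
apply: tens_ind => // x y.
elim/uhomog_ind: x => [p x hx|x x' hx hx'];
  last by rewrite (linearD' _ _ (pl _)); apply: PD'.
elim/uhomog_ind: y => [q y hy|y y' hy hy'].
  exact: Pp hx hy.
by rewrite (linearD' _ _ (pr _)); apply: PD'.
Qed.

Lemma tens_alg : is_alg (pure 1 1 : tens U U) tmul.
Proof.
have [ml mr] := tmul_bilin; split=> //.
- move=> x y z.
  elim/tens_homog_ind: x => [p q x1 x2 hx1 hx2|k x x' hx hx'];
    last by rewrite !ml hx hx'.
  elim/tens_homog_ind: y => [p' q' y1 y2 hy1 hy2|k y y' hy hy'];
    last by rewrite !(ml, mr) hy hy'.
  elim/tens_homog_ind: z => [p'' q'' z1 z2 hz1 hz2|k z z' hz hz'];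
    last by rewrite !mr hz hz'.
  rewrite (tmulE _ _ hy2 hz1) (tmulE _ _ hx2 hy1).
  rewrite (linearZ' _ _ (ml _)) (linearZ' _ _ (mr _)).
  rewrite (tmulE _ _ hx2 (homogM hy1 hz1)) (tmulE _ _ (homogM hx2 hy2) hz1).
  rewrite !scalerA -!signr_addb !mulrA; congr (_ ^+ _ *: _).
  by case: (q) (p') (q') (p'') => [] [] [] [].
- move=> z; elim/tens_homog_ind: z => [p q x y hx hy|k x y hx hy].
    by rewrite (tmulE _ _ homog1 hx) !mul1r expr0 scale1r.
  by rewrite mr hx hy.
- move=> z; elim/tens_homog_ind: z => [p q x y hx hy|k x y hx hy].
    by rewrite (tmulE _ _ hy homog1) !mulr1 andbF expr0 scale1r.
  by rewrite ml hx hy.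
Qed.

Lemma Delta_compat :
  lie_compat tmul (fun x : L => pure (i x) 1 + pure 1 (i x)).
Proof.
have [ml mr] := tmul_bilin; have [pl pr] := @pure_bilin K U U.
split=> [k x y|p q x y hx hy].
  by rewrite !iota_linear pl pr scalerDr addrACA.
have [hix hiy] := (homog_iota hx, homog_iota hy).
rewrite !(linearD' _ _ (ml _)) !(linearD' _ _ (mr _)).
rewrite !(tmulE _ _ homog1 hix, tmulE _ _ homog1 hiy, tmulE _ _ homog1 homog1).
rewrite !(tmulE _ _ hix homog1, tmulE _ _ hiy homog1).
rewrite (tmulE _ _ hix hiy) (tmulE _ _ hiy hix).
rewrite !(mul1r, mulr1, andbF, expr0, scale1r) (iota_br hx hy).
rewrite (linearD' _ _ (pl _)) (linearD' _ _ (pr _)).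
rewrite (linearZ' _ _ (pl _)) (linearZ' _ _ (pr _)) !scalerDr !scalerA.
rewrite [in (-1) ^+ (q && p)]andbC -expr2 sqrr_sign scale1r.
set A := pure (i y * i x) 1; set B := pure (i (lie_br x y)) 1.
set C := pure 1 (i y * i x); set D := pure 1 (i (lie_br x y)).
set E := pure (i x) (i y); set F := pure (i y) (i x).
move: (_ *: A) (_ *: C) (_ *: F) => a c f.
by rewrite !addrA [LHS](ACl (1*4*3*5*2*6)).
Qed.

Lemma DeltaP : [/\ linear Delta, Delta 1 = pure 1 1,
  forall x y, Delta (x * y) = tmul (Delta x) (Delta y)
  & forall x, Delta (i x) = pure (i x) 1 + pure 1 (i x)].
Proof. exact: env_liftP tens_alg Delta_compat. Qed.

End HopfEnveloping.

Section MatrixSuper.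
Variables (K : numFieldType) (m k : nat).
Local Notation M := 'M[K]_(m + k).

(* K^(m|k) has its first m coordinates even and its last k coordinates odd. *)
Definition pmx : M := block_mx 1%:M 0 0 (- 1%:M).

Definition mpar (X : M) : M := pmx *m X *m pmx.

Definition mbr (X Y : M) : M :=
  X *m Y - ssum mpar mpar (fun X Y => Y *m X) X Y.

Lemma pmxK : pmx *m pmx = 1%:M.
Proof.
rewrite mulmx_block !(mul0mx, mulmx0, mul1mx, addr0, add0r) mulNmx mulmxN.
by rewrite mulmx1 opprK -scalar_mx_block.
Qed.

Lemma mpar_linear : linear mpar.
Proof. by move=> c X Y; rewrite /mpar mulmxDr mulmxDl -scalemxAr -scalemxAl. Qed.

Lemma mparK : involutive mpar.
Proof. by move=> X; rewrite /mpar !mulmxA pmxK mul1mx -mulmxA pmxK mulmx1. Qed.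

Lemma mparM X Y : mpar (X *m Y) = mpar X *m mpar Y.
Proof. by rewrite /mpar !mulmxA -[_ *m pmx *m pmx]mulmxA pmxK mulmx1. Qed.

Lemma mulmx_bilin : bilin (fun X Y : M => X *m Y).
Proof.
split=> [Y c X X'|X c Y Y']; first by rewrite mulmxDl scalemxAl.
by rewrite mulmxDr scalemxAr.
Qed.

Lemma mulmxC_bilin : bilin (fun X Y : M => Y *m X).
Proof. by have [ml mr] := mulmx_bilin; split. Qed.

Lemma mx_alg : is_alg (1%:M : M) (fun X Y => X *m Y).
Proof. by split; [exact: mulmx_bilin|exact: mulmxA|exact: mul1mx|exact: mulmx1]. Qed.

Lemma mbr_bilin : bilin mbr.
Proof.
have [ml mr] := mulmx_bilin.
have [sl sr] := ssum_bilin mpar_linear mpar_linear mulmxC_bilin.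
split=> [Y c X X'|X c Y Y']; rewrite /mbr.
  by rewrite sl ml scalerBr opprD addrACA.
by rewrite sr mr scalerBr opprD addrACA.
Qed.

Lemma mbrE p q X Y : homog mpar p X -> homog mpar q Y ->
  mbr X Y = X *m Y - (-1) ^+ (p && q) *: (Y *m X).
Proof. by move=> hX hY; rewrite /mbr (ssum_homog mulmxC_bilin hX hY). Qed.

Local Opaque mbr.

Lemma mhomog_ind (P : M -> Prop) : (forall p X, homog mpar p X -> P X) ->
  (forall X Y, P X -> P Y -> P (X + Y)) -> forall X, P X.
Proof. exact: homog_ind mpar_linear mparK. Qed.

Lemma mhomogM p q X Y : homog mpar p X -> homog mpar q Y ->
  homog mpar (p (+) q) (X *m Y).
Proof.
by move=> hX hY; rewrite /homog mparM hX hY signr_addb -scalemxAl -scalemxAr scalerA.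
Qed.

Lemma mhomog_br p q X Y : homog mpar p X -> homog mpar q Y ->
  homog mpar (p (+) q) (mbr X Y).
Proof.
move=> hX hY; rewrite (mbrE hX hY) /homog.
have /= hXY := mhomogM hX hY; have /= hYX := mhomogM hY hX.
rewrite -scaleNr addrC mpar_linear hXY hYX addbC scalerDr !scalerA.
by rewrite [_ * _ ^+ (p (+) q)]mulrC.
Qed.

Lemma mbr_par X Y : mpar (mbr X Y) = mbr (mpar X) (mpar Y).
Proof.
have [bl br] := mbr_bilin; have pl := mpar_linear.
have pD A B : mpar (A + B) = mpar A + mpar B := linearD' A B pl.
have bDl A B C : mbr (A + B) C = mbr A C + mbr B C := linearD' A B (bl C).
have bDr A B C : mbr A (B + C) = mbr A B + mbr A C := linearD' B C (br A).
elim/mhomog_ind: X => [p X hX|X X' hX hX'].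
  elim/mhomog_ind: Y => [q Y hY|Y Y' hY hY'].
    rewrite (mhomog_br hX hY) hX hY (linearZ' _ _ (bl _)) (linearZ' _ _ (br _)).
    by rewrite scalerA signr_addb.
  by rewrite bDr pD [mpar (Y + Y')]pD bDr hY hY'.
by rewrite bDl pD [mpar (X + X')]pD bDl hX hX'.
Qed.

Lemma mbr_skew p q X Y : homog mpar p X -> homog mpar q Y ->
  mbr X Y = - ((-1) ^+ (p && q) *: mbr Y X).
Proof.
move=> hX hY; rewrite (mbrE hX hY) (mbrE hY hX) scalerBr scalerA [q && p]andbC.
by rewrite -expr2 sqrr_sign scale1r opprB.
Qed.

Lemma mbr_jacobi p q X Y Z : homog mpar p X -> homog mpar q Y ->
  mbr X (mbr Y Z) = mbr (mbr X Y) Z + (-1) ^+ (p && q) *: mbr Y (mbr X Z).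
Proof.
have [bl br] := mbr_bilin => hX hY.
have bDr A B C : mbr A (B + C) = mbr A B + mbr A C := linearD' B C (br A).
elim/mhomog_ind: Z => [r Z hZ|Z Z' hZ hZ']; last first.
  rewrite (bDr Y Z Z') (bDr X Z Z') (bDr X (mbr Y Z)) (bDr (mbr X Y) Z Z').
  rewrite (bDr Y (mbr X Z) (mbr X Z')).
  rewrite hZ hZ'.
  rewrite (scalerDr _ (mbr Y (mbr X Z))).
  exact: addrACA.
rewrite (mbrE hX (mhomog_br hY hZ)) (mbrE hY hZ).
rewrite (mbrE (mhomog_br hX hY) hZ) (mbrE hX hY).
rewrite (mbrE hY (mhomog_br hX hZ)) (mbrE hX hZ).
rewrite !(mulmxBl, mulmxBr) -!scalemxAl -!scalemxAr !mulmxA.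
set XYZ := X *m Y *m Z; set XZY := X *m Z *m Y; set YXZ := Y *m X *m Z.
set YZX := Y *m Z *m X; set ZXY := Z *m X *m Y; set ZYX := Z *m Y *m X.
apply/matrixP => a b; rewrite !mxE.
move: (XYZ a b) (XZY a b) (YXZ a b) (YZX a b) (ZXY a b) (ZYX a b).
by case: p q r {hX hY hZ} => [] [] [] x1 x2 x3 x4 x5 x6 /=;
  rewrite ?(expr0, expr1); ring.
Qed.

(* The Lie superalgebra structure on a subspace of gl(m|k) stable by the parity
   involution and by the superbracket. *)
Section SubLie.
Variable V : {vspace M}.
Hypotheses (Vpar : forall X, X \in V -> mpar X \in V)
  (Vbr : forall X Y, X \in V -> Y \in V -> mbr X Y \in V).
Local Notation g := (subvs_of V).

Definition spar (x : g) : g := vsproj V (mpar (vsval x)).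
Definition sbr (x y : g) : g := vsproj V (mbr (vsval x) (vsval y)).

Lemma val_spar x : vsval (spar x) = mpar (vsval x).
Proof. by rewrite vsprojK // Vpar // subvsP. Qed.
Lemma val_sbr x y : vsval (sbr x y) = mbr (vsval x) (vsval y).
Proof. by rewrite vsprojK // Vbr // subvsP. Qed.

Lemma spar_linear : linear spar.
Proof. by move=> c x y; rewrite /spar linearP mpar_linear linearP. Qed.
Lemma sparK : involutive spar.
Proof. by move=> x; apply: val_inj; rewrite /= !val_spar mparK. Qed.
Lemma sbr_bilin : bilin sbr.
Proof.
have [bl br] := mbr_bilin.
by split=> [y c x x'|x c y y']; rewrite /sbr linearP ?bl ?br linearP.
Qed.
Lemma sbr_par x y : spar (sbr x y) = sbr (spar x) (spar y).
Proof. by apply: val_inj; rewrite /= !(val_spar, val_sbr) mbr_par. Qed.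
Lemma val_homog p x : homog spar p x -> homog mpar p (vsval x).
Proof. by rewrite /homog -val_spar => ->; rewrite linearZ. Qed.
Lemma sbr_skew p q x y : homog spar p x -> homog spar q y ->
  sbr x y = - ((-1) ^+ (p && q) *: sbr y x).
Proof.
move=> /val_homog hx /val_homog hy; apply: val_inj.
by rewrite -scaleN1r scalerA linearZ /= !val_sbr (mbr_skew hx hy) -scaleN1r scalerA.
Qed.
Lemma sbr_jacobi p q x y z : homog spar p x -> homog spar q y ->
  sbr x (sbr y z) = sbr (sbr x y) z + (-1) ^+ (p && q) *: sbr y (sbr x z).
Proof.
move=> /val_homog hx /val_homog hy; apply: val_inj.
apply: (etrans (val_sbr x (sbr y z))); rewrite (val_sbr y z).
apply: (etrans (mbr_jacobi (vsval z) hx hy)).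
rewrite -(val_sbr x y) -(val_sbr x z) -(val_sbr (sbr x y) z).
by rewrite -(val_sbr y (sbr x z)).
Qed.

Definition mxlie : lieSuper K := LieSuper spar_linear sparK sbr_bilin sbr_par
  sbr_skew sbr_jacobi.

Definition mxrep : env mxlie -> M :=
  env_lift 1%:M (fun X Y : M => X *m Y) (fun x : mxlie => vsval x).

Lemma mxrep_compat :
  lie_compat (fun X Y : M => X *m Y) (fun x : mxlie => vsval (x : g)).
Proof.
split=> [c x y|p q x y /val_homog hx /val_homog hy] //.
by rewrite /= val_sbr (mbrE hx hy) addrC subrK.
Qed.

End SubLie.

Section EvenPart.
Variable V : {vspace M}.

Definition even_part : {vspace M} :=
  (V :&: lker (linfun (fun X : M => mpar X - X)))%VS.

Lemma even_partP X : (X \in even_part) = (X \in V) && (mpar X == X).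
Proof.
pose f (X : M) := mpar X - X.
have fl : linear f by move=> c A B; rewrite /f mpar_linear scalerBr opprD addrACA.
pose flin := HB.pack_for {linear M -> M} f
  (GRing.isLinear.Build _ _ _ _ f fl).
rewrite memv_cap memv_ker -[linfun _]/(linfun flin) lfunE /= /f.
by rewrite subr_eq0.
Qed.

Lemma even_par X : X \in even_part -> mpar X \in even_part.
Proof. by rewrite even_partP => /andP[XV /eqP eX]; rewrite eX even_partP XV eX eqxx. Qed.

Lemma even_br : (forall X Y, X \in V -> Y \in V -> mbr X Y \in V) ->
  forall X Y, X \in even_part -> Y \in even_part -> mbr X Y \in even_part.
Proof.
move=> Vbr X Y; rewrite !even_partP => /andP[XV /eqP eX] /andP[YV /eqP eY].
by rewrite Vbr // mbr_par eX eY eqxx.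
Qed.

End EvenPart.
End MatrixSuper.

(* osp(G): the X in gl(m|k) with (X u, v) + (-1)^([X][u]) (u, X v) = 0 for the
   bilinear form (u, v) = u^T G v. *)
Section OrthoSymplectic.
Variables (K : numFieldType) (m k : nat) (G : 'M[K]_(m + k)).
Local Notation M := 'M[K]_(m + k).

Definition msign (p : bool) : M := if p then pmx K m k else 1%:M.

Definition osp_def (X : M) : M := \sum_(p : bool)
  ((hpart (@mpar K m k) p X)^T *m G + msign p *m G *m hpart (@mpar K m k) p X).

Definition osp_space : {vspace M} := lker (linfun osp_def).

Hypothesis G_even : mpar G = G.

Local Opaque mbr.

Lemma osp_def_linear : linear osp_def.
Proof.
move=> c X Y; rewrite /osp_def scaler_sumr -big_split; apply: eq_bigr => p _ /=.
rewrite (hpart_linear (@mpar_linear K m k)) linearP /= mulmxDl mulmxDr.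
by rewrite -scalemxAl -scalemxAr scalerDr addrACA.
Qed.

Lemma osp_spaceE X : (X \in osp_space) = (osp_def X == 0).
Proof.
pose flin := HB.pack_for {linear M -> M} osp_def
  (GRing.isLinear.Build _ _ _ _ osp_def osp_def_linear).
by rewrite memv_ker -[linfun _]/(linfun flin) lfunE.
Qed.

Lemma osp_brDl (X Y Z : M) : mbr X Z \in osp_space ->
  mbr Y Z \in osp_space -> mbr (X + Y) Z \in osp_space.
Proof.
rewrite 3!osp_spaceE => /eqP hX /eqP hY; apply/eqP.
apply: etrans (congr1 osp_def (linearD' X Y (proj1 (@mbr_bilin K m k) Z))) _.
apply: etrans (linearD' _ _ osp_def_linear) _.
by apply: etrans (congr2 +%R hX hY) (addr0 _).
Qed.

Lemma osp_brDr (X Y Z : M) : mbr X Y \in osp_space ->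
  mbr X Z \in osp_space -> mbr X (Y + Z) \in osp_space.
Proof.
rewrite 3!osp_spaceE => /eqP hY /eqP hZ; apply/eqP.
apply: etrans (congr1 osp_def (linearD' Y Z (proj2 (@mbr_bilin K m k) X))) _.
apply: etrans (linearD' _ _ osp_def_linear) _.
by apply: etrans (congr2 +%R hY hZ) (addr0 _).
Qed.

Lemma mhpartE (X : M) :
  X = hpart (@mpar K m k) true X + hpart (@mpar K m k) false X.
Proof. by rewrite -[LHS](hpart_sum (@mpar K m k)) big_bool. Qed.

Lemma osp_def_homog p X : homog (@mpar K m k) p X ->
  osp_def X = X^T *m G + msign p *m G *m X.
Proof.
move=> hX; rewrite /osp_def (bigD1 p) //= (hpart_id _ hX) eqxx.
rewrite big1 ?addr0 // => q /negPf nq; rewrite (hpart_id _ hX) nq.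
by rewrite trmx0 mul0mx mulmx0 addr0.
Qed.

Lemma pmx_tr : (pmx K m k)^T = pmx K m k.
Proof. by rewrite tr_block_mx !trmx0 linearN /= !trmx1. Qed.

Lemma mpar_tr X : mpar X^T = (mpar X)^T :> M.
Proof. by rewrite /mpar !trmx_mul pmx_tr mulmxA. Qed.

Lemma msignM p q : msign p *m msign q = msign (p (+) q).
Proof. by case: p q => [] []; rewrite /= ?mul1mx ?mulmx1 ?pmxK. Qed.

Lemma msign_comm p q (X : M) : homog (@mpar K m k) q X ->
  X *m msign p = (-1) ^+ (p && q) *: (msign p *m X).
Proof.
case: p => /= [hX|_]; last by rewrite mulmx1 mul1mx expr0 scale1r.
have: pmx K m k *m mpar X = X *m pmx K m k by rewrite /mpar !mulmxA pmxK mul1mx.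
by rewrite hX => <-; rewrite scalemxAr.
Qed.

Lemma osp_homogP p X : homog (@mpar K m k) p X -> (X \in osp_space) ->
  X^T *m G = - (msign p *m G *m X).
Proof.
move=> hX; rewrite osp_spaceE (osp_def_homog hX) => /eqP h.
by apply/eqP; rewrite -addr_eq0; apply/eqP.
Qed.

Lemma osp_def_par X : mpar (osp_def X) = osp_def (mpar X).
Proof.
elim/mhomog_ind: X => [p X hX|X Y hX hY]; last first.
  rewrite !(linearD' _ _ osp_def_linear) !(linearD' _ _ (@mpar_linear K m k)).
  by rewrite (linearD' _ _ osp_def_linear) hX hY.
rewrite hX (linearZ' _ _ osp_def_linear) (osp_def_homog hX).
rewrite (linearD' _ _ (@mpar_linear K m k)) !mparM mpar_tr hX G_even.
rewrite !linearZ /= -scalemxAl scalerDr; congr (_ + _).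
congr (_ *: (_ *m _ *m _)).
by case: (p); rewrite /= /mpar ?mulmx1 pmxK ?mul1mx.
Qed.

Lemma osp_par X : X \in osp_space -> mpar X \in osp_space.
Proof.
rewrite !osp_spaceE -osp_def_par => /eqP ->.
by rewrite (linear0' (@mpar_linear K m k)).
Qed.

Lemma osp_hpart p X : X \in osp_space -> hpart (@mpar K m k) p X \in osp_space.
Proof. by move=> hX; rewrite memvZ // memvD // memvZ // osp_par. Qed.

Lemma osp_br X Y : X \in osp_space -> Y \in osp_space -> mbr X Y \in osp_space.
Proof.
have pK := @mparK K m k; have pl := @mpar_linear K m k => hX hY.
suff h p q :
    mbr (hpart (@mpar K m k) p X) (hpart (@mpar K m k) q Y) \in osp_space.
  have h1 p : mbr (hpart (@mpar K m k) p X) Y \in osp_space.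
    by rewrite [Y]mhpartE; apply: osp_brDr; apply: h.
  by rewrite [X]mhpartE; apply: osp_brDl; apply: h1.
move: (osp_hpart p hX) (osp_hpart q hY) (hpart_homog pl pK p X) (hpart_homog pl pK q Y).
move: (hpart _ _ X) (hpart _ _ Y) => {hX}X {hY}Y hX hY pX pY.
rewrite osp_spaceE (osp_def_homog (mhomog_br pX pY)) (mbrE pX pY).
have eX := osp_homogP pX hX; have eY := osp_homogP pY hY.
have pXt : homog (@mpar K m k) p X^T by rewrite /homog mpar_tr pX linearZ.
have pYt : homog (@mpar K m k) q Y^T by rewrite /homog mpar_tr pY linearZ.
have eXY : (X *m Y)^T *m G = (-1) ^+ (p && q) *: (msign (p (+) q) *m G *m Y *m X).
  rewrite trmx_mul -(mulmxA Y^T) eX mulmxN !mulmxA (msign_comm p pYt).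
  rewrite -!scalemxAl -(mulmxA _ Y^T) eY mulmxN.
  rewrite mulNmx scalerN opprK !mulmxA msignM.
  by [].
have eYX : (Y *m X)^T *m G = (-1) ^+ (p && q) *: (msign (p (+) q) *m G *m X *m Y).
  rewrite trmx_mul -(mulmxA X^T) eY mulmxN !mulmxA (msign_comm q pXt).
  rewrite -!scalemxAl -(mulmxA _ X^T) eX mulmxN.
  rewrite mulNmx scalerN opprK !mulmxA msignM addbC andbC.
  by [].
rewrite linearB /= linearZ /= mulmxBl -scalemxAl eXY eYX scalerA -expr2 sqrr_sign.
rewrite scale1r mulmxBr -!scalemxAr !mulmxA.
by rewrite addrA subrK subrr.
Qed.

Definition ospG : lieSuper K := mxlie osp_par osp_br.
Definition ospG_even : lieSuper K :=
  mxlie (@even_par K m k osp_space) (@even_br K m k osp_space osp_br).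

(* U(g_0) -> U(g), induced by the inclusion of the even part g_0. *)
Definition even_incl (x : ospG_even) : ospG :=
  vsproj osp_space (vsval (x : subvs_of (even_part osp_space))).

Definition env_even : env ospG_even -> env ospG :=
  env_lift 1 *%R (fun x => iota_ (even_incl x)).

Lemma val_even_incl x :
  vsval (even_incl x : subvs_of osp_space) = vsval (x : subvs_of (even_part osp_space)).
Proof. by rewrite vsprojK //; have := subvsP x; rewrite even_partP => /andP[]. Qed.

Lemma env_even_compat : lie_compat *%R (fun x => iota_ (even_incl x)).
Proof.
split=> [c x y|p q x y hx hy]; first by rewrite /even_incl !linearP /= iota_linear.
have hE r z : homog (@lie_par _ ospG_even) r z ->
    homog (@lie_par _ ospG) r (even_incl z).
  move=> /(val_homog (@even_par K m k osp_space)) hz; apply: val_inj.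
  rewrite [LHS](val_spar osp_par) [X in mpar X]val_even_incl hz.
  by rewrite -[vsval z]val_even_incl.
rewrite (iota_br (hE _ _ hx) (hE _ _ hy)); congr (_ + iota_ _).
apply: val_inj; rewrite /= (val_sbr osp_br) !val_even_incl.
by rewrite (val_sbr (@even_br K m k osp_space osp_br)).
Qed.

End OrthoSymplectic.

Section Dual.
Variables (K : numFieldType) (L : lieSuper K).
Local Notation U := (env L).
Local Notation form := (env L -> K^o).

Definition fpar (a : form) : form := fun x => a (upar x).

(* <a (x) b, x (x) y> = (-1)^([b][x]) <a, x> <b, y>. *)
Definition fpairing (a b : form) (x y : U) : K^o :=
  ssum (@upar K L) fpar (fun x b => a x * b y : K^o) x b.

Definition fmul (a b : form) : form := fun x => tlift (fpairing a b) (Delta x).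

Definition fantipode (a : form) : form := fun x => a (antipode x).

(* The element of U* (x) U* encoded by s is the image of b under the transpose
   of the product, and its factors lie in B. *)
Definition fcoprod_rep (B : set form) (b : form) (s : seq (form * form)) : Prop :=
  (forall c, c \in s -> B c.1 /\ B c.2) /\
  (forall x y, b (x * y) = \sum_(c <- s) fpairing c.1 c.2 x y).

Definition graded_rep (d0 d1 : nat) (rho : U -> 'M[K]_(d0 + d1)) : Prop :=
  [/\ linear rho, rho 1 = 1%:M, forall x y, rho (x * y) = rho x *m rho y
    & forall x, rho (upar x) = mpar (rho x)].

Definition finite_dual : set form := [set a | exists d0 d1,
  exists2 rho : U -> 'M[K]_(d0 + d1), graded_rep rho &
  exists (r : 'rV_(d0 + d1)) (c : 'cV_(d0 + d1)),
    a = fun x => (r *m rho x *m c) 0 0].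

Record sub_hopf (B : set form) : Prop := SubHopf {
  sub_hopf_fdual : B `<=` finite_dual;
  sub_hopf_lin : forall k a b, B a -> B b -> B (k *: a + b);
  sub_hopf_par : forall a, B a -> B (fpar a);
  sub_hopf_unit : B (@ueps K L);
  sub_hopf_mul : forall a b, B a -> B b -> B (fmul a b);
  sub_hopf_antipode : forall a, B a -> B (fantipode a);
  sub_hopf_coprod : forall a, B a -> exists s, fcoprod_rep B a s
}.

Definition hopf_generated (T : set form) : set form :=
  [set a | forall B, sub_hopf B -> T `<=` B -> B a].

Section Integral.
Variable B : set form.

(* Some expression of the coproduct of b in B (x) B as a sum of elementary
   tensors. What is computed from it below does not depend on the choice made,
   for B a graded subcoalgebra and for linear forms on B. *)
Definition fcoprod (b : form) : seq (form * form) :=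
  xget [::] [set s | fcoprod_rep B b s].

(* Linear forms on B are functions whose values outside B are irrelevant. *)
Definition linear_on (phi : form -> K) : Prop :=
  forall k a b, B a -> B b -> phi (k *: a + b) = k * phi a + phi b.

(* (id (x) phi)(a (x) b) = (-1)^([phi][a]) phi(b) a, where the sign may be read
   off b since phi(b) = 0 unless [b] = [phi]. *)
Definition id_tensor (phi : form -> K) (s : seq (form * form)) : form :=
  \sum_(c <- s) ssum fpar fpar (fun a b => phi b *: a) c.1 c.2.

Definition tensor_id (phi : form -> K) (s : seq (form * form)) : form :=
  \sum_(c <- s) phi c.1 *: c.2.

Definition left_integral (phi : form -> K) : Prop := linear_on phi /\
  forall b, B b -> id_tensor phi (fcoprod b) = phi b *: @ueps K L.

Definition right_integral (phi : form -> K) : Prop := linear_on phi /\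
  forall b, B b -> tensor_id phi (fcoprod b) = phi b *: @ueps K L.

Definition nonzero_on (phi : form -> K) : Prop := exists2 b, B b & phi b != 0.

(* <f.g, a> = <f (x) g, Delta(a)> with <f (x) g, a (x) b> = (-1)^([g][a]) f(a) g(b),
   where the sign may be read off b. *)
Definition conv (f g : form -> K) (a : form) : K :=
  \sum_(c <- fcoprod a) ssum fpar fpar (fun a b => f a * g b : K^o) c.1 c.2.

End Integral.

(* <nu(x), a> = (-1)^([x][a]) <a, x>. *)
Definition nu (x : U) (a : form) : K :=
  ssum (@upar K L) fpar (fun x a => a x : K^o) x a.

End Dual.

(* osp(2|2n), for the even supersymmetric form on K^(2|2n) with the symmetric
   block [[0, 1], [1, 0]] and the symplectic block [[0, 1], [-1, 0]]. *)
Section Osp2.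
Variables (K : numFieldType) (n : nat).

Definition form_sym : 'M[K]_2 := \matrix_(i, j) (i != j)%:R.
Definition form_skew : 'M[K]_(n + n) := block_mx 0 1%:M (- 1%:M) 0.
Definition osp2_form : 'M[K]_(2 + (n + n)) := block_mx form_sym 0 0 form_skew.

Lemma osp2_form_even : mpar osp2_form = osp2_form.
Proof.
rewrite /mpar /pmx /osp2_form !mulmx_block.
rewrite !(mul0mx, mulmx0, mul1mx, mulmx1, addr0, add0r, mulNmx, mulmxN, opprK).
by rewrite ?oppr0.
Qed.

Definition osp2 : lieSuper K := ospG osp2_form_even.
Definition osp2_even : lieSuper K := ospG_even osp2_form_even.

Definition U_even_incl : env osp2_even -> env osp2 :=
  @env_even K 2 (n + n) osp2_form osp2_form_even.

Definition restr (a : env osp2 -> K^o) : env osp2_even -> K^o :=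
  fun y => a (U_even_incl y).

Definition defrep : env osp2 -> 'M[K]_(2 + (n + n)) :=
  @mxrep K 2 (n + n) _ (osp_par osp2_form_even) (osp_br osp2_form_even).

Definition t_ (a b : 'I_(2 + (n + n))) : env osp2 -> K^o := fun x => defrep x a b.

Definition fun_alg : set (env osp2 -> K^o) :=
  hopf_generated [set a | exists i j, a = t_ i j].

Definition fun_alg_even : set (env osp2_even -> K^o) := [set restr a | a in fun_alg].

(* The generator diag(1, -1, 0, ..., 0) of gl(1) = so(2). *)
Definition gl1_mx : 'M[K]_(2 + (n + n)) :=
  block_mx (diag_mx (\row_i (-1) ^+ i)) 0 0 0.

Lemma gl1_mx_osp : gl1_mx \in osp_space osp2_form.
Proof.
have h : homog (@mpar K 2 (n + n)) false gl1_mx.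
  rewrite /homog expr0 scale1r /mpar /pmx /gl1_mx !mulmx_block.
  by rewrite !(mul0mx, mulmx0, mul1mx, mulmx1, addr0, add0r, mulNmx, mulmxN, oppr0).
rewrite osp_spaceE (osp_def_homog _ h) /= mul1mx /gl1_mx /osp2_form.
rewrite tr_block_mx !trmx0 !mulmx_block !(mul0mx, mulmx0, addr0, add0r).
rewrite add_block_mx !addr0 -(block_mx0 _ 2 (n + n) 2 (n + n)).
apply/eqP; congr block_mx; rewrite tr_diag_mx mul_diag_mx mul_mx_diag.
apply/matrixP => i j; rewrite !mxE.
case: i j => [[|[|i]] hi] [[|[|j]] hj] //=;
  by rewrite ?(expr0, expr1, mul0r, mulr0, mulr1, mul1r, addr0, subrr, addNr).
Qed.

Definition gl1 : osp2 := vsproj (osp_space osp2_form) gl1_mx.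

(* The gl(1)-eigenspace g_1s of g_1 with eigenvalue s = 1 or s = -1. *)
Definition odd_part (s : K) : set osp2 :=
  [set x | homog lie_par true x /\ lie_br gl1 x = s *: x].

(* The degree 2n part of the subalgebra U(g_1s) of U(g) generated by g_1s. *)
Definition top_degree (s : K) : set (env osp2) := [set u |
  exists (N : nat) (c : 'I_N -> K) (x : 'I_N -> 'I_(n + n) -> osp2),
    (forall k j, odd_part s (x k j)) /\
    u = \sum_(k < N) c k *: \prod_(j < n + n) iota_ (x k j)].

End Osp2.

Arguments fun_alg K n : clear implicits.
Arguments fun_alg_even K n : clear implicits.
Arguments top_degree {K n} s.

(* Main.v *)
Require Import Defs.
From mathcomp Require Import all_boot all_order all_algebra.
From mathcomp Require Import boolp classical_sets functions reals complex.
From mathcomp Require Import mxtens ring.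

Set Implicit Arguments.
Unset Strict Implicit.
Unset Printing Implicit Defensive.

Import Order.TTheory GRing.Theory Num.Theory.
Local Open Scope ring_scope.
Local Open Scope classical_set_scope.

(** Write U for U(g), U_0 for the image of U(g_0) in U, and P for the restriction.

    As Gamma is even, the integral of b is the value of int_0 at the form
    y |-> b (Gamma y) on U_0. For a form b and z in U put Phi_b(z) = int_0(y |-> b(z y)).
    Left invariance of int_0 says that Phi_b vanishes on the left ideal U g_0, and the
    left invariance of the integral means that Phi_b(x Gamma) = eps(x) Phi_b(Gamma) for
    all x in U. So Gamma has to be an invariant of U / U g_0. It commutes with g_0,
    because the determinants of g_0 on g_+ and on g_- are inverse to each other
    (even_Gamma_comm); it is killed by g_+ on the left, because E has top degree; and
    for x in g_-, commuting x through E produces the brackets [x, e_i] in g_0, plus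
    terms without elements of g_0 whose coefficient is the trace of [x, e_i] on g_+
    plus its weight on F, which is its trace on g_-. The sum of the two traces is 0
    (contract_unimodular, gen_Gamma).

    For the right invariance, y Gamma = Gamma y for y in U_0, and the same computation
    shows that Gamma x lies in g_0 U for x odd (Gamma_gen). One needs that
    int_0(y |-> b(y h z)) = 0 for h in g_0, that is, that int_0 is right invariant too.
    This comes from the compact real form of g_0: in the defining representation the
    matrices of g_0 are closed under conjugate transposition, and this property passes
    to sums, products and antipodes of matrix elements (unitary_dual_sub_hopf). For such
    representations the orthogonal projection onto the invariants is given by an
    element u0 of U_0 (invariant_projection), whence int_0(P(b)) = b(u0) int_0(1): the
    integral int_0 is determined by int_0(1), which is not 0, and is two-sided invariant
    (int0_value, int0_fshiftr).

    The integral is not 0 at the product of the 4n matrix elements t_ab with a even and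
    b odd (odd_word_value): they vanish on U_0, so that each odd factor of Gamma has to
    hit exactly one of them, and the result is the unit form, up to a nonzero factor.

    All this takes place in the smallest sub-Hopf superalgebra that contains the t_ab.
    That the intersection of sub-Hopf superalgebras is one of them rests on the finite
    rank of the coproduct of a matrix element (hopf_generated_sub_hopf). *)

(** * Products of anticommuting square-zero elements *)

Section Grassmann.
Variables (R : nzRingType) (N : nat) (e : nat -> R).
Local Notation gprod a b := (\prod_(a <= j < b) e j).

Lemma gprodS a b : (a <= b)%N -> gprod a b.+1 = gprod a b * e b.
Proof. by move=> ab; rewrite big_nat_recr. Qed.

Lemma gprod_nil a b : (b <= a)%N -> gprod a b = 1.
Proof. by move=> ba; rewrite big_geq. Qed.

Lemma commutator_prod (h : R) (a b : nat) : (a <= b)%N ->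
  h * gprod a b = gprod a b * h +
    \sum_(a <= k < b) gprod a k * (h * e k - e k * h) * gprod k.+1 b.
Proof.
elim: b => [|b IH]; first by rewrite leqn0 => /eqP ->; rewrite !big_geq // mul1r mulr1 addr0.
rewrite leq_eqVlt ltnS => /predU1P[->|ab]; first by rewrite !big_geq // mul1r mulr1 addr0.
rewrite [X in _ = _ + X]big_nat_recr //= !(gprodS ab) (gprod_nil (leqnn b.+1)) mulr1.
rewrite mulrA IH // mulrDl mulr_suml mulrBr !mulrA addrCA [RHS]addrC -!addrA.
rewrite [RHS]addrCA addNKr; congr (_ + _).
apply: eq_big_nat => k /andP[_ lk]; by rewrite gprodS // mulrA.
Qed.

Lemma anticommutator_prod (x : R) (m : nat) :
  x * gprod 0 m = (-1) ^+ m * gprod 0 m * x +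
    \sum_(0 <= i < m) (-1) ^+ i * gprod 0 i * (x * e i + e i * x) * gprod i.+1 m.
Proof.
elim: m => [|m IH]; first by rewrite !big_geq // !mulr1 expr0 mul1r addr0.
rewrite [X in _ = _ + X]big_nat_recr //= !(gprodS (leq0n m)) (gprod_nil (leqnn m.+1)) mulr1.
rewrite mulrA IH // mulrDl mulr_suml mulrDr exprS !mulrA mulN1r !mulNr.
rewrite [RHS]addrC -!addrA subrr addr0 addrC; congr (_ + _).
apply: eq_big_nat => k /andP[_ lk]; by rewrite gprodS // mulrA.
Qed.

Hypothesis eC : forall i j, e i * e j = - (e j * e i).
Hypothesis ee0 : forall i, e i * e i = 0.

Lemma mul_gprod l a b : e l * gprod a b = (-1) ^+ (b - a) * gprod a b * e l.
Proof.
have [/subnK <-|/ltnW ba] := leqP a b; last first.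
  by rewrite gprod_nil // (eqP ba) expr0 mulr1 mul1r mul1r.
elim: (b - a)%N => [|m IH].
  by rewrite add0n subnn gprod_nil // expr0 mulr1 mul1r mul1r.
rewrite addSn gprodS ?leq_addl // mulrA IH subSn ?leq_addl // exprS.
by rewrite -!mulrA eC mulN1r !mulrN.
Qed.

Lemma mul_gprod0 l a b : (a <= l < b)%N -> e l * gprod a b = 0.
Proof.
case/andP=> al lb; rewrite (big_cat_nat al (ltnW lb)) /= mulrA mul_gprod.
by rewrite (big_ltn lb) -!mulrA [e l * (e l * _)]mulrA ee0 mul0r !mulr0.
Qed.

Lemma gprod_mul0 l a b : (a <= l < b)%N -> gprod a b * e l = 0.
Proof.
move=> lab; have := mul_gprod l a b; rewrite mul_gprod0 // => /esym /(congr1 (GRing.mul ((-1) ^+ (b - a)))).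
by rewrite !mulrA -expr2 sqrr_sign mul1r mulr0.
Qed.

Local Notation central c := (forall r : R, c * r = r * c).

Local Notation gprodD i := (gprod 0 i * gprod i.+1 N).

(** [h, -] is a derivation, and replacing a factor e k by e l with l different from k
    repeats e l: only the diagonal coefficients survive. *)
Lemma commutator_top (h : R) (a : nat -> nat -> R) :
  (forall k l, central (a k l)) ->
  (forall k, h * e k - e k * h = \sum_(0 <= l < N) a k l * e l) ->
  h * gprod 0 N = gprod 0 N * h + (\sum_(0 <= k < N) a k k) * gprod 0 N.
Proof.
move=> aC ha; rewrite commutator_prod //; congr (_ + _).
rewrite mulr_suml; apply: eq_big_nat => k /andP[_ kN].
rewrite ha mulr_sumr mulr_suml.
have kN' : (k \in index_iota 0 N) by rewrite mem_index_iota.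
rewrite (bigD1_seq k) ?iota_uniq //= [X in _ + X = _]big1_seq.
  rewrite addr0 [in RHS](big_cat_nat (leq0n k) (ltnW kN)) /= (big_ltn kN).
  by rewrite mulrA -(aC k k (gprod 0 k)) -!mulrA.
move=> l /andP[lk]; rewrite mem_index_iota => /andP[_ lN].
rewrite mulrA -(aC k l (gprod 0 k)) -!mulrA; case: (ltngtP l k) lk => // lk _.
  by rewrite !mulrA -(mulrA (a k l)) gprod_mul0 ?mulr0 ?mul0r.
by rewrite mul_gprod0 ?mulr0 // lk.
Qed.

(** Moving x through the e i leaves the h i = [x, e i], which have to be moved to the
    right in turn. As [[x, e i], e k] is skew in i and k, the double brackets add up
    to the full trace of ad (h i) on the span of the e k. *)
Lemma contract_top (x : R) (h : nat -> R) (a : nat -> nat -> nat -> R) :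
  (forall i k l, central (a i k l)) ->
  (forall i, x * e i + e i * x = h i) ->
  (forall i k, h i * e k - e k * h i = \sum_(0 <= l < N) a i k l * e l) ->
  (forall i k l, a i k l = - a k i l) -> (forall i l, a i i l = 0) ->
  x * gprod 0 N = (-1) ^+ N * gprod 0 N * x +
    \sum_(0 <= i < N) (-1) ^+ i * gprodD i * (h i + \sum_(0 <= k < N) a i k k).
Proof.
move=> aC xe ha aA a0; rewrite anticommutator_prod; congr (_ + _).
pose t i k : R := (-1) ^+ i * gprodD i * a i k k.
have aX i k l r s : r * (a i k l * s) = a i k l * (r * s).
  by rewrite mulrA -aC mulrA.
(* Only the components of [h i, e k] along e k and e i survive. *)
have step i k : (i < k < N)%N ->
  (-1) ^+ i * gprod 0 i *
    (gprod i.+1 k * (h i * e k - e k * h i) * gprod k.+1 N) = t i k + t k i.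
  case/andP=> ik kN; have iN := ltn_trans ik kN.
  rewrite ha mulr_sumr mulr_suml mulr_sumr.
  have kN' : (k \in index_iota 0 N) by rewrite mem_index_iota.
  have iN' : (i \in index_iota 0 N) by rewrite mem_index_iota.
  rewrite (bigD1_seq k) ?iota_uniq //= (big_rem _ iN') /= (ltn_eqF ik) /=.
  have pull l : (-1) ^+ i * gprod 0 i * (gprod i.+1 k * (a i k l * e l) * gprod k.+1 N) =
      a i k l * ((-1) ^+ i * (gprod 0 i * (gprod i.+1 k * (e l * gprod k.+1 N)))).
    by rewrite -!mulrA !aX.
  rewrite !pull [X in _ + (_ + X) = _]big1_seq ?addr0.
    congr (_ + _); rewrite /t -aC.
      congr (_ * _).
      by rewrite -(big_ltn kN) -(@big_cat_nat _ _ _ k i.+1 N) // ltnW.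
    rewrite aA mulNr -mulrN; congr (_ * _).
    have -> : gprod 0 k = gprod 0 i * (e i * gprod i.+1 k).
      by rewrite -big_ltn // -big_cat_nat // ltnW.
    have -> : (-1) ^+ k = - ((-1) ^+ i * (-1) ^+ (k - i.+1)) :> R.
      by rewrite -exprD -[RHS]mulN1r -exprS -addSn subnKC.
    rewrite (mul_gprod i i.+1 k) -[(-1) ^+ i]signr_odd -[(-1) ^+ (k - i.+1)]signr_odd.
    by do 2!case: (odd _); rewrite /= ?(expr0, expr1, mulN1r, mul1r, mulNr, mulrN, opprK, mulrA).
  move=> l /andP[lk]; rewrite mem_rem_uniq ?iota_uniq // inE mem_index_iota => /and3P[li _ lN].
  rewrite pull; suff: gprod 0 i * (gprod i.+1 k * (e l * gprod k.+1 N)) = 0.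
    by move=> ->; rewrite !mulr0.
  have [kl|lk'] := ltnP k l; first by rewrite mul_gprod0 ?mulr0 ?kl.
  have [il|li'] := ltnP i l.
    by rewrite [gprod i.+1 k * _]mulrA gprod_mul0 ?mul0r ?mulr0 // il /= ltn_neqAle lk.
  have -> : gprod i.+1 k * (e l * gprod k.+1 N) =
      e l * ((-1) ^+ (k - i.+1) * gprod i.+1 k * gprod k.+1 N).
    rewrite !mulrA [e l * _]commr_sign -[_ * e l * gprod i.+1 k]mulrA mul_gprod.
    by rewrite !mulrA -expr2 sqrr_sign mul1r.
  by rewrite mulrA gprod_mul0 ?mul0r //= ltn_neqAle li.
transitivity (\sum_(0 <= i < N) ((-1) ^+ i * gprodD i * h i +
                                  \sum_(i.+1 <= k < N) (t i k + t k i))).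
  apply: eq_big_nat => i /andP[_ iN].
  rewrite xe -mulrA (commutator_prod (h i)) // mulrDr mulr_sumr; congr (_ + _).
    by rewrite !mulrA.
  apply: eq_big_nat => k /andP[ik kN].
  by rewrite step ?ik.
have tii i : t i i = 0 by rewrite /t a0 mulr0.
rewrite big_split /=.
under [RHS]eq_bigr do rewrite mulrDr mulr_sumr.
rewrite [RHS]big_split /=; congr (_ + _).
under eq_bigr do rewrite big_split.
rewrite big_split /=.
rewrite [X in _ + X](_ : _ = \sum_(0 <= i < N) \sum_(0 <= k < i) t i k).
  rewrite -big_split /=; apply: eq_big_nat => i /andP[_ iN].
  by rewrite addrC (big_cat_nat (leq0n i) (ltnW iN)) /= (big_ltn iN) -/(t i i) tii add0r.
under eq_big_nat => i do rewrite (big_nat_widenl _ 0%N) //.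
rewrite (exchange_big_dep_nat xpredT) //=; apply: eq_big_nat => k /andP[_ kN].
by rewrite [RHS](big_nat_widen _ _ N) 1?ltnW.
Qed.

End Grassmann.

Section GrassmannWords.
Variables (K : fieldType) (R : algType K) (N : nat) (e : nat -> R).
Hypothesis eC : forall i j, e i * e j = - (e j * e i).
Hypothesis ee0 : forall i, e i * e i = 0.
Local Notation word w := (\prod_(j <- w) e j).

(** Commuting e a to the front costs one sign for each letter that it passes. *)
Lemma word_pull a w1 w2 :
  word (w1 ++ a :: w2) = (-1) ^+ size w1 * (e a * word (w1 ++ w2)).
Proof.
elim: w1 => [|b w1 IH] /=; first by rewrite big_cons expr0 mul1r.
rewrite !big_cons IH exprS mulN1r !mulrA commr_sign -[_ * e b * e a]mulrA eC.
by rewrite mulrN !mulNr !mulrA.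
Qed.

Lemma word_perm w w' : perm_eq w w' -> exists s : nat, word w = (-1) ^+ s * word w'.
Proof.
elim: w' w => [|a w' IH] w pw.
  by rewrite (perm_nilP pw); exists 0%N; rewrite mul1r.
have aw : a \in w by rewrite (perm_mem pw) mem_head.
case/splitPr: aw pw => w1 w2; rewrite -cat1s perm_catCA perm_cons => /IH[s es].
exists (size w1 + s)%N; rewrite word_pull es big_cons exprD -!mulrA; congr (_ * _).
by rewrite !mulrA commr_sign.
Qed.

Lemma word_dup w : ~~ uniq w -> word w = 0.
Proof.
elim: w => [|a w IH] //=; rewrite negb_and negbK big_cons => /orP[aw|/IH ->].
  case/splitPr: aw => w1 w2.
  by rewrite word_pull mulrA commr_sign -mulrA [e a * _]mulrA ee0 mul0r mulr0.
by rewrite mulr0.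
Qed.

Local Notation top := (\prod_(0 <= j < N) e j).

Lemma word_top w : size w = N -> all (gtn N) w -> exists c : K, word w = c *: top.
Proof.
move=> sw wN; have [uw|/word_dup ->] := boolP (uniq w); last first.
  by exists 0; rewrite scale0r.
have [|s ->] := @word_perm w (iota 0 N).
  apply: uniq_perm; rewrite ?iota_uniq //.
  have [] := @uniq_min_size _ w (iota 0 N) uw.
  - by move=> i /(allP wN) /=; rewrite mem_iota.
  - by rewrite size_iota sw.
  by move=> _.
exists ((-1) ^+ s); rewrite /index_iota subn0.
elim: s => [|s IH]; first by rewrite mul1r scale1r.
by rewrite !exprS -mulrA IH mulN1r -scalerA scaleN1r.
Qed.

(** The top degree of a Grassmann algebra is a line: expand, and note that a word of N
    letters either repeats a letter or is a permutation of e 0, ..., e (N - 1). *)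
Lemma prod_span_top (x : 'I_N -> R) :
  (forall j, exists u : nat -> K, x j = \sum_(0 <= l < N) u l *: e l) ->
  exists c : K, \prod_j x j = c *: top.
Proof.
suff H m (y : 'I_m -> R) w :
    (forall j, exists u : nat -> K, y j = \sum_(0 <= l < N) u l *: e l) ->
    (size w + m)%N = N -> all (gtn N) w ->
    exists c : K, word w * \prod_j y j = c *: top.
  move=> xe; have [c] := H _ x [::] xe (add0n _) isT.
  by rewrite big_nil mul1r => ->; exists c.
elim: m y w => [|m IH] y w ye sw wN.
  by rewrite big_ord0 mulr1; apply: word_top; rewrite // -sw addn0.
rewrite big_ord_recl; have [u ->] := ye ord0.
pose P z := exists c : K, z = c *: top.
have PD z z' : P z -> P z' -> P (z + z').
  by move=> [c ->] [c' ->]; exists (c + c'); rewrite scalerDl.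
rewrite mulr_suml mulr_sumr -/(P _) big_nat.
elim/big_rec: _ => [|l z lN Pz]; first by exists 0; rewrite scale0r.
apply: (PD) Pz; rewrite -scalerAl -scalerAr mulrA.
have -> : word w * e l = word (rcons w l) by rewrite -cats1 big_cat big_seq1.
have [||c ->] := IH (fun j => y (lift ord0 j)) (rcons w l) (fun j => ye _).
- by rewrite size_rcons addSnnS.
- by rewrite all_rcons wN andbT.
by exists (u l * c); rewrite scalerA.
Qed.

End GrassmannWords.

Section UnimodularTop.
Variables (R : nzRingType) (N : nat) (e : nat -> R) (F x : R) (h : nat -> R).
Variable a : nat -> nat -> nat -> R.
Hypothesis eC : forall i j, e i * e j = - (e j * e i).
Hypothesis ee0 : forall i, e i * e i = 0.
Hypothesis aC : forall i k l (r : R), a i k l * r = r * a i k l.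
Hypothesis xe : forall i, x * e i + e i * x = h i.
Hypothesis he : forall i k,
  h i * e k - e k * h i = \sum_(0 <= l < N) a i k l * e l.
Hypothesis aA : forall i k l, a i k l = - a k i l.
Hypothesis a0 : forall i l, a i i l = 0.
Hypothesis xF : x * F = 0.
Hypothesis hF : forall i, h i * F = F * h i - (\sum_(0 <= k < N) a i k k) * F.

(** The trace of h i on the span of the e k is opposite to its weight on F, so that
    the terms without h i cancel. *)
Lemma contract_unimodular :
  x * (\prod_(0 <= j < N) e j * F) = \sum_(0 <= i < N)
    (-1) ^+ i * (\prod_(0 <= j < i) e j * \prod_(i.+1 <= j < N) e j) * F * h i.
Proof.
rewrite mulrA (contract_top eC ee0 aC xe he aA a0) mulrDl -[_ * x * F]mulrA xF mulr0 add0r.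
rewrite mulr_suml; apply: eq_bigr => i _.
by rewrite -[LHS]mulrA mulrDl hF subrK mulrA.
Qed.

End UnimodularTop.

Section UnimodularTopOp.
Variables (R : nzRingType) (N : nat) (e : nat -> R) (F x : R) (h : nat -> R).
Variable a : nat -> nat -> nat -> R.
Hypothesis eC : forall i j, e i * e j = - (e j * e i).
Hypothesis ee0 : forall i, e i * e i = 0.
Hypothesis aC : forall i k l (r : R), a i k l * r = r * a i k l.
Hypothesis xe : forall i, x * e i + e i * x = h i.
Hypothesis he : forall i k,
  h i * e k - e k * h i = \sum_(0 <= l < N) a i k l * e l.
Hypothesis aA : forall i k l, a i k l = - a k i l.
Hypothesis a0 : forall i l, a i i l = 0.
Hypothesis Fx : F * x = 0.
Hypothesis hF : forall i, h i * F = F * h i - (\sum_(0 <= k < N) a i k k) * F.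

(** The mirror image, from the opposite ring: brackets change sign there, and so do the
    structure constants. It reverses the order of the product. *)
Lemma contract_unimodular_op : exists z : nat -> R,
  F * \prod_(j <- rev (index_iota 0 N)) e j * x = \sum_(0 <= i < N) h i * z i.
Proof.
rewrite -rev_prodr.
have E := @contract_unimodular (GRing.converse R) N e F x h (fun i k l => - a i k l).
eexists; apply: E.
- by move=> i j; apply: eC.
- exact: ee0.
- by move=> i k l r; rewrite [LHS]mulrN [RHS]mulNr aC.
- by move=> i; rewrite addrC; apply: xe.
- move=> i k; apply: (@etrans _ _ (- (h i * e k - e k * h i))); first by rewrite opprB.
  rewrite he -sumrN; apply: eq_bigr => l _; rewrite -mulNr.
  have aC' r : - a i k l * r = r * - a i k l by rewrite mulNr mulrN aC.
  exact: aC'.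
- by move=> i k l; rewrite aA.
- by move=> i l; rewrite a0 oppr0.
- exact: Fx.
move=> i; rewrite sumrN.
have aF : F * (\sum_(0 <= k < N) a i k k) = (\sum_(0 <= k < N) a i k k) * F.
  by rewrite mulr_sumr mulr_suml; apply: eq_bigr => k _; rewrite aC.
have E' : F * h i = h i * F - F * - (\sum_(0 <= k < N) a i k k).
  by rewrite mulrN opprK aF hF subrK.
exact: E'.
Qed.
End UnimodularTopOp.

(** * Slices of bilinear maps and orthogonal projection *)

Section Subspaces.
Variable K : fieldType.

Lemma subspace_mulmx m d (P : 'rV[K]_d -> Prop) (A : 'M[K]_(m, d)) :
  P 0 -> (forall k x y, P x -> P y -> P (k *: x + y)) ->
  (forall i, P (row i A)) -> forall u : 'rV_m, P (u *m A).
Proof.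
move=> P0 PD PA u; rewrite mulmx_sum_row.
by elim/big_rec: _ => // i z _; apply: PD.
Qed.

(** A matrix of maximal rank among those with rows in P has row space P. *)
Lemma subspace_basis d (P : 'rV[K]_d -> Prop) :
  P 0 -> (forall k x y, P x -> P y -> P (k *: x + y)) ->
  exists2 M : 'M[K]_d, (forall i, P (row i M)) & forall w, P w -> (w <= M)%MS.
Proof.
move=> P0 PD.
pose Q r := `[< exists2 M : 'M[K]_d, (forall i, P (row i M)) & \rank M = r >].
have Q0 : exists r, Q r.
  by exists 0%N; apply/asboolP; exists 0; rewrite ?mxrank0 // => i; rewrite row0.
have Qd r : Q r -> (r <= d)%N by move=> /asboolP[M _ <-]; apply: rank_leq_row.
case: (ex_maxnP Q0 Qd) => r /asboolP[M PM rM] rmax; exists M => // w Pw.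
have PMw i : P (row i (M + w)%MS).
  have /submxP[D ->] : (row i (M + w)%MS <= col_mx M w)%MS.
    by rewrite -addsmxE row_sub.
  apply: subspace_mulmx => // j; rewrite -(fintype.splitK j).
  by case: (fintype.split j) => k /=; rewrite ?(rowKu, rowKd) // [k]ord1 row_id.
have /rmax : Q (\rank (M + w)%MS) by apply/asboolP; exists (M + w)%MS.
rewrite -rM => le_rk; apply: submx_trans (addsmxSr M w) _.
have [le_rk' <-] := mxrank_leqif_sup (addsmxSl M w).
by rewrite eqn_leq le_rk' le_rk.
Qed.

(** If the vectors v y are spanned by v (y0 1), ..., v (y0 m), then b is a combination of
    its slices b (-, y0 j), with coefficients in the span of the v i. *)
Lemma bilinear_slices (V : lmodType K) (T : Type) m (b : T -> V -> K)
    (u : 'I_m -> T -> K) (v : 'I_m -> V -> K) :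
  (forall i k x y, v i (k *: x + y) = k * v i x + v i y) ->
  (forall x y, b x y = \sum_i u i x * v i y) ->
  exists (y0 : 'I_m -> V) (c : 'M[K]_m),
    forall x y, b x y = \sum_j b x (y0 j) * \sum_i c i j * v i y.
Proof.
move=> vl be; pose w y : 'rV[K]_m := \row_i v i y.
have v0 i : v i 0 = 0 by have := vl i (-1) 0 0; rewrite scaleN1r addNr mulN1r addNr.
have [|k _ _ [x ->] [y ->]|M PM Mmax] := @subspace_basis _ (fun z => exists y, z = w y).
- by exists 0; apply/rowP => i; rewrite !mxE v0.
- by exists (k *: x + y); apply/rowP => i; rewrite !mxE vl.
have /fin_all_exists[y0 y0E] i : exists y, row i M = w y by exact: PM.
exists y0, (pinvmx M) => x y.
rewrite be; transitivity (\sum_i u i x * (w y *m pinvmx M *m M) 0 i).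
  by apply: eq_bigr => i _; rewrite mulmxKpV ?mxE //; apply: Mmax; exists y.
under eq_bigr do rewrite mxE mulr_sumr.
rewrite exchange_big; apply: eq_bigr => j _ /=.
have -> : (w y *m pinvmx M) 0 j = \sum_i pinvmx M i j * v i y.
  by rewrite mxE; apply: eq_bigr => i _; rewrite mxE mulrC.
rewrite be mulr_suml; apply: eq_bigr => i _.
have -> : M j i = v i (y0 j) by have /rowP/(_ i) := y0E j; rewrite !mxE.
by rewrite mulrA mulrAC.
Qed.

End Subspaces.

Section Adjoint.
Variable C : numClosedFieldType.

Definition adjmx m d (A : 'M[C]_(m, d)) : 'M[C]_(d, m) := (map_mx Num.conj A)^T.

Lemma adjmxM m d p (A : 'M[C]_(m, d)) (B : 'M[C]_(d, p)) :
  adjmx (A *m B) = adjmx B *m adjmx A.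
Proof. by rewrite /adjmx map_mxM trmx_mul. Qed.

Lemma adjmxK m d : cancel (@adjmx m d) (@adjmx d m).
Proof. by move=> A; apply/matrixP => i j; rewrite !mxE conjCK. Qed.

Lemma adjmx_eq0 m d (A : 'M[C]_(m, d)) : A *m adjmx A = 0 -> A = 0.
Proof.
move=> A0; apply/matrixP => i j; rewrite mxE.
have /eqP := congr1 (fun B : 'M_m => B i i) A0; rewrite !mxE psumr_eq0.
  by move=> /allP/(_ j); rewrite mem_index_enum !mxE mul_conjC_eq0 => /(_ isT)/eqP.
by move=> k _; rewrite !mxE mul_conjC_ge0.
Qed.

(** The normal equations are solvable: M and the Gram matrix M M^* have the same rank,
    since W^* M M^* W = 0 forces M^* W = 0. *)
Lemma orthogonal_projection m d (M : 'M[C]_(m, d)) (r : 'rV[C]_d) :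
  exists v : 'rV_m, (r - v *m M) *m adjmx M = 0.
Proof.
suff /submxP[v vE] : (r *m adjmx M <= M *m adjmx M)%MS.
  by exists v; rewrite mulmxBl vE mulmxA subrr.
apply: submx_trans (submxMl _ _) _; rewrite submxE.
set W := cokermx _; have W0 : M *m adjmx M *m W = 0 by exact: mulmx_coker.
have B0 : adjmx (adjmx M *m W) = 0.
  by apply: adjmx_eq0; rewrite adjmxK adjmxM adjmxK -mulmxA [M *m _]mulmxA W0 mulmx0.
apply/eqP; rewrite -[LHS]adjmxK B0.
by apply/matrixP => i j; rewrite !mxE rmorph0.
Qed.

End Adjoint.

(** * Linear forms on an enveloping superalgebra *)

Section Forms.
Variables (K : numFieldType) (L : lieSuper K).
Local Notation U := (env L).
Local Notation form := (env L -> K^o).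
Local Notation i_ := (@iota_ K L).
Implicit Types (a b : form) (u v : U) (p q : bool).

(** Multiplying by one homogeneous generator at a time suits the formulas for Delta and
    the antipode, which are simple on generators. *)
Lemma env_rgen_ind (P : U -> Prop) : P 1 ->
  (forall k u v, P u -> P v -> P (k *: u + v)) ->
  (forall p u x, homog lie_par p x -> P u -> P (u * i_ x)) -> forall u, P u.
Proof.
move=> P1 PD Px v; rewrite -[v]mul1r; elim/env_ind: v 1 P1 => [|x|k v w Pv Pw|v w Pv Pw] u Pu.
- by rewrite mulr1.
- rewrite -(hpart_sum lie_par x) big_bool /= (linearD' _ _ (@iota_linear _ _)) mulrDr.
  by rewrite -[X in X + _]scale1r; apply: PD; apply: Px Pu; apply: (hpart_homog (@lie_par_linear _ L) (@lie_parK _ L)).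
- by rewrite mulrDr -scalerAr; apply: PD; [apply: Pv|apply: Pw].
- by rewrite mulrA; apply/Pw/Pv.
Qed.

Lemma env_lgen_ind (P : U -> Prop) : P 1 ->
  (forall k u v, P u -> P v -> P (k *: u + v)) ->
  (forall p u x, homog lie_par p x -> P u -> P (i_ x * u)) -> forall u, P u.
Proof.
move=> P1 PD Px v; rewrite -[v]mulr1; elim/env_ind: v 1 P1 => [|x|k v w Pv Pw|v w Pv Pw] u Pu.
- by rewrite mul1r.
- rewrite -(hpart_sum lie_par x) big_bool /= (linearD' _ _ (@iota_linear _ _)) mulrDl.
  by rewrite -[X in X + _]scale1r; apply: PD; apply: Px Pu; apply: (hpart_homog (@lie_par_linear _ L) (@lie_parK _ L)).
- by rewrite mulrDl -scalerAl; apply: PD; [apply: Pv|apply: Pw].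
- by rewrite -mulrA; apply/Pv/Pw.
Qed.

Definition fshiftl v a : form := fun u => a (v * u).
Definition fshiftr v a : form := fun u => a (u * v).

Lemma fshiftr_linear v a : linear a -> linear (fshiftr v a).
Proof. by move=> al k x y; rewrite /fshiftr mulrDl -scalerAl al. Qed.
Lemma fpar_linear_form a : linear a -> linear (fpar a).
Proof. by move=> al k x y; rewrite /fpar upar_linear al. Qed.

Lemma hpart_form a p : linear a -> hpart (@fpar K L) p a = a \o hpart (@upar K L) p.
Proof.
move=> al; apply/funext => x; rewrite /hpart /= (linearZ' _ _ al).
rewrite (linearD' _ _ al) (linearZ' _ _ al) /fpar.
by [].
Qed.

Lemma hpart_formE a p u : linear a ->
  hpart (@fpar K L) p a u = a (hpart (@upar K L) p u).
Proof. by move=> al; rewrite hpart_form. Qed.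

Lemma form_scaleE k a u : (k *: a) u = k * a u. Proof. by []. Qed.

(** The parity projections of forms are dual to those of U, so that the signs may be
    read off the two arguments. *)
Lemma fpairingE a b u v : linear b ->
  fpairing a b u v =
  ssum (@upar K L) (@upar K L) (fun x y => a x * b y : K^o) u v.
Proof.
move=> bl; rewrite /fpairing /ssum; apply: eq_bigr => p _.
by apply: eq_bigr => q _; rewrite (hpart_form q bl).
Qed.

Lemma form_mul_bilin a b : linear a -> linear b ->
  bilin (fun x y => a x * b y : K^o).
Proof.
move=> al bl; split=> [y k x x'|x k y y'].
  by rewrite al mulrDl /GRing.scale /= mulrA.
by rewrite bl mulrDr /GRing.scale /= mulrCA.
Qed.

Lemma fpairing_bilin a b : linear a -> linear b -> bilin (fpairing a b).
Proof.
move=> al bl.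
have [sl sr] := ssum_bilin (@upar_linear K L) (@upar_linear K L) (form_mul_bilin al bl).
by split=> [y k x x'|x k y y']; rewrite !fpairingE // ?sl ?sr.
Qed.

Lemma fpairing_homog p q a b u v : linear a -> linear b ->
  homog (@upar K L) p u -> homog (@upar K L) q v ->
  fpairing a b u v = (-1) ^+ (p && q) * (a u * b v).
Proof.
move=> al bl hu hv; rewrite fpairingE //.
by rewrite (ssum_homog (form_mul_bilin al bl) hu hv).
Qed.

Lemma fpairing_evenr a b u v : linear a -> linear b ->
  homog (@upar K L) false v -> fpairing a b u v = a u * b v.
Proof.
move=> al bl hv; have [pl _] := fpairing_bilin al bl.
elim/uhomog_ind: u => [p u hu|u u' hu hu'].
  by rewrite (fpairing_homog al bl hu hv) andbF mul1r.
by rewrite (linearD' _ _ (pl _)) hu hu' (linearD' _ _ al) mulrDl.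
Qed.

Lemma fpairing_evenl a b u v : linear a -> linear b ->
  homog (@upar K L) false u -> fpairing a b u v = a u * b v.
Proof.
move=> al bl hu; have [_ pr] := fpairing_bilin al bl.
elim/uhomog_ind: v => [p v hv|v v' hv hv'].
  by rewrite (fpairing_homog al bl hu hv) mul1r.
by rewrite (linearD' _ _ (pr _)) hv hv' (linearD' _ _ bl) mulrDr.
Qed.

Lemma fmul_linear a b : linear a -> linear b -> linear (fmul a b).
Proof.
move=> al bl k x y; have [Dl _ _ _] := DeltaP L.
by have [tl _] := tliftP (fpairing_bilin al bl); rewrite /fmul Dl tl.
Qed.

Lemma fmul1 a b : linear a -> linear b -> fmul a b 1 = a 1 * b 1.
Proof.
move=> al bl; have [_ D1 _ _] := DeltaP L.
have [_ tp] := tliftP (fpairing_bilin al bl).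
by rewrite /fmul D1 tp fpairing_evenl //; apply: homog1.
Qed.

Definition fparn p a : form := if p then fpar a else a.

Lemma fparn_homog p q a u : linear a -> homog (@upar K L) q u ->
  fparn p a u = (-1) ^+ (p && q) * a u.
Proof.
move=> al hu; case: p => /=; last by rewrite mul1r.
by rewrite /fpar hu (linearZ' _ _ al).
Qed.

Lemma fparn_linear p a : linear a -> linear (fparn p a).
Proof. by case: p => //; apply: fpar_linear_form. Qed.

(** The elements of L are primitive: right translation by a homogeneous element of L is
    a superderivation of the product of forms. *)
Lemma fmul_gen p x a b u : linear a -> linear b -> homog lie_par p x ->
  fmul a b (u * i_ x) =
  fmul (fshiftr (i_ x) a) b u + fmul (fparn p a) (fshiftr (i_ x) b) u.
Proof.
move=> al bl hx; have [_ _ DM Di] := DeltaP L; have hix := homog_iota hx.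
have ral := fshiftr_linear (i_ x) al; have rbl := fshiftr_linear (i_ x) bl.
have [ml mr] := tmul_bilin L; have pal := fparn_linear p al.
have [t0l t0p] := tliftP (fpairing_bilin al bl).
have [t1l t1p] := tliftP (fpairing_bilin ral bl).
have [t2l t2p] := tliftP (fpairing_bilin pal rbl).
rewrite /fmul DM Di; elim/tens_homog_ind: (Delta u) => [q q' y y' hy hy'|k z z' hz hz'].
  rewrite (linearD' _ _ (mr _)) (linearD' _ _ t0l).
  rewrite (tmulE _ _ hy' hix) (tmulE _ _ hy' (homog1 L)) andbF expr0 scale1r !mulr1.
  rewrite (linearZ' _ _ t0l) !t0p t1p t2p.
  rewrite (fpairing_homog al bl (homogM hy hix) hy').
  rewrite (fpairing_homog al bl hy (homogM hy' hix)).
  rewrite (fpairing_homog ral bl hy hy') (fpairing_homog pal rbl hy hy').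
  rewrite (fparn_homog p al hy) /fshiftr /GRing.scale /= !mulrA -!signr_addb.
  by congr (_ ^+ _ * _ * _ + _ ^+ _ * _ * _); case: p q q' {hx hix hy hy' pal t2l t2p} => [] [] [].
rewrite ml t0l hz hz' t1l t2l scalerDr addrACA.
by [].
Qed.

End Forms.

(** * Sub-Hopf superalgebras of the finite dual *)

Section SubHopf.
Variables (K : numFieldType) (L : lieSuper K).
Local Notation U := (env L).
Local Notation form := (env L -> K^o).
Implicit Types (a b : form) (x y : U).

Lemma finite_dual_linear a : finite_dual a -> linear a.
Proof.
move=> [d0 [d1 [rho [rl _ _ _] [r [c ->]]]]] k x y /=.
by rewrite rl mulmxDr mulmxDl -scalemxAr -scalemxAl !mxE.
Qed.

(** The coproduct of a matrix element has finite rank, so its factors can be chosen among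
    the translates of the form itself; apply bilinear_slices on either side. *)
Lemma finite_dual_slices a : finite_dual a ->
  exists m (x0 y0 : 'I_m -> U) (c : 'M[K]_m), forall x y,
    a (x * y) = \sum_j (\sum_i c i j * a (x * y0 i)) * a (x0 j * y).
Proof.
move=> fa; have al := finite_dual_linear fa.
move: fa => [d0 [d1 [rho [rl _ rM _] [r [c ae]]]]].
pose u i x := (r *m rho x) 0 i; pose v i y := (rho y *m c) i 0.
have vl i k x y : v i (k *: x + y) = k * v i x + v i y.
  by rewrite /v rl mulmxDl -scalemxAl !mxE.
have [|y0 [c1 e1]] := bilinear_slices (b := fun x y => a (x * y)) (u := u) vl.
  by move=> x y; rewrite ae rM mulmxA -mulmxA mxE.
have [||x0 [c2 e2]] := @bilinear_slices K U U _ (fun y x => a (x * y))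
    (fun j y => \sum_i c1 i j * v i y) (fun j x => a (x * y0 j)).
- by move=> i k x y; rewrite mulrDl -scalerAl al.
- by move=> y x; rewrite e1; apply: eq_bigr => j _; rewrite mulrC.
by exists _, x0, y0, c2 => x y; rewrite e2; apply: eq_bigr => j _; rewrite mulrC.
Qed.

(** The signs of the pairing on the tensor square are absorbed by splitting the factors
    into their homogeneous parts. *)
Lemma fpairing_parts a b x y : linear a -> linear b ->
  \sum_(p : bool) \sum_(q : bool)
    fpairing ((-1) ^+ (p && q) *: hpart (@fpar K L) p a) (hpart (@fpar K L) q b) x y
  = a x * b y.
Proof.
move=> al bl.
have hl c p : linear c -> linear (hpart (@fpar K L) p c).
  by move=> cl k u v; rewrite hpart_form //= (hpart_linear (@upar_linear K L)); apply: cl.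
have sl c (k : K) : linear c -> linear (k *: c : form).
  by move=> cl l u v; rewrite -![(k *: c) _]/(k * c _) cl /GRing.scale /= mulrDr mulrCA.
have tb p q := fpairing_bilin (sl _ ((-1) ^+ (p && q)) (hl _ p al)) (hl _ q bl).
elim/uhomog_ind: x => [r x hx|x x' hx hx']; last first.
  under eq_bigr => p _ do under eq_bigr => q _ do
    rewrite (linearD' _ _ ((tb p q).1 _)).
  under eq_bigr do rewrite big_split.
  by rewrite big_split /= hx hx' (linearD' _ _ al) mulrDl.
elim/uhomog_ind: y => [t y hy|y y' hy hy']; last first.
  under eq_bigr => p _ do under eq_bigr => q _ do
    rewrite (linearD' _ _ ((tb p q).2 _)).
  under eq_bigr do rewrite big_split.
  by rewrite big_split /= hy hy' (linearD' _ _ bl) mulrDr.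
have term p q : fpairing ((-1) ^+ (p && q) *: hpart (@fpar K L) p a)
    (hpart (@fpar K L) q b) x y =
    if (p == r) && (q == t) then a x * b y else 0.
  rewrite (fpairing_homog (sl _ _ (hl _ p al)) (hl _ q bl) hx hy).
  rewrite form_scaleE !hpart_formE // (hpart_id p hx) (hpart_id q hy).
  have [->|_] /= := eqVneq p r; last by rewrite (linear0' al) mulr0 mul0r mulr0.
  have [->|_] /= := eqVneq q t; last by rewrite (linear0' bl) !mulr0.
  by rewrite !mulrA -signr_addb addbb mul1r.
rewrite (bigD1 r) //= (bigD1 t) //= !big1 ?addr0.
- by rewrite term !eqxx.
- by move=> p /negPf pr; apply: big1 => q _; rewrite term pr.
- by move=> q /negPf qt; rewrite term qt andbF.
Qed.

Section Closed.
Variable B : set form.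
Hypothesis B_hopf : sub_hopf B.

Let Blin := sub_hopf_lin B_hopf.

Lemma sub_hopf_linear a : B a -> linear a.
Proof. by move/(sub_hopf_fdual B_hopf)/finite_dual_linear. Qed.

Lemma sub_hopf0 : B 0.
Proof. by have B1 := sub_hopf_unit B_hopf; have := Blin (-1) B1 B1; rewrite scaleN1r addNr. Qed.

Lemma sub_hopfD a b : B a -> B b -> B (a + b).
Proof. by move=> Ba Bb; rewrite -[a]scale1r; apply: Blin. Qed.

Lemma sub_hopfZ k a : B a -> B (k *: a).
Proof. by move=> Ba; rewrite -[_ *: _]addr0; apply: Blin sub_hopf0. Qed.

Lemma sub_hopf_sum I (r : seq I) (P : pred I) (F : I -> form) :
  (forall i, P i -> B (F i)) -> B (\sum_(i <- r | P i) F i).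
Proof. by move=> BF; elim/big_ind: _ => //; [apply: sub_hopf0|apply: sub_hopfD]. Qed.

Lemma sub_hopf_hpart p a : B a -> B (hpart (@fpar K L) p a).
Proof.
by move=> Ba; apply/sub_hopfZ/sub_hopfD => //; apply/sub_hopfZ/(sub_hopf_par B_hopf).
Qed.

Lemma sub_hopf_fshiftl v a : B a -> B (fshiftl v a).
Proof.
move=> Ba; have [s [sB sE]] := sub_hopf_coprod B_hopf Ba.
have -> : fshiftl v a = \sum_(c <- s) \sum_(p : bool) \sum_(q : bool)
    ((-1) ^+ (p && q) * c.1 (hpart (@upar K L) p v)) *: hpart (@fpar K L) q c.2.
  apply/funext => y; rewrite /fshiftl sE fct_sumE; apply: eq_bigr => c _.
  rewrite fct_sumE; apply: eq_bigr => p _; rewrite fct_sumE; apply: eq_bigr => q _.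
  by rewrite /GRing.scale /= mulrA.
rewrite big_seq; apply: sub_hopf_sum => c /sB[_ Bc].
by do 2![apply: sub_hopf_sum => ? _]; apply/sub_hopfZ/sub_hopf_hpart.
Qed.

Lemma sub_hopf_fshiftr v a : B a -> B (fshiftr v a).
Proof.
move=> Ba; have [s [sB sE]] := sub_hopf_coprod B_hopf Ba.
have -> : fshiftr v a = \sum_(c <- s) \sum_(p : bool) \sum_(q : bool)
    ((-1) ^+ (p && q) * hpart (@fpar K L) q c.2 v) *: hpart (@fpar K L) p c.1.
  apply/funext => y; rewrite /fshiftr sE big_seq fct_sumE big_seq.
  apply: eq_bigr => c /sB[Bc _].
  rewrite fct_sumE; apply: eq_bigr => p _; rewrite fct_sumE; apply: eq_bigr => q _.
  rewrite form_scaleE (hpart_formE p _ (sub_hopf_linear Bc)) -mulrA.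
  by congr (_ * _); rewrite mulrC.
rewrite big_seq; apply: sub_hopf_sum => c /sB[Bc _].
by do 2![apply: sub_hopf_sum => ? _]; apply/sub_hopfZ/sub_hopf_hpart.
Qed.

End Closed.

(** By fpairing_parts, a decomposition without signs gives one with signs, for a space of
    forms closed under parity. *)
Lemma fcoprod_rep_exists (B : set form) a m (u v : 'I_m -> form) :
  (forall k a b, B a -> B b -> B (k *: a + b)) ->
  (forall a, B a -> B (fpar a)) -> (forall a, B a -> linear a) ->
  (forall i, B (u i)) -> (forall i, B (v i)) ->
  (forall x y, a (x * y) = \sum_i u i x * v i y) ->
  exists s, fcoprod_rep B a s.
Proof.
move=> BD Bpar Blin Bu Bv ae.
have BZ k b : B b -> B (k *: b).
  move=> Bb; have B0 : B 0 by have := BD (-1) _ _ Bb Bb; rewrite scaleN1r addNr.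
  by rewrite -[_ *: _]addr0; apply: BD.
have Bh p b : B b -> B (hpart (@fpar K L) p b).
  by move=> Bb; apply: BZ; rewrite addrC; apply: BD => //; apply: Bpar.
exists [seq ((-1) ^+ (z.2.1 && z.2.2) *: hpart (@fpar K L) z.2.1 (u z.1),
             hpart (@fpar K L) z.2.2 (v z.1)) | z <- index_enum ('I_m * (bool * bool))%type].
split=> [_ /mapP[z _ ->]|x y]; first by split; [apply: BZ|]; apply: Bh.
rewrite big_map -(pair_bigA _ (fun i pq =>
  fpairing ((-1) ^+ (pq.1 && pq.2) *: hpart (@fpar K L) pq.1 (u i))
           (hpart (@fpar K L) pq.2 (v i)) x y)) /= ae.
apply: eq_bigr => i _; rewrite -(pair_bigA _ (fun p q =>
  fpairing ((-1) ^+ (p && q) *: hpart (@fpar K L) p (u i))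
           (hpart (@fpar K L) q (v i)) x y)) /=.
by rewrite fpairing_parts //; apply: Blin.
Qed.

(** Only the coproduct is not obvious for an intersection. Its factors may be taken among
    combinations of translates of the element, by finite_dual_slices, and every sub-Hopf
    superalgebra that contains an element contains its translates. *)
Lemma hopf_generated_sub_hopf (B T : set form) :
  sub_hopf B -> T `<=` B -> sub_hopf (hopf_generated T).
Proof.
move=> hB TB; split.
- by move=> a /(_ B hB TB); apply: sub_hopf_fdual.
- by move=> k a b ha hb C hC TC; apply: sub_hopf_lin; [exact: hC|exact: ha|exact: hb].
- by move=> a ha C hC TC; apply: sub_hopf_par; [exact: hC|exact: ha].
- by move=> C hC TC; apply: sub_hopf_unit.
- by move=> a b ha hb C hC TC; apply: sub_hopf_mul; [exact: hC|exact: ha|exact: hb].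
- by move=> a ha C hC TC; apply: sub_hopf_antipode; [exact: hC|exact: ha].
move=> a ha; have [m [x0 [y0 [c ae]]]] := finite_dual_slices (sub_hopf_fdual hB (ha _ hB TB)).
apply: (fcoprod_rep_exists (a := a) (u := fun j => \sum_i c i j *: fshiftr (y0 i) a)
  (v := fun j => fshiftl (x0 j) a)).
- by move=> k b b' hb hb' C hC TC; apply: sub_hopf_lin; [exact: hC|exact: hb|exact: hb'].
- by move=> b hb C hC TC; apply: sub_hopf_par; [exact: hC|exact: hb].
- by move=> b /(_ _ hB TB); apply: sub_hopf_linear.
- move=> j C hC TC; apply: sub_hopf_sum => // i _; apply: sub_hopfZ => //.
  by apply: sub_hopf_fshiftr => //; apply: ha.
- by move=> j C hC TC; apply: sub_hopf_fshiftl => //; apply: ha.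
move=> x y; rewrite ae; apply: eq_bigr => j _; rewrite fct_sumE.
by [].
Qed.

End SubHopf.

Section LinearOn.
Variables (K : numFieldType) (L : lieSuper K) (B : set (env L -> K^o)).
Variable phi : (env L -> K^o) -> K.
Hypotheses (Blin : forall k a b, B a -> B b -> B (k *: a + b)) (B0 : B 0).
Hypothesis phiB : linear_on B phi.

Lemma linear_on0 : phi 0 = 0.
Proof.
by have := phiB (-1) B0 B0; rewrite scaleN1r addNr mulN1r addNr.
Qed.

Lemma linear_onZ k a : B a -> phi (k *: a) = k * phi a.
Proof. by move=> Ba; rewrite -[_ *: _ in LHS]addr0 phiB // linear_on0 addr0. Qed.

Lemma linear_on_sum (I : eqType) (s : seq I) (k : I -> K) (f : I -> env L -> K^o) :
  (forall c, c \in s -> B (f c)) ->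
  B (\sum_(c <- s) k c *: f c) /\
  phi (\sum_(c <- s) k c *: f c) = \sum_(c <- s) k c * phi (f c).
Proof.
elim: s => [|c s IH] Bf; first by rewrite !big_nil linear_on0.
have [Bs e] : B (\sum_(c <- s) k c *: f c) /\
  phi (\sum_(c <- s) k c *: f c) = \sum_(c <- s) k c * phi (f c).
  by apply: IH => d ds; apply: Bf; rewrite inE ds orbT.
have Bc : B (f c) by apply: Bf; rewrite mem_head.
by rewrite !big_cons phiB // e; split=> //; apply: Blin.
Qed.

Lemma fcoprodP b : (exists s, fcoprod_rep B b s) -> fcoprod_rep B b (fcoprod B b).
Proof. by move=> [s hs]; apply: (@xgetPex _ [::] [set s | fcoprod_rep B b s]); exists s. Qed.

End LinearOn.

(** * Representations and their matrix elements *)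

Section Representations.
Variables (K : numFieldType) (L : lieSuper K).
Local Notation U := (env L).
Local Notation form := (env L -> K^o).
Local Notation i_ := (@iota_ K L).
Local Notation hp := (hpart (@upar K L)).

Lemma mulmx_alg d : is_alg (1%:M : 'M[K]_d) (fun X Y => X *m Y).
Proof.
split; [split=> [Y c X X'|X c Y Y']|exact: mulmxA|exact: mul1mx|exact: mulmx1].
  by rewrite mulmxDl scalemxAl.
by rewrite mulmxDr scalemxAr.
Qed.

Record alg_rep d (rho : U -> 'M[K]_d) : Prop := AlgRep {
  alg_rep_linear : linear rho;
  alg_rep1 : rho 1 = 1%:M;
  alg_repM : forall x y, rho (x * y) = rho x *m rho y
}.

Lemma env_lift_rep d (f : L -> 'M[K]_d) : lie_compat (fun X Y => X *m Y) f ->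
  alg_rep (env_lift 1%:M (fun X Y => X *m Y) f) /\
  forall x, env_lift 1%:M (fun X Y => X *m Y) f (i_ x) = f x.
Proof. by case/(env_liftP (mulmx_alg d)) => rl r1 rM ri; split. Qed.

Definition coef d (rho : U -> 'M[K]_d) (r : 'rV[K]_d) (c : 'cV[K]_d) : form :=
  fun x => (r *m rho x *m c) 0 0.

Lemma coef_linear d (rho : U -> 'M[K]_d) r c : linear rho -> linear (coef rho r c).
Proof.
by move=> rl k x y; rewrite /coef rl mulmxDr mulmxDl -scalemxAr -scalemxAl !mxE.
Qed.

Lemma hpart_upar p x : hp p (upar x) = (-1) ^+ p *: hp p x.
Proof.
rewrite /hpart uparK scalerA mulrC -scalerA; congr (_ *: _).
by rewrite scalerDr scalerA -expr2 sqrr_sign scale1r addrC.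
Qed.

Lemma hpart_splitE (x : U) : x = hp true x + hp false x.
Proof. by rewrite -[LHS](hpart_sum (@upar K L)) big_bool. Qed.

Lemma upar_hpart (p : bool) (x : U) : homog (@upar K L) p (hp p x).
Proof. exact: hpart_homog (@upar_linear K L) (@uparK K L) p x. Qed.

Lemma hpartM p x y :
  hp p (x * y) = hp false x * hp p y + hp true x * hp (~~ p) y.
Proof.
have hD u v : hp p (u + v) = hp p u + hp p v.
  by have := hpart_linear (@upar_linear K L) p 1 u v; rewrite !scale1r.
rewrite [x in LHS]hpart_splitE [y in LHS]hpart_splitE.
rewrite mulrDl !mulrDr !hD.
rewrite !(hpart_id _ (homogM (upar_hpart _ x) (upar_hpart _ y))).
by case: p {hD} => /=; rewrite ?addr0 ?add0r // addrC.
Qed.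

(** The sum of rho and rho o upar, graded by the swap of the two summands, in a basis that
    diagonalizes the swap. *)
Definition double_rep d (rho : U -> 'M[K]_d) (x : U) : 'M[K]_(d + d) :=
  block_mx (rho (hp false x)) (rho (hp true x)) (rho (hp true x)) (rho (hp false x)).

(** Every finite-dimensional representation is thus a summand of a graded one, where its
    matrix elements have an even row vector (double_rep_coef, row_mx0_pmx). *)
Lemma double_repP d (rho : U -> 'M[K]_d) : alg_rep rho ->
  alg_rep (double_rep rho) /\ forall x, double_rep rho (upar x) = mpar (double_rep rho x).
Proof.
move=> [rl r1 rM]; have rD u v := linearD' u v rl.
split; [split|] => [k x y||x y|x].
- rewrite /double_rep !(hpart_linear (@upar_linear K L)) !rl.
  by rewrite scale_block_mx add_block_mx.
- rewrite /double_rep !(hpart_id _ (homog1 L)) /= r1 (linear0' rl).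
  by rewrite -scalar_mx_block.
- rewrite /double_rep !hpartM !rD !rM mulmx_block /=.
  by congr block_mx; rewrite addrC.
rewrite /double_rep !hpart_upar expr0 expr1 !(linearZ' _ _ rl) scale1r scaleN1r.
rewrite /mpar /pmx !mulmx_block !(mul0mx, mulmx0, mul1mx, mulmx1, addr0, add0r).
by rewrite !(mulNmx, mulmxN, mul1mx, mulmx1, opprK).
Qed.

Lemma double_rep_coef d (rho : U -> 'M[K]_d) r c : alg_rep rho ->
  coef rho r c = coef (double_rep rho) (row_mx r 0) (col_mx c c).
Proof.
move=> [rl _ _]; apply/funext => x; rewrite /coef /double_rep.
rewrite mul_row_block !mul0mx !addr0 mul_row_col -mulmxDl -mulmxDr.
by rewrite -(linearD' _ _ rl) addrC -hpart_splitE.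
Qed.

Lemma row_mx0_pmx d (r : 'rV[K]_d) : row_mx r 0 *m pmx K d d = row_mx r 0.
Proof. by rewrite mul_row_block mulmx1 !mul0mx mulmx0 !addr0. Qed.

Lemma coef_finite_dual d (rho : U -> 'M[K]_d) r c : alg_rep rho ->
  finite_dual (coef rho r c).
Proof.
move=> hr; rewrite double_rep_coef //; have [[dl d1 dM] dg] := double_repP hr.
exists d, d, (double_rep rho); first by split.
by exists (row_mx r 0), (col_mx c c).
Qed.

End Representations.

Section TensorRepresentation.
Variables (K : numFieldType) (L : lieSuper K) (m k d : nat).
Variables (rho1 : env L -> 'M[K]_(m + k)) (rho2 : env L -> 'M[K]_d).
Hypotheses (rho1P : alg_rep rho1) (rho2P : alg_rep rho2).
Hypothesis rho1_par : forall x, rho1 (upar x) = mpar (rho1 x).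
Local Notation i_ := (@iota_ K L).
Local Notation D := ((m + k) * d)%N.
Local Notation sg := (msign K m k).

Lemma tensmxDl p1 q1 p2 q2 (A A' : 'M[K]_(p1, q1)) (B : 'M[K]_(p2, q2)) :
  (A + A') *t B = A *t B + A' *t B.
Proof. by apply/matrixP => i j; rewrite !mxE mulrDl. Qed.
Lemma tensmxDr p1 q1 p2 q2 (A : 'M[K]_(p1, q1)) (B B' : 'M[K]_(p2, q2)) :
  A *t (B + B') = A *t B + A *t B'.
Proof. by apply/matrixP => i j; rewrite !mxE mulrDr. Qed.
Lemma tensmxZl p1 q1 p2 q2 c (A : 'M[K]_(p1, q1)) (B : 'M[K]_(p2, q2)) :
  (c *: A) *t B = c *: (A *t B).
Proof. by apply/matrixP => i j; rewrite !mxE mulrA. Qed.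
Lemma tensmxZr p1 q1 p2 q2 c (A : 'M[K]_(p1, q1)) (B : 'M[K]_(p2, q2)) :
  A *t (c *: B) = c *: (A *t B).
Proof. by apply/matrixP => i j; rewrite !mxE mulrCA. Qed.

Lemma row_tens_col d1 d2 (r1 : 'rV[K]_d1) (r2 : 'rV[K]_d2) (c1 : 'cV[K]_d1)
    (c2 : 'cV[K]_d2) :
  ((r1 *t r2 : 'rV_(d1 * d2)) *m (c1 *t c2 : 'cV_(d1 * d2))) 0 0 =
  (r1 *m c1) 0 0 * (r2 *m c2) 0 0.
Proof.
have /(congr1 (fun A : 'M_1 => A 0 0)) := tensmx_mul r1 r2 c1 c2.
move=> ->; rewrite [LHS]mxE.
by rewrite ![(mxtens_unindex _).1]ord1 ![(mxtens_unindex _).2]ord1.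
Qed.

(** The sign operator on the first factor is the super sign rule: an odd x on the right
    factor passes the vectors of the left factor. *)
Definition tens_gen (x : L) : 'M[K]_D :=
  rho1 (i_ x) *t 1%:M + \sum_(p : bool) sg p *t rho2 (i_ (hpart lie_par p x)).

Lemma tens_gen_homog p x : homog lie_par p x ->
  tens_gen x = rho1 (i_ x) *t 1%:M + sg p *t rho2 (i_ x).
Proof.
move=> hx; rewrite /tens_gen; congr (_ + _); rewrite (bigD1 p) //= big1.
  by rewrite addr0 (hpart_id _ hx) eqxx.
move=> q /negPf qp; rewrite (hpart_id _ hx) qp (linear0' (@iota_linear _ _)).
by rewrite (linear0' (alg_rep_linear rho2P)) tensmx0.
Qed.

Lemma rho1_homog p x : homog lie_par p x -> homog (@mpar K m k) p (rho1 (i_ x)).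
Proof.
move=> hx; rewrite /homog -rho1_par upar_iota hx (linearZ' _ _ (@iota_linear _ _)).
by rewrite (linearZ' _ _ (alg_rep_linear rho1P)).
Qed.

Lemma tens_gen_compat : lie_compat (fun X Y => X *m Y) tens_gen.
Proof.
have [[l1 _ M1] [l2 _ M2]] := (rho1P, rho2P).
split=> [c x y|p q x y hx hy].
  rewrite /tens_gen iota_linear l1 tensmxDl tensmxZl scalerDr scaler_sumr.
  rewrite addrACA -big_split; congr (_ + _); apply: eq_bigr => p _ /=.
  by rewrite (hpart_linear (@lie_par_linear _ L)) iota_linear l2 tensmxDr tensmxZr.
have hxy : homog lie_par (p (+) q) (lie_br x y).
  rewrite /homog lie_br_par hx hy; have [bl br] := @lie_br_bilin _ L.
  by rewrite (linearZ' _ _ (bl _)) (linearZ' _ _ (br _)) scalerA signr_addb.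
rewrite (tens_gen_homog hx) (tens_gen_homog hy) (tens_gen_homog hxy).
rewrite !mulmxDl !mulmxDr !tensmx_mul !mul1mx !mulmx1.
rewrite (msign_comm q (rho1_homog hx)) (msign_comm p (rho1_homog hy)) !msignM.
have e1 : rho1 (i_ x) *m rho1 (i_ y) =
    (-1) ^+ (p && q) *: (rho1 (i_ y) *m rho1 (i_ x)) + rho1 (i_ (lie_br x y)).
  by rewrite -!M1 (iota_br hx hy) l1.
have e2 : rho2 (i_ x) *m rho2 (i_ y) =
    (-1) ^+ (p && q) *: (rho2 (i_ y) *m rho2 (i_ x)) + rho2 (i_ (lie_br x y)).
  by rewrite -!M2 (iota_br hx hy) l2.
rewrite e1 e2 tensmxDl tensmxDr !tensmxZl tensmxZr (andbC q p) (addbC q p).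
rewrite !scalerDr !scalerA -expr2 sqrr_sign scale1r.
set A := (_ *m _) *t 1%:M; set B := rho1 _ *t 1%:M.
set C := _ *t (rho2 _ *m rho2 _); set E := _ *t rho2 (i_ (lie_br x y)).
set F := (sg q *m _) *t _; set G := (sg p *m _) *t _.
move: (_ *: A) (_ *: C) (_ *: F) => a c f.
by apply/matrixP => i j; rewrite !mxE; ring.
Qed.

Definition tens_rep := env_lift 1%:M (fun X Y => X *m Y) tens_gen.

(** Both sides satisfy the same recursion along right multiplication by a generator. The
    parity of the first form is the action of pmx on its column c1 alone, because its
    row is even. *)
Lemma fmul_coef r1 c1 r2 c2 : r1 *m pmx K m k = r1 ->
  fmul (coef rho1 r1 c1) (coef rho2 r2 c2) =
  coef tens_rep (r1 *t r2 : 'rV_D) (c1 *t c2 : 'cV_D).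
Proof.
move=> r1s; have [[l1 u1 M1] [l2 u2 M2]] := (rho1P, rho2P).
have [[tl t1 tM] ti] := env_lift_rep tens_gen_compat.
have cl1 r c : linear (coef rho1 r c) by exact: coef_linear.
have cl2 r c : linear (coef rho2 r c) by exact: coef_linear.
apply/funext => u; elim/env_rgen_ind: u c1 c2 => [|a u v hu hv|p u x hx hu] c1 c2.
- rewrite fmul1 // /coef /tens_rep t1 u1 u2 !mulmx1.
  exact/esym/row_tens_col.
- by rewrite fmul_linear // hu hv (coef_linear _ _ tl).
have sr1 q : r1 *m sg q = r1 by case: q => //=; rewrite mulmx1.
have e1 : fshiftr (i_ x) (coef rho1 r1 c1) = coef rho1 r1 (rho1 (i_ x) *m c1).
  by apply/funext => v; rewrite /fshiftr /coef M1 !mulmxA.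
have e2 : fshiftr (i_ x) (coef rho2 r2 c2) = coef rho2 r2 (rho2 (i_ x) *m c2).
  by apply/funext => v; rewrite /fshiftr /coef M2 !mulmxA.
have e3 : fparn p (coef rho1 r1 c1) = coef rho1 r1 (sg p *m c1).
  apply/funext => v; case: (p); rewrite /= ?mul1mx // /fpar /coef rho1_par /mpar.
  by rewrite !mulmxA r1s.
rewrite (fmul_gen _ _ _ hx) // e1 e2 e3 !hu /coef /tens_rep tM ti (tens_gen_homog hx).
have e : (rho1 (i_ x) *t 1%:M + sg p *t rho2 (i_ x)) *m (c1 *t c2 : 'cV_D) =
    ((rho1 (i_ x) *m c1) *t c2 : 'cV_D) + ((sg p *m c1) *t (rho2 (i_ x) *m c2) : 'cV_D).
  rewrite mulmxDl; congr (_ + _); last exact: (tensmx_mul (sg p) (rho2 (i_ x)) c1 c2).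
  exact: (etrans (tensmx_mul (rho1 (i_ x)) 1%:M c1 c2) (congr1 _ (mul1mx c2))).
by rewrite !mulmxA -[in RHS]mulmxA e [in RHS]mulmxDr [RHS]mxE.
Qed.

End TensorRepresentation.

Section DualRepresentation.
Variables (K : numFieldType) (L : lieSuper K) (m k : nat).
Variable rho : env L -> 'M[K]_(m + k).
Hypotheses (rhoP : alg_rep rho) (rho_par : forall x, rho (upar x) = mpar (rho x)).
Local Notation i_ := (@iota_ K L).
Local Notation sg := (msign K m k).

Lemma sopmul_homogl p (x y : env L) : homog (@upar K L) p x ->
  sopmul x y = (if p then upar y else y) * x.
Proof.
move=> hx; have [ml mr] := sopmul_bilin L.
elim/uhomog_ind: y => [q y hy|y y' hy hy'].
  rewrite (sopmulE hx hy); case: (p); last by rewrite scale1r.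
  by rewrite hy scalerAl.
rewrite (linearD' _ _ (mr _)) hy hy' -mulrDl.
by case: (p); rewrite ?(linearD' _ _ (@upar_linear _ _)).
Qed.

(** The contragredient representation; for odd x the sign operator sg makes up for the
    signs of the super transpose. *)
Definition dual_gen (x : L) : 'M[K]_(m + k) :=
  - \sum_(p : bool) (rho (i_ (hpart lie_par p x)))^T *m sg p.

Lemma dual_gen_homog p x : homog lie_par p x ->
  dual_gen x = - ((rho (i_ x))^T *m sg p).
Proof.
move=> hx; congr (- _); rewrite (bigD1 p) //= big1.
  by rewrite addr0 (hpart_id _ hx) eqxx.
move=> q /negPf qp; rewrite (hpart_id _ hx) qp (linear0' (@iota_linear _ _)).
by rewrite (linear0' (alg_rep_linear rhoP)) trmx0 mul0mx.
Qed.

Lemma dual_gen_compat : lie_compat (fun X Y => X *m Y) dual_gen.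
Proof.
have [rl _ rM] := rhoP.
split=> [c x y|p q x y hx hy].
  rewrite /dual_gen scalerN -opprD scaler_sumr -big_split; congr (- _).
  apply: eq_bigr => p _ /=.
  rewrite (hpart_linear (@lie_par_linear _ L)) iota_linear rl.
  by rewrite linearP /= mulmxDl scalemxAl.
have hxy : homog lie_par (p (+) q) (lie_br x y).
  rewrite /homog lie_br_par hx hy; have [bl br] := @lie_br_bilin _ L.
  by rewrite (linearZ' _ _ (bl _)) (linearZ' _ _ (br _)) scalerA signr_addb.
have hT r z : homog lie_par r z -> homog (@mpar K m k) r (rho (i_ z))^T.
  by move=> hz; rewrite /homog mpar_tr (rho1_homog rhoP rho_par hz) linearZ.
rewrite (dual_gen_homog hx) (dual_gen_homog hy) (dual_gen_homog hxy).
rewrite !mulNmx !mulmxN !opprK !mulmxA.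
have e z w r t : homog lie_par t z ->
    w *m sg r *m (rho (i_ z))^T *m sg t =
    (-1) ^+ (r && t) *: (w *m (rho (i_ z))^T *m sg (r (+) t)) :> 'M_(m + k).
  move=> hz; rewrite -msignM !mulmxA -(mulmxA w _ (sg r)) (msign_comm r (hT _ _ hz)).
  by rewrite -scalemxAr -scalemxAl scalerA -expr2 sqrr_sign scale1r mulmxA.
rewrite (e _ _ _ _ hx) (e _ _ _ _ hy) -!trmx_mul -!rM andbC addbC.
rewrite scalerA -expr2 sqrr_sign scale1r (iota_br hx hy) rl !linearD /=.
by rewrite mulmxDl addrK linearZ /= -scalemxAl [q && p]andbC.
Qed.

Definition dual_rep := env_lift 1%:M (fun X Y => X *m Y) dual_gen.

(** Left multiplication by a generator becomes, under the antipode, right multiplication,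
    and only changes the column c. *)
Lemma antipode_coef r c : r *m pmx K m k = r ->
  fantipode (coef rho r c) = coef dual_rep c^T r^T.
Proof.
move=> rs; have [rl r1 rM] := rhoP.
have [[dl d1 dM] di] := env_lift_rep dual_gen_compat.
have [Sl S1 SM Si] := antipodeP L.
apply/funext => u; rewrite /fantipode.
elim/env_lgen_ind: u c => [|a u v hu hv|p u x hx hu] c.
- by rewrite S1 /coef r1 /dual_rep d1 !mulmx1 -trmx_mul [RHS]mxE.
- by rewrite Sl (coef_linear _ _ rl) hu hv (coef_linear _ _ dl).
have -> : coef rho r c (antipode (i_ x * u)) =
    coef rho r (- (sg p *m rho (i_ x) *m c)) (antipode u).
  rewrite SM Si (@sopmul_homogl p); last first.
    by rewrite /homog -scaleN1r (linearZ' _ _ (@upar_linear _ _))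
      (homog_iota hx) !scalerA mulrC.
  rewrite /coef rM -scaleN1r (linearZ' _ _ rl) scaleN1r; congr (fun_of_matrix _ _ _).
  case: (p); rewrite ?rho_par /mpar /= ?mul1mx !(mulmxN, mulNmx) !mulmxA ?rs //.
rewrite hu /coef /dual_rep dM di (dual_gen_homog hx) linearN /= !trmx_mul.
have -> : (sg p)^T = sg p by case: (p); rewrite /= ?trmx1 ?pmx_tr.
by rewrite !(mulmxN, mulNmx) !mulmxA.
Qed.

End DualRepresentation.

(** * Representations closed under adjunction *)

Section UnitaryDual.
Variables (C : numClosedFieldType) (L : lieSuper C) (star : L -> L).
Hypothesis star_even : forall h, homog lie_par false h -> homog lie_par false (star h).
Local Notation U := (env L).
Local Notation form := (env L -> C^o).
Local Notation i_ := (@iota_ C L).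

(** The map star plays the part of the adjunction that defines a compact real form of
    the even part of L. *)
Definition star_rep d (rho : U -> 'M[C]_d) : Prop := alg_rep rho /\
  forall h, homog lie_par false h -> adjmx (rho (i_ h)) = rho (i_ (star h)).

Definition unitary_dual : set form := [set a | exists d (rho : U -> 'M[C]_d),
  star_rep rho /\ exists r c, a = coef rho r c].

Lemma adjmx0 m d : adjmx (0 : 'M[C]_(m, d)) = 0.
Proof. by apply/matrixP => i j; rewrite !mxE rmorph0. Qed.
Lemma adjmx1 d : adjmx (1%:M : 'M[C]_d) = 1%:M.
Proof. by apply/matrixP => i j; rewrite !mxE rmorph_nat eq_sym. Qed.
Lemma adjmx_block m1 m2 n1 n2 (A : 'M[C]_(m1, n1)) B D (E : 'M[C]_(m2, n2)) :
  adjmx (block_mx A B D E) = block_mx (adjmx A) (adjmx D) (adjmx B) (adjmx E).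
Proof. by rewrite /adjmx map_block_mx tr_block_mx. Qed.

Lemma star_rep_double d (rho : U -> 'M[C]_d) : star_rep rho ->
  star_rep (double_rep rho).
Proof.
move=> [rP rs]; split=> [|h hh]; first by have [] := double_repP rP.
have hs := star_even hh.
rewrite /double_rep !(hpart_id _ (homog_iota hh)) !(hpart_id _ (homog_iota hs)) /=.
by rewrite (linear0' (alg_rep_linear rP)) adjmx_block adjmx0 rs.
Qed.

Lemma unitary_dual_graded a : unitary_dual a ->
  exists d (rho : U -> 'M[C]_(d + d)), star_rep rho /\
    (forall x, rho (upar x) = mpar (rho x)) /\
    exists r c, a = coef rho r c /\ r *m pmx C d d = r.
Proof.
move=> [d [rho [rP [r [c ->]]]]]; exists d, (double_rep rho).
split; first exact: star_rep_double.
split; first by have [] := double_repP rP.1.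
exists (row_mx r 0), (col_mx c c); split; first exact: double_rep_coef rP.1.
exact: row_mx0_pmx.
Qed.

Lemma unitary_dual_lin k a b : unitary_dual a -> unitary_dual b ->
  unitary_dual (k *: a + b).
Proof.
move=> [d [rho [[[rl r1 rM] rs] [r [c ->]]]]] [d' [rho' [[[rl' r1' rM'] rs'] [r' [c' ->]]]]].
exists (d + d')%N, (fun x => block_mx (rho x) 0 0 (rho' x)).
split; last first.
  exists (row_mx r r'), (col_mx (k *: c) c'); apply/funext => x.
  rewrite /coef mul_row_block !mulmx0 addr0 add0r mul_row_col mxE -scalemxAr mxE.
  by [].
split; first split.
- by move=> l x y; rewrite rl rl' scale_block_mx !scaler0 add_block_mx !addr0.
- by rewrite r1 r1' -scalar_mx_block.
- by move=> x y; rewrite rM rM' mulmx_block !mulmx0 !mul0mx !addr0 !add0r.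
by move=> h hh; rewrite adjmx_block !adjmx0 rs ?rs'.
Qed.

Lemma unitary_dual_par a : unitary_dual a -> unitary_dual (fpar a).
Proof.
move=> [d [rho [[[rl r1 rM] rs] [r [c ->]]]]].
exists d, (fun x => rho (upar x)); split; last by exists r, c.
split; first split.
- by move=> l x y; rewrite upar_linear rl.
- by rewrite upar1.
- by move=> x y; rewrite uparM rM.
move=> h hh; have hs := star_even hh.
by rewrite !upar_iota hh hs expr0 !scale1r rs.
Qed.

Lemma unitary_dual_unit : unitary_dual (@ueps C L).
Proof.
have [el e1 eM ei] := uepsP L.
exists 1%N, (fun x => (ueps x)%:M); split.
  split; first split.
  - by move=> l x y; rewrite el; apply/matrixP => i j; rewrite !mxE mulrnDl mulrnAr.
  - by rewrite e1.
  - by move=> x y; rewrite eM scalar_mxM.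
  by move=> h _; rewrite !ei; apply/matrixP => i j; rewrite !mxE !mul0rn rmorph0.
by exists 1%:M, 1%:M; apply/funext => x; rewrite /coef mul1mx mulmx1 mxE eqxx.
Qed.

Lemma adjmxD m d (A B : 'M[C]_(m, d)) : adjmx (A + B) = adjmx A + adjmx B.
Proof. by apply/matrixP => i j; rewrite !mxE rmorphD. Qed.
Lemma adjmxN m d (A : 'M[C]_(m, d)) : adjmx (- A) = - adjmx A.
Proof. by apply/matrixP => i j; rewrite !mxE rmorphN. Qed.
Lemma adjmx_tens m n p q (A : 'M[C]_(m, n)) (B : 'M[C]_(p, q)) :
  adjmx (A *t B) = adjmx A *t adjmx B.
Proof. by apply/matrixP => i j; rewrite !mxE rmorphM. Qed.

Lemma unitary_dual_mul a b : unitary_dual a -> unitary_dual b ->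
  unitary_dual (fmul a b).
Proof.
move=> /unitary_dual_graded[d [rho1 [[P1 s1] [g1 [r1 [c1 [-> r1s]]]]]]].
move=> [d2 [rho2 [[P2 s2] [r2 [c2 ->]]]]].
exists _, (tens_rep rho1 rho2); split; last by do 2!eexists; apply: fmul_coef.
have [tP ti] := env_lift_rep (tens_gen_compat P1 P2 g1).
split=> // h hh; have hs := star_even hh.
rewrite /tens_rep !ti (tens_gen_homog _ P2 hh) (tens_gen_homog _ P2 hs).
by rewrite adjmxD !adjmx_tens !adjmx1 s1 // s2.
Qed.

Lemma unitary_dual_antipode a : unitary_dual a -> unitary_dual (fantipode a).
Proof.
move=> /unitary_dual_graded[d [rho [[P s] [g [r [c [-> rs]]]]]]].
rewrite antipode_coef //; exists _, (dual_rep rho); split; last by do 2!eexists.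
have [dP di] := env_lift_rep (dual_gen_compat P g).
split=> // h hh; have hs := star_even hh.
rewrite /dual_rep !di (dual_gen_homog P hh) (dual_gen_homog P hs) /= !mulmx1.
by rewrite adjmxN -s //; apply/matrixP => i j; rewrite !mxE.
Qed.

(** The adjunction passes to direct sums, doublings, tensor products and duals, because
    an even element h acts on a tensor product by h tensor 1 + 1 tensor h. *)
Lemma unitary_dual_sub_hopf : sub_hopf unitary_dual.
Proof.
split.
- by move=> _ [d [rho [[rP _] [r [c ->]]]]]; apply: coef_finite_dual.
- exact: unitary_dual_lin.
- exact: unitary_dual_par.
- exact: unitary_dual_unit.
- exact: unitary_dual_mul.
- exact: unitary_dual_antipode.
move=> _ [d [rho [rP [r [c ->]]]]]; have [[rl r1 rM] rs] := rP.
apply: (fcoprod_rep_exists (u := fun i => coef rho r (delta_mx i 0))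
  (v := fun i => coef rho (delta_mx 0 i) c)).
- exact: unitary_dual_lin.
- exact: unitary_dual_par.
- by move=> _ [d' [rho' [[[rl' _ _] _] [r' [c' ->]]]]]; apply: coef_linear.
- by move=> i; exists d, rho; split=> //; do 2!eexists.
- by move=> i; exists d, rho; split=> //; do 2!eexists.
move=> x y; rewrite /coef rM mulmxA -mulmxA mxE; apply: eq_bigr => i _.
by rewrite -colE -mulmxA -rowE !mxE.
Qed.

End UnitaryDual.

Section Invariants.
Variables (C : numClosedFieldType) (L : lieSuper C) (d : nat).
Variable rho : env L -> 'M[C]_d.
Hypothesis rhoP : alg_rep rho.
Hypothesis rho_adj : forall h, exists h', adjmx (rho (iota_ h)) = rho (iota_ h').

(** Complete reducibility: r = r u0 + r u' with u' in the augmentation ideal J and r u0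
    orthogonal to r J. As J is an ideal, the squared norm of r u0 h is the inner
    product of an element of r J with r u0, hence 0. *)
Lemma invariant_projection (r : 'rV[C]_d) : exists u0 : env L,
  ueps u0 = 1 /\ forall h, r *m rho u0 *m rho (iota_ h) = 0.
Proof.
have [rl r1 rM] := rhoP; have [el e1 eM ei] := uepsP L.
pose P w := exists u, ueps u = 0 /\ w = r *m rho u.
have [|k _ _ [x [ex ->]] [y [ey ->]]|M PM Mmax] := @subspace_basis _ _ P.
- by exists 0; rewrite (linear0' el) (linear0' rl) mulmx0.
- exists (k *: x + y); rewrite el rl ex ey scaler0 addr0; split=> //.
  by rewrite mulmxDr scalemxAr.
have [v vM] := orthogonal_projection M r.
have [u [eu ru]] : P (v *m M).
  apply: subspace_mulmx PM _.
  - by exists 0; rewrite (linear0' el) (linear0' rl) mulmx0.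
  move=> k _ _ [x [ex ->]] [y [ey ->]].
  exists (k *: x + y); rewrite el rl ex ey scaler0 addr0; split=> //.
  by rewrite mulmxDr scalemxAr.
exists (1 - u); split.
  by rewrite addrC -scaleN1r el eu e1 scaler0 add0r.
have e0 : r *m rho (1 - u) = r - v *m M.
  by rewrite addrC -scaleN1r rl r1 mulmxDr mulmx1 scaleN1r mulmxN -ru addrC.
move=> h; apply: adjmx_eq0; have [h' hh'] := rho_adj h.
rewrite [adjmx (_ *m rho (iota_ h))]adjmxM hh' !mulmxA.
have /submxP[z ->] : (r *m rho (1 - u) *m rho (iota_ h) *m rho (iota_ h') <= M)%MS.
  apply: Mmax; exists ((1 - u) * iota_ h * iota_ h').
  by rewrite !eM !ei !mulr0 !rM !mulmxA; split.
rewrite -mulmxA e0 -[M *m _]adjmxK (adjmxM M) adjmxK vM.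
by rewrite adjmx0 mulmx0.
Qed.

End Invariants.

(** * Matrices of osp(2|2n) *)

Section OspMatrices.
Variables (K : numFieldType) (n : nat).
Local Notation N := (n + n)%N.
Local Notation M := 'M[K]_(2 + N).
Local Notation S := (form_sym K).
Local Notation J := (form_skew K n).
Local Notation par := (@mpar K 2 N).
Local Notation osp := (osp_space (osp2_form K n)).
Local Notation pd := (homog (@lie_par _ (osp2 K n))).

Lemma form_sym_tr : S^T = S.
Proof. by apply/matrixP => i j; rewrite !mxE eq_sym. Qed.
Lemma form_sym_sqr : S *m S = 1%:M.
Proof.
apply/matrixP => i j; rewrite !mxE big_ord_recl big_ord1 !mxE.
by case: i j => [[|[|i]] hi] [[|[|j]] hj] //=;
  rewrite ?(mulr0, mul0r, mulr1, mul1r, addr0, add0r).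
Qed.
Lemma form_skew_tr : J^T = - J.
Proof.
rewrite /form_skew tr_block_mx !trmx0 linearN /= trmx1 opp_block_mx !oppr0 opprK.
by [].
Qed.
Lemma form_skew_sqr : J *m J = - 1%:M.
Proof.
rewrite /form_skew mulmx_block !(mul0mx, mulmx0, mul1mx, mulmx1, addr0, add0r).
by rewrite (scalar_mx_block n n 1) opp_block_mx !oppr0.
Qed.

(** The osp condition determines the lower left block of an odd matrix from its upper
    right block B. *)
Definition oddmx (B : 'M[K]_(2, N)) : M := block_mx 0 B (- (J *m B^T *m S)) 0.

Lemma oddmx_linear : linear oddmx.
Proof.
move=> k A B; rewrite /oddmx scale_block_mx add_block_mx !scaler0 !addr0.
by rewrite linearP /= mulmxDr mulmxDl -scalemxAr -scalemxAl opprD scalerN.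
Qed.

Lemma mpar_block A B D (E : 'M[K]_N) :
  par (block_mx A B D E) = block_mx A (- B) (- D) E.
Proof.
rewrite /mpar /pmx !mulmx_block !(mul0mx, mulmx0, mul1mx, mulmx1, addr0, add0r).
by rewrite !(mulNmx, mulmxN, mul1mx, mulmx1, opprK).
Qed.

Lemma oddmx_homog B : homog par true (oddmx B).
Proof.
by rewrite /homog expr1 scaleN1r /oddmx mpar_block opp_block_mx !oppr0.
Qed.

Lemma oddmx_osp B : oddmx B \in osp.
Proof.
rewrite osp_spaceE (osp_def_homog _ (oddmx_homog B)) /= /pmx /oddmx /osp2_form.
rewrite tr_block_mx !trmx0 !mulmx_block !(mul0mx, mulmx0, addr0, add0r, mul1mx).
rewrite add_block_mx !addr0 -(block_mx0 _ 2 N 2 N); apply/eqP; congr block_mx.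
  rewrite !(linearN, mulNmx) /= !trmx_mul trmxK form_sym_tr form_skew_tr.
  by rewrite !(mulmxN, mulNmx) opprK -!mulmxA form_skew_sqr !mulmxN mulmx1 addNr.
rewrite !(mulNmx, mulmxN, mul1mx) opprK !mulmxA form_skew_sqr.
by rewrite !mulNmx mul1mx subrr.
Qed.

Lemma osp_oddP X : X \in osp -> homog par true X -> X = oddmx (ursubmx X).
Proof.
move=> XO hX; have := XO; rewrite osp_spaceE (osp_def_homog _ hX) /=.
move: hX; rewrite -[X]submxK /homog expr1 scaleN1r mpar_block opp_block_mx.
move=> /eq_block_mx[A0 _ _ E0].
have half m' n' (Z : 'M[K]_(m', n')) : Z = - Z -> Z = 0.
  by move=> /eqP; rewrite -addr_eq0 -mulr2n -scaler_nat scaler_eq0 pnatr_eq0 => /eqP.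
rewrite (half _ _ _ A0) (half _ _ _ E0) block_mxKur /pmx /osp2_form.
rewrite tr_block_mx !trmx0 !mulmx_block !(mul0mx, mulmx0, addr0, add0r, mul1mx).
rewrite add_block_mx !addr0 -(block_mx0 _ 2 N 2 N) => /eqP/eq_block_mx[_ _ h _].
rewrite /oddmx; congr block_mx.
move/(congr1 (fun Z => J *m Z)): h; rewrite mulmx0 mulmxDr !mulmxA.
rewrite mulmxN mulmx1 (mulNmx J) form_skew_sqr opprK mul1mx.
by move=> h; apply/eqP; rewrite -addr_eq0 addrC; apply/eqP.
Qed.

Lemma osp_evenP X : X \in osp -> homog par false X ->
  exists D Z, [/\ X = block_mx D 0 0 Z, D^T *m S + S *m D = 0
                & Z^T *m J + J *m Z = 0].
Proof.
move=> XO hX; have := XO; rewrite osp_spaceE (osp_def_homog _ hX) /= mul1mx.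
move: hX; rewrite -[X]submxK /homog expr0 scale1r mpar_block.
move=> /eq_block_mx[_ B0 C0 _].
have half m' n' (Z : 'M[K]_(m', n')) : - Z = Z -> Z = 0.
  move=> /esym/eqP; rewrite -addr_eq0 -mulr2n -scaler_nat scaler_eq0.
  by rewrite pnatr_eq0 => /eqP.
rewrite (half _ _ _ B0) (half _ _ _ C0) /osp2_form.
rewrite tr_block_mx !trmx0 !mulmx_block !(mul0mx, mulmx0, addr0, add0r).
rewrite add_block_mx !addr0 -(block_mx0 _ 2 N 2 N) => /eqP/eq_block_mx[hD _ _ hZ].
by exists (ulsubmx X), (drsubmx X).
Qed.

Lemma so2P (D : 'M[K]_2) : D^T *m S + S *m D = 0 ->
  [/\ D 0 1 = 0, D 1 0 = 0 & D 1 1 = - D 0 0].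
Proof.
move=> h; have hij i j := congr1 (fun Z : 'M_2 => Z i j) h.
have := (hij 0 0, hij 0 1, hij 1 1); rewrite !mxE !big_ord_recl !big_ord0 !mxE /=.
have -> : lift ord0 ord0 = 1 :> 'I_2 by apply: val_inj.
have -> : ord0 = 0 :> 'I_2 by apply: val_inj.
rewrite !(mulr0, mul0r, mulr1, mul1r, addr0, add0r) => -[[h0 h1] h2].
have half (z : K) : z + z = 0 -> z = 0.
  by move/eqP; rewrite -mulr2n mulrn_eq0 => /eqP.
by split; [apply: half|apply: half|apply/eqP; rewrite -addr_eq0 addrC h1].
Qed.

(** Z is conjugate to the opposite of its transpose by the form. *)
Lemma sp_trace0 (Z : 'M[K]_N) : Z^T *m J + J *m Z = 0 -> \tr Z = 0.
Proof.
move=> /(congr1 (fun Y => \tr (J *m Y))); rewrite mulmx0 mxtrace0 mulmxDr linearD /=.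
rewrite [J *m (J *m Z)]mulmxA form_skew_sqr mulNmx mul1mx linearN /=.
rewrite mulmxA mxtrace_mulC mulmxA form_skew_sqr mulNmx mul1mx linearN /= mxtrace_tr.
by move/eqP; rewrite -opprD oppr_eq0 -mulr2n mulrn_eq0 => /eqP.
Qed.

(** Rows of index j >= 2n vanish, so that families may be indexed by nat. *)
Definition unit_row (j : nat) : 'rV[K]_N := \row_l (l == j :> nat)%:R.

Lemma unit_row_sum (w : 'rV[K]_N) :
  w = \sum_(0 <= l < N) (w *m (unit_row l)^T) 0 0 *: unit_row l.
Proof.
rewrite big_mkord {1}[w]row_sum_delta; apply: eq_bigr => l _.
have -> : unit_row l = delta_mx 0 l by apply/rowP => j; rewrite !mxE eqxx.
congr (_ *: _); rewrite mxE (bigD1 l) //= big1 ?addr0 => [|j /negPf jl].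
  by rewrite !mxE !eqxx mulr1.
by rewrite !mxE jl andbF mulr0.
Qed.

Lemma trace_unit_rows (Z : 'M[K]_N) :
  \sum_(0 <= k < N) (unit_row k *m Z *m (unit_row k)^T) 0 0 = \tr Z.
Proof.
rewrite big_mkord; apply: eq_bigr => l _.
have -> : unit_row l = delta_mx 0 l by apply/rowP => j; rewrite !mxE eqxx.
by rewrite -rowE trmx_delta -colE !mxE.
Qed.

Lemma trace_unit_rows1 :
  \sum_(0 <= k < N) (unit_row k *m (unit_row k)^T) 0 0 = N%:R.
Proof. by rewrite -(mxtrace1 K N) -trace_unit_rows; under [RHS]eq_bigr do rewrite mulmx1. Qed.

(** The eigenvectors of gl(1): s = 0 for g_+ and s = 1 for g_-. *)
Definition odd_row (s : 'I_2) (w : 'rV[K]_N) : M := oddmx (delta_mx s 0 *m w).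

Lemma odd_row_linear s : linear (odd_row s).
Proof. by move=> k v w; rewrite /odd_row mulmxDr -scalemxAr oddmx_linear. Qed.

(** The upper left block vanishes because the form J is skew, the lower right one because
    the diagonal of the form S vanishes. *)
Lemma odd_row_anticomm s v w :
  odd_row s v *m odd_row s w + odd_row s w *m odd_row s v = 0.
Proof.
rewrite /odd_row /oddmx !mulmx_block !(mul0mx, mulmx0, addr0, add0r).
rewrite add_block_mx !addr0 -(block_mx0 _ 2 N 2 N) !trmx_mul.
have SS (z : 'rV[K]_N) : delta_mx 0 s *m (S *m (delta_mx s 0 *m z)) = 0 :> 'M_(1, N).
  rewrite !mulmxA; suff -> : delta_mx 0 s *m S *m delta_mx s 0 = 0 :> 'M_1 by rewrite mul0mx.
  by apply/matrixP => i j; rewrite -rowE -colE !mxE eqxx.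
rewrite !trmx_delta; congr block_mx; last first.
  by rewrite !mulNmx -!mulmxA !SS !mulmx0 oppr0 addr0.
have sk : v *m J *m w^T = - (w *m J *m v^T).
  have -> : v *m J *m w^T = (v *m J *m w^T)^T.
    by apply/matrixP => i j; rewrite [RHS]mxE !ord1.
  by rewrite !trmx_mul trmxK form_skew_tr mulNmx mulmxN mulmxA.
rewrite !mulmxN -opprD -!mulmxA -mulmxDr [w *m _]mulmxA [v *m _]mulmxA.
rewrite [v *m J *m _]mulmxA [w *m J *m _]mulmxA sk mulNmx addNr mulmx0 oppr0.
by [].
Qed.

(** The bracket is odd and in osp, so that it is determined by its upper right block, on
    whose row of index s the so(2) part acts by its diagonal entry. *)
Lemma even_odd_row s w (D : 'M[K]_2) (Z : 'M[K]_N) :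
  block_mx D 0 0 Z \in osp ->
  block_mx D 0 0 Z *m odd_row s w - odd_row s w *m block_mx D 0 0 Z =
  odd_row s (D s s *: w - w *m Z).
Proof.
move=> hO; set H := block_mx _ _ _ _ in hO *.
have hH : homog par false H by rewrite /homog mpar_block !oppr0 expr0 scale1r.
have [D' [Z' [/eq_block_mx[<- _ _ <-] hD hZ]]] := osp_evenP hO hH.
have hb := osp_br (osp2_form_even K n) hO (oddmx_osp (delta_mx s 0 *m w)).
have := osp_oddP hb (mhomog_br hH (oddmx_homog _)).
rewrite (mbrE hH (oddmx_homog _)) expr0 scale1r => ->.
rewrite /odd_row; congr oddmx.
rewrite /H /oddmx !mulmx_block !(mul0mx, mulmx0, addr0, add0r).
rewrite opp_block_mx add_block_mx block_mxKur mulmxBr -scalemxAr.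
rewrite !mulmxA; congr (_ - _); rewrite scalemxAl; congr (_ *m w).
have [D01 D10 _] := so2P hD; rewrite -colE; apply/matrixP => i j; rewrite !mxE ord1 eqxx.
have Doff (i' s' : 'I_2) : i' != s' -> D i' s' = 0.
  case: i' s' => [[|[|i']] hi] [[|[|s']] hs] //= _.
    by rewrite -[RHS]D01; congr (D _ _); apply: val_inj.
  by rewrite -[RHS]D10; congr (D _ _); apply: val_inj.
by have [->|/Doff ->] := eqVneq i s; rewrite ?mulr1 ?mulr0.
Qed.

End OspMatrices.

(** * The odd generators in the enveloping algebra *)

Section OspGenerators.
Local Opaque mbr sbr spar mpar osp_def.
Variables (K : numFieldType) (n : nat).
Local Notation N := (n + n)%N.
Local Notation g := (osp2 K n).
Local Notation U := (env g).
Local Notation i_ := (@iota_ K g).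
Local Notation V := (osp_space (osp2_form K n)).
Local Notation par := (@mpar K 2 N).
Local Notation pd := (homog (@lie_par _ g)).
Local Notation mx x := (vsval (x : subvs_of V)).

Definition odd_elt (s : 'I_2) (w : 'rV[K]_N) : g := vsproj V (odd_row s w).
Definition gen (s : 'I_2) (j : nat) : U := i_ (odd_elt s (unit_row K n j)).

Lemma val_odd_elt s w : mx (odd_elt s w) = odd_row s w.
Proof. by rewrite vsprojK // oddmx_osp. Qed.

Lemma osp_val_inj (x y : g) : mx x = mx y -> x = y.
Proof. exact: val_inj. Qed.

Lemma osp_val_par (x : g) : mx (lie_par x : g) = par (mx x).
Proof. exact: (val_spar (osp_par (osp2_form_even K n))). Qed.

Lemma osp_val_br (x y : g) : mx (lie_br x y : g) = mbr (mx x) (mx y).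
Proof. exact: (val_sbr (osp_br (osp2_form_even K n))). Qed.

Lemma osp_homogP p (x : g) : pd p x <-> homog par p (mx x).
Proof.
split=> h; first exact: (val_homog (osp_par (osp2_form_even K n)) h).
by apply: osp_val_inj; rewrite osp_val_par h linearZ.
Qed.

Lemma odd_elt_homog s w : pd true (odd_elt s w).
Proof. by apply/osp_homogP; rewrite val_odd_elt; apply: oddmx_homog. Qed.

Lemma odd_elt_linear s : linear (odd_elt s).
Proof. by move=> k v w; rewrite /odd_elt odd_row_linear linearP. Qed.

Lemma osp_brE p q (x y : g) : pd p x -> pd q y ->
  mx (lie_br x y : g) = mx x *m mx y - (-1) ^+ (p && q) *: (mx y *m mx x).
Proof. by move=> /osp_homogP hx /osp_homogP hy; rewrite osp_val_br (mbrE hx hy). Qed.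

Lemma br_homog p q (x y : g) : pd p x -> pd q y -> pd (p (+) q) (lie_br x y).
Proof.
move=> /osp_homogP hx /osp_homogP hy; apply/osp_homogP; rewrite osp_val_br.
exact: mhomog_br.
Qed.

Lemma odd_elt_br0 s v w : lie_br (odd_elt s v) (odd_elt s w) = 0.
Proof.
apply: osp_val_inj; rewrite (osp_brE (odd_elt_homog s v) (odd_elt_homog s w)).
by rewrite !val_odd_elt expr1 scaleN1r opprK odd_row_anticomm linear0.
Qed.

Lemma gen_anticomm s i j : gen s i * gen s j = - (gen s j * gen s i).
Proof.
rewrite /gen (iota_br (odd_elt_homog s _) (odd_elt_homog s _)) odd_elt_br0.
by rewrite (linear0' (@iota_linear _ _)) addr0 expr1 scaleN1r.
Qed.

Lemma gen_sqr0 s i : gen s i * gen s i = 0.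
Proof.
have /eqP := gen_anticomm s i i; rewrite -addr_eq0 -mulr2n -scaler_nat.
by rewrite scaler_eq0 pnatr_eq0 => /eqP.
Qed.

Lemma iota_odd_elt s w :
  i_ (odd_elt s w) = \sum_(0 <= l < N) (w *m (unit_row K n l)^T) 0 0 *: gen s l.
Proof.
rewrite [w in LHS]unit_row_sum; elim: (index_iota 0 N) => [|l t IH].
  rewrite !big_nil; have -> : odd_elt s 0 = 0 by exact: linear0' (odd_elt_linear s).
  exact: linear0' (@iota_linear _ _).
by rewrite !big_cons odd_elt_linear iota_linear IH.
Qed.

Lemma odd_decomposition (x : g) : pd true x ->
  exists w0 w1, x = odd_elt 0 w0 + odd_elt 1 w1.
Proof.
move=> /osp_homogP hx; pose B := ursubmx (mx x).
exists (row 0 B), (row 1 B); apply: osp_val_inj; rewrite linearD /= !val_odd_elt.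
rewrite /odd_row -(linearD' _ _ (@oddmx_linear K n)) {1}(osp_oddP (subvsP x) hx).
congr oddmx; apply/matrixP => i j; rewrite !mxE !big_ord1 !mxE eqxx !andbT.
by case: i => [[|[|i]] hi] //=; rewrite ?mul1r ?mul0r ?addr0 ?add0r;
  congr (mx x _ _); apply: val_inj.
Qed.

(** The matrix of ad X on g_+ or g_- in the basis of the unit rows. *)
Definition ad_coef (s : 'I_2) (X : 'M[K]_(2 + N)) (k l : nat) : K :=
  ((ulsubmx X s s *: unit_row K n k - unit_row K n k *m drsubmx X)
     *m (unit_row K n l)^T) 0 0.

Lemma even_odd_br (h : g) s w : pd false h -> lie_br h (odd_elt s w) =
  odd_elt s (ulsubmx (mx h) s s *: w - w *m drsubmx (mx h)).
Proof.
move=> hh; apply: osp_val_inj.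
rewrite (osp_brE hh (odd_elt_homog s w)) expr0 scale1r !val_odd_elt.
have [D [Z [hE _ _]]] := osp_evenP (subvsP h) ((osp_homogP _ _).1 hh).
have hO := subvsP h; rewrite hE in hO *.
by rewrite (even_odd_row s w hO) block_mxKul block_mxKdr.
Qed.

Lemma even_gen_comm (h : g) s k : pd false h ->
  i_ h * gen s k - gen s k * i_ h =
  \sum_(0 <= l < N) ad_coef s (mx h) k l *: gen s l.
Proof.
move=> hh; rewrite /gen (iota_br hh (odd_elt_homog s _)) expr0 scale1r.
by rewrite addrC addKr even_odd_br // iota_odd_elt.
Qed.

(** Symplectic matrices have trace 0: only the weight of so(2) contributes. *)
Lemma ad_trace (h : g) s : pd false h ->
  \sum_(0 <= k < N) ad_coef s (mx h) k k = N%:R * ulsubmx (mx h) s s.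
Proof.
move=> hh; rewrite /ad_coef.
have [D [Z [hE _ hZ]]] := osp_evenP (subvsP h) ((osp_homogP _ _).1 hh).
under eq_bigr do rewrite mulmxBl -scalemxAl mxE mxE [X in _ + X]mxE.
rewrite sumrB trace_unit_rows -mulr_sumr trace_unit_rows1 mulrC.
by rewrite hE block_mxKdr (sp_trace0 hZ) subr0.
Qed.

Lemma so2_opposite_weights (h : g) : pd false h ->
  ulsubmx (mx h) 1 1 = - ulsubmx (mx h) 0 0.
Proof.
move=> hh; have [D [Z [-> hD _]]] := osp_evenP (subvsP h) ((osp_homogP _ _).1 hh).
by rewrite block_mxKul; have [] := so2P hD.
Qed.

Lemma ad_traceN (h : g) : pd false h ->
  \sum_(0 <= k < N) ad_coef 1 (mx h) k k = - \sum_(0 <= k < N) ad_coef 0 (mx h) k k.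
Proof. by move=> hh; rewrite !ad_trace // so2_opposite_weights // mulrN. Qed.

Local Notation top s := (\prod_(0 <= j < N) gen s j).

Lemma even_top_comm (h : g) s : pd false h ->
  i_ h * top s = top s * i_ h + (\sum_(0 <= k < N) ad_coef s (mx h) k k) *: top s.
Proof.
move=> hh; have := @commutator_top U N _ (gen_anticomm s) (gen_sqr0 s) (i_ h)
  (fun k l => (ad_coef s (mx h) k l)%:A).
move=> -> => [|k l r|k]; first by rewrite -scaler_suml -scalerAl mul1r.
- by rewrite -scalerAl -scalerAr mul1r mulr1.
by rewrite even_gen_comm //; apply: eq_bigr => l _; rewrite -scalerAl mul1r.
Qed.

(** The weights of the top degrees of g_+ and g_- are opposite by ad_traceN. *)
Lemma even_Gamma_comm (h : g) : pd false h ->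
  i_ h * (top 0 * top 1) = top 0 * top 1 * i_ h.
Proof.
move=> hh; rewrite mulrA even_top_comm // mulrDl -mulrA even_top_comm // mulrDr.
by rewrite ad_traceN // mulrA -scalerAr scaleNr -scalerAl subrK.
Qed.

Lemma gen_top0 s m : gen s m * top s = 0 /\ top s * gen s m = 0.
Proof.
have [mN|Nm] := ltnP m N.
  split; first exact: (mul_gprod0 (gen_anticomm s) (gen_sqr0 s)).
  exact: (gprod_mul0 (gen_anticomm s) (gen_sqr0 s)).
suff -> : gen s m = 0 by rewrite mul0r mulr0.
rewrite /gen (_ : unit_row K n m = 0).
  have -> : odd_elt s 0 = 0 by exact: linear0' (odd_elt_linear s).
  exact: linear0' (@iota_linear _ _).
by apply/rowP => l; rewrite !mxE ltn_eqF // (leq_trans (ltn_ord l)).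
Qed.

Definition odd_br (s t : 'I_2) (m i : nat) : g :=
  lie_br (odd_elt s (unit_row K n m)) (odd_elt t (unit_row K n i)).

Lemma odd_br_even s t m i : pd false (odd_br s t m i).
Proof. exact: br_homog (odd_elt_homog _ _) (odd_elt_homog _ _). Qed.

(** The Jacobi identity, as the elements of g_+ (resp. g_-) commute: [[x, e_i], e_k] is
    skew in i and k. *)
Lemma ad_coef_skew s t m i k l :
  ad_coef t (mx (odd_br s t m i)) k l = - ad_coef t (mx (odd_br s t m k)) i l.
Proof.
pose h i := odd_br s t m i; pose x := odd_elt s (unit_row K n m).
pose e i := odd_elt t (unit_row K n i); rewrite -/(h i) -/(h k).
have he j : pd false (h j) := odd_br_even s t m j.
have sk : lie_br (h i) (e k) = - lie_br (h k) (e i).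
  have := lie_jacobi (e k) (odd_elt_homog s (unit_row K n m))
                     (odd_elt_homog t (unit_row K n i)).
  have -> : lie_br (odd_elt t (unit_row K n i)) (e k) = 0 by exact: odd_elt_br0.
  rewrite -/x -/(e i) -[true && true]/true expr1 scaleN1r.
  have [bl br] := @lie_br_bilin _ g; rewrite (linear0' (br _)).
  rewrite -/(h i) -[lie_br x (e k)]/(h k).
  have := lie_br_skew (odd_elt_homog t (unit_row K n i)) (he k).
  rewrite andbF expr0 scale1r -/(e i) => ->; rewrite opprK.
  by move=> /esym/eqP; rewrite addr_eq0 => /eqP.
have sk' := etrans (esym (even_odd_br t (unit_row K n k) (he i)))
  (etrans sk (congr1 -%R (even_odd_br t (unit_row K n i) (he k)))).
have injo (v w : 'rV[K]_N) : odd_elt t v = - odd_elt t w -> v = - w.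
  move=> /(congr1 (fun y : g => mx y)); rewrite linearN /= !val_odd_elt /odd_row /oddmx.
  rewrite opp_block_mx => /eq_block_mx[_ vw _ _].
  have {vw} := congr1 (fun Y : 'M_(2, N) => delta_mx (0 : 'I_1) t *m Y) vw.
  rewrite mulmxN !mulmxA mul_delta_mx => vw.
  have d1 (z : 'rV[K]_N) : delta_mx 0 0 *m z = z.
    suff -> : delta_mx 0 0 = 1%:M :> 'M[K]_1 by rewrite mul1mx.
    by apply/matrixP => a b; rewrite !mxE !ord1.
  by rewrite !d1 in vw.
by rewrite /ad_coef (injo _ _ sk') mulNmx mxE.
Qed.

Lemma ad_coef_diag s t m i l :
  ad_coef t (mx (odd_br s t m i)) i l = 0.
Proof.
have /eqP := ad_coef_skew s t m i i l; rewrite -addr_eq0 -mulr2n mulrn_eq0.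
by move=> /eqP.
Qed.

Lemma gen_br s t m i : gen s m * gen t i + gen t i * gen s m =
  i_ (odd_br s t m i).
Proof.
rewrite {1}/gen (iota_br (odd_elt_homog s _) (odd_elt_homog t _)) expr1 scaleN1r.
by rewrite addrAC addNr add0r.
Qed.

Local Opaque odd_br ad_coef.

(** E F is invariant modulo the left ideal generated by the even part: x E F lies in this
    ideal for x in g_-, as contract_unimodular applies with F the top degree of g_-. *)
Lemma gen_Gamma m : exists (h : nat -> g) (z : nat -> U), (forall i, pd false (h i)) /\
  gen 1 m * (top 0 * top 1) = \sum_(0 <= i < N) z i * i_ (h i).
Proof.
have hh := odd_br_even 1 0 m.
exists (odd_br 1 0 m); eexists; split=> //.
apply: (@contract_unimodular U N (gen 0) (top 1) (gen 1 m) (fun i => i_ (odd_br 1 0 m i))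
  (fun i k l => (ad_coef 0 (mx (odd_br 1 0 m i)) k l)%:A) (gen_anticomm 0) (gen_sqr0 0)).
- by move=> i k l r; rewrite -scalerAl -scalerAr mul1r mulr1.
- by move=> i; apply: gen_br.
- by move=> i k; rewrite even_gen_comm //; apply: eq_bigr => l _; rewrite -scalerAl mul1r.
- by move=> i k l; apply: etrans (congr1 (fun c => c%:A) (ad_coef_skew 1 0 m i k l)) (scaleNr _ _).
- by move=> i l; apply: etrans (congr1 (fun c => c%:A) (ad_coef_diag 1 0 m i l)) (scale0r _).
- by have [] := gen_top0 1 m.
by move=> i; rewrite even_top_comm // ad_traceN // -scaler_suml -scalerAl mul1r scaleNr.
Qed.

Lemma rev_top s : exists c : K,
  top s = c *: \prod_(j <- rev (index_iota 0 N)) gen s j.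
Proof.
have [|c ->] := word_perm (gen_anticomm s) (w := index_iota 0 N)
  (w' := rev (index_iota 0 N)); first by rewrite perm_sym perm_rev.
exists ((-1) ^+ c); elim: c => [|c IH]; first by rewrite mul1r scale1r.
by rewrite !exprS -mulrA IH mulN1r -scalerA scaleN1r.
Qed.

(** The same modulo the right ideal, for x in g_+, with the roles of g_+ and g_-
    exchanged. *)
Lemma Gamma_gen m : exists (h : nat -> g) (z : nat -> U), (forall i, pd false (h i)) /\
  top 0 * top 1 * gen 0 m = \sum_(0 <= i < N) i_ (h i) * z i.
Proof.
have hh := odd_br_even 0 1 m.
have [c cE] := rev_top 1.
have [||||||||i|z zE] := @contract_unimodular_op U N (gen 1) (top 0) (gen 0 m)
  (fun i => i_ (odd_br 0 1 m i)) (fun i k l => (ad_coef 1 (mx (odd_br 0 1 m i)) k l)%:A).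
- exact: gen_anticomm.
- exact: gen_sqr0.
- by move=> i k l r; rewrite -scalerAl -scalerAr mul1r mulr1.
- by move=> i; apply: gen_br.
- by move=> i k; rewrite even_gen_comm //; apply: eq_bigr => l _; rewrite -scalerAl mul1r.
- by move=> i k l; apply: etrans (congr1 (fun c => c%:A) (ad_coef_skew 0 1 m i k l)) (scaleNr _ _).
- by move=> i l; apply: etrans (congr1 (fun c => c%:A) (ad_coef_diag 0 1 m i l)) (scale0r _).
- by have [] := gen_top0 0 m.
- by rewrite even_top_comm // -scaler_suml -scalerAl mul1r ad_traceN // scaleNr opprK.
exists (odd_br 0 1 m), (fun i => c *: z i); split=> //.
rewrite cE -scalerAr -scalerAl zE scaler_sumr.
by apply: eq_bigr => i _; rewrite scalerAr.
Qed.

End OspGenerators.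

(** * The even subalgebra and the top Grassmann degree *)

Section EvenSubalgebra.
Variables (K : numFieldType) (n : nat).
Local Notation N := (n + n)%N.
Local Notation g := (osp2 K n).
Local Notation g0 := (osp2_even K n).
Local Notation U := (env g).
Local Notation U0 := (env g0).
Local Notation V := (osp_space (osp2_form K n)).
Local Notation incl := (@U_even_incl K n).
Local Notation mx x := (vsval (x : subvs_of V)).
Local Opaque mbr sbr mpar osp_def.

Lemma inclP : [/\ linear incl, incl 1 = 1,
  forall x y, incl (x * y) = incl x * incl y
  & forall x : g0, incl (iota_ x) = iota_ (even_incl x : g)].
Proof. exact: env_liftP (env_alg _) (env_even_compat (osp2_form_even K n)). Qed.

Lemma even_par_id (x : g0) : lie_par x = x.
Proof.
apply: val_inj; rewrite [LHS](val_spar (@even_par _ _ _ V)).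
by have := subvsP x; rewrite even_partP => /andP[_ /eqP].
Qed.

Lemma even_upar_id (u : U0) : upar u = u.
Proof.
elim/env_ind: u => [|x|k u v hu hv|u v hu hv]; first exact: upar1.
- by rewrite upar_iota even_par_id.
- by rewrite upar_linear hu hv.
- by rewrite uparM hu hv.
Qed.

Lemma even_incl_homog (x : g0) : homog (@lie_par _ g) false (even_incl x : g).
Proof.
apply/osp_homogP; rewrite val_even_incl /homog expr0 scale1r.
by have := subvsP x; rewrite even_partP => /andP[_ /eqP].
Qed.

Lemma upar_incl (u : U0) : upar (incl u) = incl u.
Proof.
have [il i1 iM ii] := inclP.
elim/env_ind: u => [|x|k u v hu hv|u v hu hv]; first by rewrite i1 upar1.
- by rewrite ii upar_iota (even_incl_homog x) expr0 scale1r.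
- by rewrite il upar_linear hu hv.
- by rewrite iM uparM hu hv.
Qed.

Lemma incl_homog (u : U0) : homog (@upar _ g) false (incl u).
Proof. by rewrite /homog upar_incl expr0 scale1r. Qed.

Lemma ueps_incl (u : U0) : ueps (incl u) = ueps u.
Proof.
have [il i1 iM ii] := inclP; have [el e1 eM ei] := uepsP g.
have [el' e1' eM' ei'] := uepsP g0.
elim/env_ind: u => [|x|k u v hu hv|u v hu hv]; first by rewrite i1 e1 e1'.
- by rewrite ii ei ei'.
- by rewrite il el el' hu hv.
- by rewrite iM eM eM' hu hv.
Qed.

Lemma even_inclP (h : g) : homog (@lie_par _ g) false h ->
  exists h0 : g0, even_incl h0 = h.
Proof.
move=> hh; have hE : mx h \in even_part V.
  by rewrite even_partP subvsP; apply/eqP; rewrite -osp_val_par hh expr0 scale1r.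
exists (vsproj (even_part V) (mx h)); apply: val_inj.
by rewrite [LHS]val_even_incl vsprojK.
Qed.

Lemma odd_part_elt (x : g) :
  (odd_part (1 : K) x -> exists w, x = odd_elt 0 w) /\
  (odd_part (-1 : K) x -> exists w, x = odd_elt 1 w).
Proof.
suff H l : odd_part l x -> exists w0 w1,
    [/\ x = odd_elt 0 w0 + odd_elt 1 w1, w0 = l *: w0 & - w1 = l *: w1].
  have half (w : 'rV[K]_N) : w = - w -> w = 0.
    move=> /eqP; rewrite -addr_eq0 -mulr2n -scaler_nat scaler_eq0 pnatr_eq0.
    by move/eqP.
  have o0 s : odd_elt s 0 = 0 :> g by exact: linear0' (odd_elt_linear s).
  split=> /H[w0 [w1 [-> e0 e1]]].
    by exists w0; rewrite (half w1) ?o0 ?addr0 // [RHS]e1 scale1r.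
  by exists w1; rewrite (half w0) ?o0 ?add0r // {1}e0 scaleN1r.
case=> hx; have [w0 [w1 xE]] := odd_decomposition hx.
move=> hl; exists w0, w1.
have glE : mx (gl1 K n : g) = gl1_mx K n by rewrite vsprojK // gl1_mx_osp.
have gl0 : homog (@lie_par _ g) false (gl1 K n).
  apply/osp_homogP; rewrite glE /gl1_mx /homog expr0 scale1r.
  by rewrite (mpar_block _ 0 0) !oppr0.
have brE s w : lie_br (gl1 K n : g) (odd_elt s w) = odd_elt s ((-1) ^+ s *: w).
  rewrite (even_odd_br s w gl0) glE /gl1_mx block_mxKul block_mxKdr mulmx0 subr0.
  by rewrite !mxE eqxx mulr1n.
have [_ br] := @lie_br_bilin _ g.
have e : odd_elt 0 w0 + odd_elt 1 (- w1) = odd_elt 0 (l *: w0) + odd_elt 1 (l *: w1).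
  have oZ s w : odd_elt s (l *: w) = l *: odd_elt s w :> g.
    exact: linearZ' (odd_elt_linear s).
  rewrite !oZ -scalerDr -xE -hl xE (linearD' _ _ (br _)) !brE expr0 expr1 scale1r.
  by rewrite scaleN1r.
have inj (v0 v1 w0' w1' : 'rV[K]_N) :
    odd_elt 0 v0 + odd_elt 1 v1 = odd_elt 0 w0' + odd_elt 1 w1' :> g -> v0 = w0' /\ v1 = w1'.
  move=> /(congr1 (fun y : g => mx y)); rewrite !linearD /= !val_odd_elt /odd_row.
  rewrite -!(linearD' _ _ (@oddmx_linear K n)) => /eq_block_mx[_ h _ _].
  have row_s (s : 'I_2) (y0 y1 : 'rV[K]_N) : row s (delta_mx 0 0 *m y0 + delta_mx 1 0 *m y1)
     = if s == 0 then y0 else y1.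
    apply/rowP => j; rewrite !mxE !big_ord1 !mxE !eqxx !andbT.
    by case: s => [[|[|s]] hs] //=; rewrite ?mul1r ?mul0r ?addr0 ?add0r.
  by have := (congr1 (row 0) h, congr1 (row 1) h); rewrite !row_s /= => -[-> ->].
by have [h0 h1] := inj _ _ _ _ e.
Qed.

Local Notation top s := (\prod_(0 <= j < N) gen K n s j).

Lemma top_degreeP (s : 'I_2) (E : U) : top_degree ((-1) ^+ s) E ->
  exists c : K, E = c *: top s.
Proof.
move=> [M [c [x [hx ->]]]].
pose P z := exists c : K, z = c *: top s.
rewrite -/(P _); elim/big_rec: _ => [|k z _ [d ->]].
  by exists 0; rewrite scale0r.
have [|c' ->] := prod_span_top (@gen_anticomm K n s) (@gen_sqr0 K n s) (x := fun j => iota_ (x k j)).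
  move=> j; have [w ->] : exists w, x k j = odd_elt s w.
    have := hx k j; case: s @P {hx d} => [[|[|s]] hs] P; rewrite ?expr0 ?expr1 => hj //.
      have [/(_ hj)[w ->] _] := odd_part_elt (x k j).
      by exists w; congr (odd_elt _ w); apply: val_inj.
    have [_ /(_ hj)[w ->]] := odd_part_elt (x k j).
    by exists w; congr (odd_elt _ w); apply: val_inj.
  by exists (fun l => (w *m (unit_row K n l)^T) 0 0); apply: iota_odd_elt.
by exists (c k * c' + d); rewrite scalerDl scalerA.
Qed.

End EvenSubalgebra.

(** * The algebra generated by the defining matrix elements *)

Section FunctionAlgebra.
Variables (C : numClosedFieldType) (n : nat).
Local Notation N := (n + n)%N.
Local Notation g := (osp2 C n).
Local Notation U := (env g).
Local Notation V := (osp_space (osp2_form C n)).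
Local Notation mx x := (vsval (x : subvs_of V)).
Local Opaque mbr sbr mpar osp_def.

Definition osp_adj (h : g) : g := vsproj V (adjmx (mx h)).

Lemma form_sym_conj : map_mx Num.conj (form_sym C) = form_sym C.
Proof. by apply/matrixP => i j; rewrite !mxE rmorph_nat. Qed.
Lemma form_skew_conj : map_mx Num.conj (form_skew C n) = form_skew C n.
Proof.
rewrite /form_skew map_block_mx; congr block_mx; apply/matrixP => i j;
  by rewrite !mxE ?rmorphN ?rmorph_nat ?rmorph0.
Qed.

(** The forms S and J are real and square to 1 and -1. *)
Lemma osp_adj_stable (h : g) : homog lie_par false h ->
  adjmx (mx h) \in V /\ homog (@mpar C 2 N) false (adjmx (mx h)).
Proof.
move=> /osp_homogP hh; have [D [Z [-> hD hZ]]] := osp_evenP (subvsP h) hh.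
have hE : homog (@mpar C 2 N) false (adjmx (block_mx D 0 0 Z)).
  by rewrite adjmx_block !adjmx0 /homog (mpar_block _ 0 0) !oppr0 expr0 scale1r.
split=> //; rewrite osp_spaceE (osp_def_homog _ hE) /= mul1mx.
rewrite adjmx_block !adjmx0 /osp2_form tr_block_mx !trmx0.
rewrite !mulmx_block !(mul0mx, mulmx0, addr0, add0r) add_block_mx !addr0.
rewrite -(block_mx0 _ 2 N 2 N) /adjmx !trmxK; apply/eqP.
have conj_mx d (X Y : 'M[C]_d) : map_mx Num.conj Y = Y -> X *m Y + Y *m X^T = 0 ->
    map_mx Num.conj X *m Y + Y *m (map_mx Num.conj X)^T = 0.
  move=> hY e; have := congr1 (map_mx Num.conj) e.
  by rewrite map_mxD !map_mxM map_mx0 -map_trmx hY.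
have eD : D *m form_sym C + form_sym C *m D^T = 0.
  have /(congr1 (fun Y => form_sym C *m Y *m form_sym C)) := hD.
  rewrite mulmx0 mul0mx mulmxDr mulmxDl !mulmxA form_sym_sqr mul1mx.
  by rewrite -!mulmxA form_sym_sqr mulmx1 addrC.
have eZ : Z *m form_skew C n + form_skew C n *m Z^T = 0.
  have /(congr1 (fun Y => form_skew C n *m Y *m form_skew C n)) := hZ.
  rewrite mulmx0 mul0mx mulmxDr mulmxDl !mulmxA form_skew_sqr mulNmx mul1mx.
  rewrite -!mulmxA form_skew_sqr mulmxN mulmx1 mulNmx mulmxN -opprD.
  by move=> /eqP; rewrite oppr_eq0 => /eqP; rewrite addrC.
by congr block_mx; apply: conj_mx => //; [apply: form_sym_conj|apply: form_skew_conj].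
Qed.

Lemma osp_adj_even (h : g) : homog lie_par false h -> homog lie_par false (osp_adj h).
Proof.
move=> /osp_adj_stable[hV hh]; apply/osp_homogP.
by rewrite /osp_adj vsprojK.
Qed.

Lemma defrep_rep : alg_rep (@defrep C n) /\
  forall x : g, defrep (iota_ x) = mx x.
Proof.
have hc := mxrep_compat (osp_par (osp2_form_even C n)) (osp_br (osp2_form_even C n)).
by have [rl r1 rM ri] := env_liftP (mx_alg C 2 N) hc; split.
Qed.

Lemma defrep_star : star_rep osp_adj (@defrep C n).
Proof.
have [rP ri] := defrep_rep; split=> // h /osp_adj_stable[hV _].
by rewrite !ri /osp_adj vsprojK.
Qed.

Local Notation A := (fun_alg C n).

Lemma t_coef i j : t_ i j = coef (@defrep C n) (delta_mx 0 i) (delta_mx j 0).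
Proof. by apply/funext => x; rewrite /coef -rowE -colE !mxE. Qed.

Lemma t_unitary : [set a | exists i j, a = @t_ C n i j] `<=` unitary_dual osp_adj.
Proof.
move=> _ [i [j ->]]; exists _, (@defrep C n); split; first exact: defrep_star.
by do 2!eexists; apply: t_coef.
Qed.

Lemma fun_alg_sub_hopf : sub_hopf A.
Proof. exact: hopf_generated_sub_hopf (unitary_dual_sub_hopf osp_adj_even) t_unitary. Qed.

Lemma fun_alg_unitary a : A a -> unitary_dual osp_adj a.
Proof. by apply; [apply: unitary_dual_sub_hopf osp_adj_even|apply: t_unitary]. Qed.

Lemma fun_alg_t i j : A (t_ i j).
Proof. by move=> B _; apply; exists i, j. Qed.

End FunctionAlgebra.

(** * Two-sided invariance of the integral on the even part *)

Section EvenIntegral.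
Variables (C : numClosedFieldType) (n : nat).
Local Notation N := (n + n)%N.
Local Notation g := (osp2 C n).
Local Notation g0 := (osp2_even C n).
Local Notation U := (env g).
Local Notation U0 := (env g0).
Local Notation incl := (@U_even_incl C n).
Local Notation A := (fun_alg C n).
Local Notation Ae := (fun_alg_even C n).
Implicit Types (a b : U -> C^o) (u y : U0) (x z : U).

Let A_hopf := fun_alg_sub_hopf C n.

Lemma fun_alg_even_restr a : A a -> Ae (restr a). Proof. by move=> Aa; exists a. Qed.

Lemma fun_alg_even_lin k (a b : U0 -> C^o) : Ae a -> Ae b -> Ae (k *: a + b).
Proof.
by move=> [a' Aa <-] [b' Ab <-]; exists (k *: a' + b') => //; apply: (sub_hopf_lin A_hopf).
Qed.

Lemma fun_alg_even0 : Ae 0.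
Proof. by exists 0 => //; apply: (sub_hopf0 A_hopf). Qed.

Lemma fun_alg_even_unit : Ae (@ueps C g0).
Proof.
exists (@ueps C g); first exact: (sub_hopf_unit A_hopf).
by apply/funext => u; apply: ueps_incl.
Qed.

Lemma fun_alg_even_coprod a : A a -> exists s, fcoprod_rep Ae (restr a) s.
Proof.
move=> Aa; have [s [sA sE]] := sub_hopf_coprod A_hopf Aa.
exists [seq (restr c.1, restr c.2) | c <- s]; split.
  by move=> _ /mapP[c /sA[A1 A2] ->]; split; apply: fun_alg_even_restr.
have [il _ iM _] := inclP C n.
move=> u y; rewrite /restr iM sE big_map; rewrite !big_seq; apply: eq_bigr => c /sA[A1 A2].
have l1 := sub_hopf_linear A_hopf A1; have l2 := sub_hopf_linear A_hopf A2.
rewrite (fpairing_evenl _ l1 l2 (incl_homog u)) fpairing_evenl //=.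
- by move=> k v w; rewrite /restr il l1.
- by move=> k v w; rewrite /restr il l2.
- by rewrite /homog even_upar_id expr0 scale1r.
Qed.

Variable int0 : (U0 -> C^o) -> C.
Hypothesis int0_left : left_integral Ae int0.
Let int0_lin := int0_left.1.

Lemma fun_alg_fshiftl z b : A b -> A (fshiftl z b).
Proof. exact: (sub_hopf_fshiftl A_hopf). Qed.
Lemma fun_alg_fshiftr z b : A b -> A (fshiftr z b).
Proof. exact: (sub_hopf_fshiftr A_hopf). Qed.

Lemma int0_0 : int0 0 = 0.
Proof. exact: linear_on0 fun_alg_even0 int0_lin. Qed.

Lemma int0_fshiftl u b : A b ->
  int0 (restr (fshiftl (incl u) b)) = ueps u * int0 (restr b).
Proof.
move=> Ab; have [il _ iM _] := inclP C n.
have [sA sE] := fcoprodP (fun_alg_even_coprod Ab).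
have /(congr1 (fun f : U0 -> C^o => f u)) := int0_left.2 _ (fun_alg_even_restr Ab).
rewrite form_scaleE mulrC => <-; rewrite /id_tensor fct_sumE.
have -> : restr (fshiftl (incl u) b) =
    \sum_(c <- fcoprod Ae (restr b)) c.1 u *: c.2.
  apply/funext => y; rewrite fct_sumE /restr /fshiftl -iM [LHS]sE.
  rewrite !big_seq; apply: eq_bigr => c /sA[[a1 Aa1 e1] [a2 Aa2 e2]].
  have l1 := sub_hopf_linear A_hopf Aa1; have l2 := sub_hopf_linear A_hopf Aa2.
  rewrite fpairing_evenl //.
  - by rewrite -e1 => k v w; rewrite /restr il l1.
  - by rewrite -e2 => k v w; rewrite /restr il l2.
  - by rewrite /homog even_upar_id expr0 scale1r.
have [|_ ->] := linear_on_sum fun_alg_even_lin fun_alg_even0 int0_lin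
  (s := fcoprod Ae (restr b)) (fun c => c.1 u) (f := fun c => c.2).
  by move=> c /sA[].
apply: eq_bigr => c _; rewrite /ssum !big_bool /=.
have fpar_id (a : U0 -> C^o) : fpar a = a.
  by apply/funext => v; rewrite /fpar even_upar_id.
have h0 (a : U0 -> C^o) : hpart (@fpar _ g0) false a = a.
  rewrite /hpart fpar_id expr0 scale1r -mulr2n -scaler_nat scalerA mulVf ?scale1r //.
  by rewrite pnatr_eq0.
have h1 (a : U0 -> C^o) : hpart (@fpar _ g0) true a = 0.
  by rewrite /hpart fpar_id expr1 scaleN1r subrr scaler0.
rewrite !h0 !h1 int0_0 !scaler0 !scale0r scaler0 !add0r scale1r.
by rewrite form_scaleE mulrC.
Qed.

(** Elements of the function algebra are matrix elements of representations in which the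
    even part is closed under adjoints, to which invariant_projection applies. *)
Lemma fun_alg_projection b : A b -> exists u0 : U0, ueps u0 = 1 /\
  forall (h : g0) y, b (incl u0 * incl (iota_ h) * incl y) = 0.
Proof.
move=> /fun_alg_unitary[d [rho [[[rl r1 rM] rs] [r [c ->]]]]].
have [il i1 iM ii] := inclP C n.
have rP : alg_rep (fun u => rho (incl u)).
  by split=> [k u v||u v]; rewrite ?il ?rl ?i1 ?iM.
have [h|u0 [e0 u0P]] := invariant_projection rP _ r.
  have hh := even_incl_homog h; have [h' eh'] := even_inclP (osp_adj_even hh).
  by exists h'; rewrite !ii rs // eh'.
exists u0; split=> // h y.
by rewrite /coef !rM !mulmxA u0P !mul0mx mxE.
Qed.

(** Translate by u0: by left invariance the integral does not change, and the translate
    is a constant. *)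
Lemma int0_value b u0 : A b -> ueps u0 = 1 ->
  (forall (h : g0) y, b (incl u0 * incl (iota_ h) * incl y) = 0) ->
  int0 (restr b) = b (incl u0) * int0 (@ueps C g0).
Proof.
move=> Ab e0 bh; have [il i1 iM ii] := inclP C n; have [el e1 eM ei] := uepsP g0.
have bl := sub_hopf_linear A_hopf Ab.
rewrite -[LHS]mul1r -e0 -int0_fshiftl //.
rewrite -(linear_onZ fun_alg_even0 int0_lin _ fun_alg_even_unit); congr int0.
apply/funext => y; rewrite form_scaleE /restr /fshiftl.
elim/env_lgen_ind: y => [|k u v hu hv|p u h hh hu].
- by rewrite i1 mulr1 e1 mulr1.
- by rewrite il el mulrDr -scalerAr bl hu hv mulrDr /GRing.scale /= mulrCA.
- by rewrite iM mulrA bh eM ei mul0r mulr0.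
Qed.

(** The element u0 of fun_alg_projection for b also serves for its right translates. *)
Lemma int0_fshiftr (h : g0) b : A b -> int0 (restr (fshiftr (incl (iota_ h)) b)) = 0.
Proof.
move=> Ab; have [u0 [e0 bh]] := fun_alg_projection Ab.
have [il i1 iM ii] := inclP C n.
rewrite (int0_value (u0 := u0)) => [||//|h' y]; last 1 first.
- by rewrite /fshiftr -mulrA -(iM y) bh.
- by rewrite /fshiftr -[_ * incl (iota_ h)]mulr1 -i1 bh mul0r.
- exact: fun_alg_fshiftr.
Qed.

(** By int0_value the integral is determined by its value at the unit. *)
Lemma int0_unit_neq0 : nonzero_on Ae int0 -> int0 (@ueps C g0) != 0.
Proof.
move=> [_ [b Ab <-]]; have [u0 [e0 bh]] := fun_alg_projection Ab.
by rewrite (int0_value Ab e0 bh); apply: contraNneq => ->; rewrite mulr0.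
Qed.

(** The integrals of the translates of b, as functions of z in U(g). By the two-sided
    invariance of int0 they vanish on the left, respectively the right ideal generated
    by the even part (int_shiftl_even, int_shiftr_even). *)
Definition int_shiftl b z := int0 (restr (fshiftl z b)).
Definition int_shiftr b z := int0 (restr (fshiftr z b)).

Lemma int_shiftl_sum (I : eqType) (s : seq I) (k : I -> C) (z : I -> U) b : A b ->
  int_shiftl b (\sum_(i <- s) k i *: z i) = \sum_(i <- s) k i * int_shiftl b (z i).
Proof.
move=> Ab; have bl := sub_hopf_linear A_hopf Ab; rewrite /int_shiftl.
have [|_ <-] := linear_on_sum fun_alg_even_lin fun_alg_even0 int0_lin
  (s := s) k (f := fun i => restr (fshiftl (z i) b)).
  by move=> i _; exact: (fun_alg_even_restr (fun_alg_fshiftl _ Ab)).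
congr int0; apply/funext => y; rewrite fct_sumE /restr /fshiftl.
elim: s => [|i s IH]; first by rewrite !big_nil mul0r (linear0' bl).
by rewrite !big_cons mulrDl -scalerAl bl IH.
Qed.

Lemma int_shiftr_sum (I : eqType) (s : seq I) (k : I -> C) (z : I -> U) b : A b ->
  int_shiftr b (\sum_(i <- s) k i *: z i) = \sum_(i <- s) k i * int_shiftr b (z i).
Proof.
move=> Ab; have bl := sub_hopf_linear A_hopf Ab; rewrite /int_shiftr.
have [|_ <-] := linear_on_sum fun_alg_even_lin fun_alg_even0 int0_lin
  (s := s) k (f := fun i => restr (fshiftr (z i) b)).
  by move=> i _; exact: (fun_alg_even_restr (fun_alg_fshiftr _ Ab)).
congr int0; apply/funext => y; rewrite fct_sumE /restr /fshiftr.
elim: s => [|i s IH]; first by rewrite !big_nil mulr0 (linear0' bl).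
by rewrite !big_cons mulrDr -scalerAr bl IH.
Qed.

Lemma int_shiftl_even (h : g) z b : A b -> homog lie_par false h -> int_shiftl b (z * iota_ h) = 0.
Proof.
move=> Ab /even_inclP[h0 <-]; have [_ _ _ ii] := inclP C n.
have -> : int_shiftl b (z * iota_ (even_incl h0 : g)) =
    int0 (restr (fshiftl (incl (iota_ h0)) (fshiftl z b))).
  by congr int0; apply/funext => y; rewrite /restr /fshiftl ii !mulrA.
have [_ _ _ ei] := uepsP g0.
by rewrite int0_fshiftl ?ei ?mul0r //; apply: fun_alg_fshiftl.
Qed.

Lemma int_shiftr_even (h : g) z b : A b -> homog lie_par false h -> int_shiftr b (iota_ h * z) = 0.
Proof.
move=> Ab /even_inclP[h0 <-]; have [_ _ _ ii] := inclP C n.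
have -> : int_shiftr b (iota_ (even_incl h0 : g) * z) =
    int0 (restr (fshiftr (incl (iota_ h0)) (fshiftr z b))).
  by congr int0; apply/funext => y; rewrite /restr /fshiftr ii !mulrA.
by rewrite int0_fshiftr //; apply: fun_alg_fshiftr.
Qed.

End EvenIntegral.

(** * Left and right invariance of the super integral *)

Section SuperIntegral.
Variables (C : numClosedFieldType) (n : nat).
Local Notation N := (n + n)%N.
Local Notation g := (osp2 C n).
Local Notation g0 := (osp2_even C n).
Local Notation U := (env g).
Local Notation U0 := (env g0).
Local Notation incl := (@U_even_incl C n).
Local Notation A := (fun_alg C n).
Local Notation Ae := (fun_alg_even C n).
Local Notation top s := (\prod_(0 <= j < N) gen C n s j).
Local Notation hp := (hpart (@upar C g)).
Local Notation fp := (hpart (@fpar C g)).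
Variable int0 : (U0 -> C^o) -> C.
Hypothesis int0_left : left_integral Ae int0.

Let A_hopf := fun_alg_sub_hopf C n.
Local Notation A_lin := (sub_hopf_linear A_hopf).

Lemma gen_homog s j : homog (@upar C g) true (gen C n s j).
Proof. exact: homog_iota (odd_elt_homog s _). Qed.

Lemma top_homog s : homog (@upar C g) false (top s).
Proof.
suff H m : homog (@upar C g) (odd m) (\prod_(0 <= j < m) gen C n s j).
  by have := H N; rewrite addnn odd_double.
elim: m => [|m IH]; first by rewrite big_geq //; apply: homog1.
rewrite big_nat_recr //= -addbT; exact: homogM IH (gen_homog _ _).
Qed.

Variables (k : C) (Gamma : U).
Hypothesis GammaE : Gamma = k *: (top 0 * top 1).

Lemma Gamma_homog : homog (@upar C g) false Gamma.
Proof. by rewrite GammaE; apply/homogZ/(homogM (top_homog _) (top_homog _)). Qed.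

Lemma Gamma_even (h : g) : homog lie_par false h ->
  iota_ h * Gamma = Gamma * iota_ h.
Proof. by move=> hh; rewrite GammaE -scalerAr -scalerAl even_Gamma_comm. Qed.

Lemma Gamma_incl y : incl y * Gamma = Gamma * incl y.
Proof.
have [il i1 iM ii] := inclP C n.
elim/env_ind: y => [|h|l u v hu hv|u v hu hv].
- by rewrite i1 mul1r mulr1.
- by rewrite ii (Gamma_even (even_incl_homog h)).
- by rewrite il mulrDl mulrDr -scalerAl hu hv -scalerAr.
- by rewrite iM -[LHS]mulrA hv [LHS]mulrA hu [RHS]mulrA.
Qed.

Lemma int_shiftl_Gamma b : int_shiftl int0 b Gamma = int_shiftr int0 b Gamma.
Proof.
by congr int0; apply/funext => y; rewrite /restr /fshiftl /fshiftr Gamma_incl.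
Qed.

Lemma odd_iota_sum (x : g) : homog lie_par true x ->
  exists t : seq (C * ('I_2 * nat)),
    iota_ x = \sum_(z <- t) z.1 *: gen C n z.2.1 z.2.2.
Proof.
move=> /odd_decomposition[w0 [w1 ->]].
rewrite (linearD' _ _ (@iota_linear _ _)) !iota_odd_elt.
pose c (w : 'rV[C]_N) l := (w *m (unit_row C n l)^T) 0 0.
exists ([seq (c w0 l, ((0 : 'I_2), l)) | l <- index_iota 0 N] ++
        [seq (c w1 l, ((1 : 'I_2), l)) | l <- index_iota 0 N]).
by rewrite big_cat !big_map.
Qed.

(** Gamma is killed by the odd generators and commutes with the even ones, modulo the
    left ideal on which int_shiftl vanishes. *)
Lemma int_shiftl_gen b p (x : g) : A b -> homog lie_par p x ->
  int_shiftl int0 b (iota_ x * Gamma) = 0.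
Proof.
move=> Ab; case: p => hx; last first.
  by rewrite (Gamma_even hx) int_shiftl_even.
have gen0 s l : int_shiftl int0 b (gen C n s l * Gamma) = 0.
  have [h [z [hh e]]] : exists (h : nat -> g) (z : nat -> U),
      (forall i, homog lie_par false (h i)) /\
      gen C n s l * (top 0 * top 1) = \sum_(0 <= i < N) z i * iota_ (h i).
    case: s => [[|[|s]] hs] //.
      exists (fun=> 0), (fun=> 0); split.
        by move=> i; rewrite /homog (linear0' (@lie_par_linear _ g)) scaler0.
      rewrite (_ : Ordinal hs = 0); last exact: val_inj.
      by rewrite mulrA (gen_top0 C n 0 l).1 mul0r big1 // => i _; rewrite mul0r.
    rewrite (_ : Ordinal hs = 1); last exact: val_inj.
    exact: gen_Gamma.
  rewrite GammaE -scalerAr e scaler_sumr int_shiftl_sum // big1 // => i _.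
  by rewrite int_shiftl_even ?mulr0.
have [t ->] := odd_iota_sum hx; rewrite mulr_suml.
under eq_bigr do rewrite -scalerAl.
by rewrite int_shiftl_sum // big1 // => z _; rewrite gen0 mulr0.
Qed.

Lemma int_shiftr_gen b p (x : g) : A b -> homog lie_par p x ->
  int_shiftr int0 b (Gamma * iota_ x) = 0.
Proof.
move=> Ab; case: p => hx; last first.
  by rewrite -(Gamma_even hx) int_shiftr_even.
have gen0 s l : int_shiftr int0 b (Gamma * gen C n s l) = 0.
  have [h [z [hh e]]] : exists (h : nat -> g) (z : nat -> U),
      (forall i, homog lie_par false (h i)) /\
      top 0 * top 1 * gen C n s l = \sum_(0 <= i < N) iota_ (h i) * z i.
    case: s => [[|[|s]] hs] //.
      rewrite (_ : Ordinal hs = 0); last exact: val_inj.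
      exact: Gamma_gen.
    exists (fun=> 0), (fun=> 0); split.
      by move=> i; rewrite /homog (linear0' (@lie_par_linear _ g)) scaler0.
    rewrite (_ : Ordinal hs = 1); last exact: val_inj.
    by rewrite -mulrA (gen_top0 C n 1 l).2 mulr0 big1 // => i _; rewrite mulr0.
  rewrite GammaE -scalerAl e scaler_sumr int_shiftr_sum // big1 // => i _.
  by rewrite int_shiftr_even ?mulr0.
have [t ->] := odd_iota_sum hx; rewrite mulr_sumr.
under eq_bigr do rewrite -scalerAr.
by rewrite int_shiftr_sum // big1 // => z _; rewrite gen0 mulr0.
Qed.

Lemma int_shiftl_invariant x b : A b -> int_shiftl int0 b (x * Gamma) = ueps x * int_shiftl int0 b Gamma.
Proof.
have [el e1 eM ei] := uepsP g.
elim/env_rgen_ind: x b => [|l u v hu hv|p u x hx hu] b Ab.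
- by rewrite mul1r e1 mul1r.
- have := int_shiftl_sum int0_left [:: true; false] (fun t => if t then l else 1)
    (fun t : bool => if t then u * Gamma else v * Gamma) Ab.
  rewrite !big_cons !big_nil /= !addr0 scale1r mul1r scalerAl -mulrDl => ->.
  by rewrite hu // hv // el mulrDl /GRing.scale /= mulrA.
have -> : int_shiftl int0 b (u * iota_ x * Gamma) = int_shiftl int0 (fshiftl u b) (iota_ x * Gamma).
  by congr int0; apply/funext => y; rewrite /restr /fshiftl !mulrA.
by rewrite (int_shiftl_gen _ hx) ?eM ?ei ?mulr0 ?mul0r //; apply: fun_alg_fshiftl.
Qed.

Lemma int_shiftr_invariant x b : A b -> int_shiftr int0 b (Gamma * x) = ueps x * int_shiftr int0 b Gamma.
Proof.
have [el e1 eM ei] := uepsP g.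
elim/env_lgen_ind: x b => [|l u v hu hv|p u x hx hu] b Ab.
- by rewrite mulr1 e1 mul1r.
- have := int_shiftr_sum int0_left [:: true; false] (fun t => if t then l else 1)
    (fun t : bool => if t then Gamma * u else Gamma * v) Ab.
  rewrite !big_cons !big_nil /= !addr0 scale1r mul1r scalerAr -mulrDr => ->.
  by rewrite hu // hv // el mulrDl /GRing.scale /= mulrA.
have -> : int_shiftr int0 b (Gamma * (iota_ x * u)) = int_shiftr int0 (fshiftr u b) (Gamma * iota_ x).
  by congr int0; apply/funext => y; rewrite /restr /fshiftr !mulrA.
by rewrite (int_shiftr_gen _ hx) ?eM ?ei ?mul0r //; apply: fun_alg_fshiftr.
Qed.

Local Notation intA := (conv A (nu Gamma) (fun a => int0 (restr a))).

Lemma hpart_false_even (a : U -> C^o) x : linear a -> homog (@upar C g) false x ->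
  fp false a x = a x /\ fp true a x = 0.
Proof.
by move=> al hx; rewrite !hpart_formE // !(hpart_id _ hx) /= (linear0' al).
Qed.

Lemma nu_even (a : U -> C^o) x : linear a -> homog (@upar C g) false x -> nu x a = a x.
Proof.
move=> al hx; rewrite /nu /ssum !big_bool /= !(hpart_id _ hx) /=.
have h0 p : fp p a 0 = 0 by rewrite hpart_formE // (linear0' (hpart_linear (@upar_linear C g) p)) (linear0' al).
have [-> ->] := hpart_false_even al hx.
by rewrite !h0 !scaler0 !add0r scale1r.
Qed.

Lemma int0_restr_lin l a b : A a -> A b ->
  int0 (restr (l *: a + b)) = l * int0 (restr a) + int0 (restr b).
Proof. by move=> Aa Ab; apply: int0_left.1; apply: fun_alg_even_restr. Qed.

Lemma int0_restr_sum (s : seq ((U -> C^o) * (U -> C^o))) (l : _ -> C) f :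
  (forall c, c \in s -> A (f c)) ->
  \sum_(c <- s) l c * int0 (restr (f c)) = int0 (restr (\sum_(c <- s) l c *: f c)).
Proof.
move=> Af; have [|_ <-] := linear_on_sum (@sub_hopf_lin _ _ _ A_hopf)
  (sub_hopf0 A_hopf) int0_restr_lin (s := s) l (f := f) => //.
Qed.

(** Gamma is even, so that the signs of nu and of the convolution disappear. *)
Lemma convE b : A b -> intA b = int_shiftl int0 b Gamma.
Proof.
move=> Ab; have [sA sE] := fcoprodP (sub_hopf_coprod A_hopf Ab).
rewrite /conv.
have -> : \sum_(c <- fcoprod A b) ssum (@fpar C g) (@fpar C g)
     (fun a a' => nu Gamma a * int0 (restr a') : C^o) c.1 c.2 =
   \sum_(c <- fcoprod A b) c.1 Gamma * int0 (restr c.2).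
  rewrite !big_seq; apply: eq_bigr => c /sA[A1 A2].
  have Ah p a : A a -> A (fp p a) by apply: sub_hopf_hpart.
  rewrite /ssum !big_bool /= !(nu_even _ Gamma_homog); try exact: A_lin (Ah _ _ A1).
  have [-> ->] := hpart_false_even (A_lin A1) Gamma_homog.
  rewrite !mul0r !scaler0 !add0r !scale1r -mulrDr; congr (_ * _).
  have := int0_restr_lin 1 (Ah true _ A2) (Ah false _ A2); rewrite mul1r scale1r => <-.
  by congr (int0 (restr _)); rewrite -[RHS](hpart_sum (@fpar C g)) big_bool.
rewrite int0_restr_sum => [|c /sA[] //].
congr int0; apply/funext => y; rewrite /restr /fshiftl fct_sumE sE.
rewrite !big_seq; apply: eq_bigr => c /sA[A1 A2].
by rewrite (fpairing_evenl _ (A_lin A1) (A_lin A2) Gamma_homog).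
Qed.

Lemma int_shiftl_linear_on l a b : A a -> A b ->
  int_shiftl int0 (l *: a + b) Gamma = l * int_shiftl int0 a Gamma + int_shiftl int0 b Gamma.
Proof.
move=> Aa Ab; rewrite /int_shiftl.
have -> : fshiftl Gamma (l *: a + b) = l *: fshiftl Gamma a + fshiftl Gamma b by [].
by rewrite int0_restr_lin //; apply: fun_alg_fshiftl.
Qed.

Lemma conv_linear_on : linear_on A intA.
Proof.
move=> l a b Aa Ab; rewrite !convE //; first exact: int_shiftl_linear_on.
exact: (sub_hopf_lin A_hopf).
Qed.

(** Evaluated at x in U(g), the left hand side is the value of int0 at b (x Gamma -). *)
Lemma conv_left_integral : left_integral A intA.
Proof.
split=> [|b Ab]; first exact: conv_linear_on.
have [sA sE] := fcoprodP (sub_hopf_coprod A_hopf Ab).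
apply/funext => x; rewrite form_scaleE convE // mulrC -int_shiftl_invariant //.
rewrite /id_tensor fct_sumE.
have -> : int_shiftl int0 b (x * Gamma) =
    \sum_(c <- fcoprod A b) c.1 x * int0 (restr (fshiftl Gamma c.2)).
  rewrite int0_restr_sum => [|c /sA[_ A2]]; last exact: fun_alg_fshiftl.
  congr int0; apply/funext => y; rewrite /restr /fshiftl fct_sumE -mulrA sE.
  rewrite !big_seq; apply: eq_bigr => c /sA[A1 A2].
  rewrite (fpairing_evenr _ (A_lin A1) (A_lin A2)) //.
  exact: homogM Gamma_homog (incl_homog y).
rewrite !big_seq; apply: eq_bigr => c /sA[A1 A2].
have Ah p : A (fp p c.2) := sub_hopf_hpart A_hopf p A2.
have hG y : homog (@upar C g) false (Gamma * incl y).
  exact: homogM Gamma_homog (incl_homog y).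
have e0 : intA (fp false c.2) = intA c.2.
  rewrite !convE //; congr int0; apply/funext => y.
  by rewrite /restr /fshiftl (hpart_false_even (A_lin A2) (hG y)).1.
have e1 : intA (fp true c.2) = 0.
  rewrite convE // -[RHS](int0_0 int0_left); congr int0; apply/funext => y.
  by rewrite /restr /fshiftl (hpart_false_even (A_lin A2) (hG y)).2.
rewrite /ssum !big_bool /= e0 e1 !scale0r !scaler0 !add0r !scale1r -scalerDr.
rewrite form_scaleE convE // mulrC; congr (_ * _).
by rewrite -[c.1 in RHS](hpart_sum (@fpar C g)) big_bool.
Qed.

(** Evaluated at x in U(g), the left hand side is the value of int0 at b (Gamma - x), that
    is at b (- Gamma x), as Gamma commutes with the even part. *)
Lemma conv_right_integral : right_integral A intA.
Proof.
split=> [|b Ab]; first exact: conv_linear_on.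
have [sA sE] := fcoprodP (sub_hopf_coprod A_hopf Ab).
apply/funext => x; rewrite form_scaleE convE // int_shiftl_Gamma mulrC -int_shiftr_invariant //.
rewrite /tensor_id fct_sumE.
have -> : int_shiftr int0 b (Gamma * x) =
    \sum_(c <- fcoprod A b) c.2 x * int0 (restr (fshiftl Gamma c.1)).
  rewrite int0_restr_sum => [|c /sA[A1 _]]; last exact: fun_alg_fshiftl.
  congr int0; apply/funext => y.
  rewrite /restr /fshiftl /fshiftr fct_sumE mulrA Gamma_incl sE.
  rewrite !big_seq; apply: eq_bigr => c /sA[A1 A2].
  rewrite (fpairing_evenl _ (A_lin A1) (A_lin A2)) ?form_scaleE 1?mulrC //.
  exact: homogM Gamma_homog (incl_homog y).
rewrite !big_seq; apply: eq_bigr => c /sA[A1 A2].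
by rewrite convE // form_scaleE mulrC.
Qed.

End SuperIntegral.

(** * Powers of the ideal of the even part *)

Section OddFiltration.
Variables (K : numFieldType) (n : nat).
Local Notation N := (n + n)%N.
Local Notation g := (osp2 K n).
Local Notation g0 := (osp2_even K n).
Local Notation U := (env g).
Local Notation U0 := (env g0).
Local Notation form := (env (osp2 K n) -> K^o).
Local Notation incl := (@U_even_incl K n).
Local Notation mx x := (vsval (x : subvs_of (osp_space (osp2_form K n)))).
Implicit Types (a b : form) (y : U0) (u : U).

Lemma fmul_gen_fun p (x : g) a b : linear a -> linear b -> homog lie_par p x ->
  fshiftr (iota_ x) (fmul a b) =
  fmul (fshiftr (iota_ x) a) b + fmul (fparn p a) (fshiftr (iota_ x) b).
Proof. by move=> al bl hx; apply/funext => u; apply: fmul_gen. Qed.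

Lemma restr_fshiftr (h : g0) a y :
  fshiftr (iota_ (even_incl h : g)) a (incl y) = a (incl (y * iota_ h)).
Proof. by have [_ _ iM ii] := inclP K n; rewrite /fshiftr iM ii. Qed.

Lemma restr_fmul0 a b y : linear a -> linear b ->
  ((forall y', a (incl y') = 0) \/ (forall y', b (incl y') = 0)) ->
  fmul a b (incl y) = 0.
Proof.
have [il i1 iM ii] := inclP K n.
elim/env_rgen_ind: y a b => [|k u v hu hv|p u h _ hu] a b al bl ab0.
- by rewrite i1 fmul1 //; case: ab0 => /(_ 1); rewrite i1 => ->; rewrite ?mul0r ?mulr0.
- by rewrite il fmul_linear // hu // hv // scaler0 addr0.
rewrite iM ii (fmul_gen _ al bl (even_incl_homog h)) /=.
rewrite !hu ?addr0 //; try exact: fshiftr_linear.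
  by case: ab0 => ab0; [left|right] => y; rewrite ?restr_fshiftr ab0.
by case: ab0 => ab0; [left|right] => y; rewrite ?restr_fshiftr ab0.
Qed.

Lemma form_lin_linear k a b : linear a -> linear b -> linear (k *: a + b : form).
Proof.
move=> al bl l u v; rewrite -![(k *: a + b) _]/(k *: a _ + b _) al bl.
by rewrite !scalerDr !scalerA addrACA [k * l]mulrC.
Qed.

Lemma fmul_linearl k a a' b : linear a -> linear a' -> linear b ->
  fmul (k *: a + a') b = k *: fmul a b + fmul a' b.
Proof.
move=> al al' bl; apply/funext => u; rewrite -[RHS]/(k *: fmul a b u + fmul a' b u).
elim/env_rgen_ind: u a a' b al al' bl => [|l u v hu hv|p u x hx hu] a a' b al al' bl.
- by rewrite !fmul1 //; [rewrite -[(_ + _) 1]/(k * a 1 + a' 1) mulrDl -mulrA|apply: form_lin_linear].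
- rewrite !fmul_linear ?hu ?hv //; last exact: form_lin_linear.
  by rewrite !scalerDr !scalerA addrACA [l * k]mulrC.
rewrite !(fmul_gen _ _ _ hx) //; last exact: form_lin_linear.
have -> : fparn p (k *: a + a') = k *: fparn p a + fparn p a' by case: (p).
rewrite -[fshiftr _ (k *: a + a')]/(k *: fshiftr (iota_ x) a + fshiftr (iota_ x) a').
by rewrite !hu ?scalerDr 1?addrACA //; try exact: fshiftr_linear; exact: fparn_linear.
Qed.

Lemma fmul_linearr k a b b' : linear a -> linear b -> linear b' ->
  fmul a (k *: b + b') = k *: fmul a b + fmul a b'.
Proof.
move=> al bl bl'; apply/funext => u; rewrite -[RHS]/(k *: fmul a b u + fmul a b' u).
elim/env_rgen_ind: u a b b' al bl bl' => [|l u v hu hv|p u x hx hu] a b b' al bl bl'.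
- by rewrite !fmul1 //; [rewrite -[(_ + _) 1]/(k * b 1 + b' 1) mulrDr mulrCA|apply: form_lin_linear].
- rewrite !fmul_linear ?hu ?hv //; last exact: form_lin_linear.
  by rewrite !scalerDr !scalerA addrACA [l * k]mulrC.
rewrite !(fmul_gen _ _ _ hx) //; last exact: form_lin_linear.
rewrite -[fshiftr _ (k *: b + b')]/(k *: fshiftr (iota_ x) b + fshiftr (iota_ x) b').
by rewrite !hu ?scalerDr 1?addrACA //; try exact: fshiftr_linear; exact: fparn_linear.
Qed.

(** Restriction to the even part is compatible with products. *)
Lemma restr_fmul_ext a a' b b' : linear a -> linear a' -> linear b -> linear b' ->
  (forall y, a (incl y) = a' (incl y)) -> (forall y, b (incl y) = b' (incl y)) ->
  forall y, fmul a b (incl y) = fmul a' b' (incl y).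
Proof.
move=> al al' bl bl' aa bb y; apply: (@etrans _ _ (fmul a' b (incl y))).
  apply/eqP; rewrite -subr_eq0 addrC -scaleN1r.
  rewrite -[X in X == 0]/((-1 *: fmul a' b + fmul a b) (incl y)) -fmul_linearl //.
  apply/eqP/restr_fmul0 => //; first exact: form_lin_linear.
  by left=> y'; rewrite -[LHS]/(-1 *: a' _ + a _) aa scaleN1r addNr.
apply/eqP; rewrite -subr_eq0 addrC -scaleN1r.
rewrite -[X in X == 0]/((-1 *: fmul a' b' + fmul a' b) (incl y)) -fmul_linearr //.
apply/eqP/restr_fmul0 => //; first exact: form_lin_linear.
by right=> y'; rewrite -[LHS]/(-1 *: b' _ + b _) bb scaleN1r addNr.
Qed.

(** The forms that vanish on the products of an element of U(g_0) with less than m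
    odd elements of g. For m = 1 they form the kernel of the restriction, whose m-th
    power lies in this set by vanish_fmul. *)
Fixpoint vanish (m : nat) (a : form) : Prop :=
  if m is m'.+1 then (forall y, a (incl y) = 0) /\
    (forall x : g, homog lie_par true x -> vanish m' (fshiftr (iota_ x) a))
  else True.

Lemma vanishS m a : vanish m.+1 a -> vanish m a.
Proof.
elim: m a => [|m IH] a // [a0 ax]; split=> // x hx.
exact/IH/ax.
Qed.

Lemma vanish_lin m k a b : vanish m a -> vanish m b -> vanish m (k *: a + b).
Proof.
elim: m a b => [|m IH] a b // [a0 ax] [b0 bx]; split=> [y|x hx].
  by rewrite -[LHS]/(k * a _ + b _) a0 b0 mulr0 addr0.
exact: IH (ax x hx) (bx x hx).
Qed.

Lemma vanish0 m : vanish m 0.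
Proof. by elim: m => [|m IH] //; split=> // x _; apply: IH. Qed.

Lemma vanish_fpar m a : linear a -> vanish m a -> vanish m (fpar a).
Proof.
elim: m a => [|m IH] a al // [a0 ax]; split=> [y|x hx].
  by rewrite /fpar upar_incl a0.
have -> : fshiftr (iota_ x) (fpar a) = -1 *: fpar (fshiftr (iota_ x) a) + 0.
  rewrite addr0; apply/funext => u; rewrite form_scaleE /fshiftr /fpar uparM.
  rewrite (homog_iota hx) expr1 scaleN1r mulrN -scaleN1r (linearZ' _ _ al).
  by rewrite /GRing.scale /=.
by apply: vanish_lin (vanish0 m); apply: IH (ax _ hx); apply: fshiftr_linear.
Qed.

Lemma vanish_fmul m l a b : linear a -> linear b ->
  vanish m a -> vanish l b -> vanish (m + l) (fmul a b).
Proof.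
move: {2}(m + l)%N (erefl (m + l)%N) => s.
elim: s m l a b => [|s IH] m l a b ml al bl ha hb; first by rewrite ml.
rewrite ml; split=> [y|x hx].
  apply: restr_fmul0 => //; case: m ml ha => [|m] ml; last by case; left.
  by move=> _; right; case: l ml hb => // l _ [].
rewrite (fmul_gen_fun al bl hx) -[X in X + _]scale1r; apply: vanish_lin.
  case: m ml ha => [|m] ml ha.
    have ls : l = s.+1 by [].
    rewrite ls in hb; have := IH 0%N s _ b (add0n s) (fshiftr_linear (iota_ x) al) bl.
    by rewrite add0n; apply=> //; apply: vanishS.
  have e : (m + l = s)%N by move: ml; rewrite addSn => -[].
  rewrite -e; apply: IH => //; [exact: fshiftr_linear|exact: ha.2].
have pa : vanish m (fpar a) by apply: vanish_fpar.
have pl : linear (fpar a) by apply: fpar_linear_form.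
case: l ml hb => [|l] ml hb.
  have ms : m = s.+1 by rewrite -ml addn0.
  rewrite ms in pa; have := IH s 0%N (fpar a) _ (addn0 s) pl (fshiftr_linear (iota_ x) bl).
  by rewrite addn0; apply=> //; apply: vanishS.
have e : (m + l = s)%N by move: ml; rewrite addnS => -[].
rewrite -e; apply: IH => //; [exact: fshiftr_linear|exact: hb.2].
Qed.

Section Words.
Variable I : Type.
Variable X : I -> g.
Hypothesis X_odd : forall z, homog lie_par true (X z).

Fixpoint env_word (r : seq I) : U := if r is z :: r' then env_word r' * iota_ (X z) else 1.

Lemma vanish_env_word m a r y : vanish m a -> (size r < m)%N -> a (incl y * env_word r) = 0.
Proof.
elim: r m a => [|z r IH] [|m] a //= [a0 ax] rm; first by rewrite mulr1.
by rewrite mulrA; apply: IH (ax _ (X_odd z)) _.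
Qed.

(** All the odd letters have to hit b, since otherwise the factor b vanishes on the even
    part; c is then only restricted, up to parity. *)
Lemma fmul_env_word r c b : linear c -> linear b -> vanish (size r) b ->
  exists c', [/\ linear c', forall y, c' (incl y) = c (incl y) &
    forall y, fmul c b (incl y * env_word r) = fmul c' (fshiftr (env_word r) b) (incl y)].
Proof.
elim: r c b => [|z r IH] c b cl bl hb.
  by exists c; split=> // y; rewrite /= mulr1; congr (fmul _ _ _);
     apply/funext => u; rewrite /fshiftr mulr1.
have pl : linear (fpar c) by apply: fpar_linear_form.
have [c' [cl' ce he]] := IH _ _ pl (fshiftr_linear (iota_ (X z)) bl) (hb.2 _ (X_odd z)).
exists c'; split=> // y; first by rewrite ce /fpar upar_incl.
rewrite /= mulrA (fmul_gen _ cl bl (X_odd z)) /= he.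
rewrite (vanish_env_word (m := (size r).+1)) ?add0r //.
  by congr (fmul _ _ _); apply/funext => u; rewrite /fshiftr mulrA.
by apply: (vanish_fmul (m := 0)) => //; apply: fshiftr_linear.
Qed.

Variable th : I -> form.
Hypothesis th_lin : forall z, linear (th z).
Hypothesis th_van : forall z, vanish 1 (th z).

Fixpoint form_word (r : seq I) : form :=
  if r is z :: r' then fmul (th z) (form_word r') else @ueps K g.

Lemma form_word_linear r : linear (form_word r).
Proof.
elim: r => [|z r IH] /=; first by have [] := uepsP g.
exact: fmul_linear.
Qed.

Lemma vanish_form_word r : vanish (size r) (form_word r).
Proof.
elim: r => [|z r IH] //=; apply: (vanish_fmul (m := 1)) => //.
exact: form_word_linear.
Qed.

Lemma vanish_fshiftr_form_word (x : g) r : homog lie_par true x ->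
  (forall i, (i < size r)%N -> forall z0, vanish 1 (fshiftr (iota_ x) (th (nth z0 r i)))) ->
  vanish (size r) (fshiftr (iota_ x) (form_word r)).
Proof.
move=> hx; elim: r => [|z r IH] // rv.
have fl := form_word_linear r.
rewrite [form_word _]/= (fmul_gen_fun (th_lin z) fl hx) -[X in X + _]scale1r.
apply: vanish_lin; apply: (vanish_fmul (m := 1)) => //.
- exact: fshiftr_linear.
- by have := rv 0%N (ltn0Sn _) z.
- exact: vanish_form_word.
- exact: fparn_linear.
- exact: fshiftr_linear.
- exact: vanish_fpar.
by apply: IH => i ir z0; apply: (rv i.+1).
Qed.

End Words.

(** Every letter X z must hit one factor, and X z hits no factor but th z without leaving
    it in the kernel of the restriction: the derivatives d z remain. *)
Lemma form_word_env_word (I : eqType) (X : I -> g) (th d : I -> form) (r : seq I) :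
  (forall z, homog lie_par true (X z)) -> (forall z, linear (th z)) ->
  (forall z, linear (d z)) ->
  (forall z, vanish 1 (th z)) -> uniq r ->
  (forall z z', z != z' -> vanish 1 (fshiftr (iota_ (X z)) (th z'))) ->
  (forall z y, fshiftr (iota_ (X z)) (th z) (incl y) = d z (incl y)) ->
  forall y, form_word th r (incl y * env_word X r) = form_word d r (incl y).
Proof.
move=> hX thl dl thv + hoff hd; elim: r => [|z r IH] /=; first by move=> _ y; rewrite mulr1.
case/andP=> zr ur y; have fl := form_word_linear thl r.
rewrite mulrA (fmul_gen _ (thl z) fl (hX z)) /=.
rewrite [X in _ + X](vanish_env_word hX (m := (size r).+1)) // ?addr0; last first.
  apply: (vanish_fmul (m := 1)); first exact: fpar_linear_form.
  - exact: fshiftr_linear.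
  - exact: vanish_fpar.
  apply: vanish_fshiftr_form_word => // i ir z0; apply: hoff.
  by apply: contraNneq zr => ->; apply: mem_nth.
have [c' [cl ce ->]] := fmul_env_word hX (fshiftr_linear (iota_ (X z)) (thl z)) fl
  (vanish_form_word thl thv r).
apply: restr_fmul_ext => // [|| y'|y'].
- exact: fshiftr_linear.
- exact: form_word_linear.
- by rewrite ce hd.
exact: IH.
Qed.

(** On the even part generators act by derivations, so that their weights add up. *)
Lemma form_word_char (I : Type) (d : I -> form) (w : I -> g0 -> K) (r : seq I) :
  (forall z, linear (d z)) -> (forall z, d z 1 = 1) ->
  (forall z y h, d z (incl y * incl (iota_ h)) = w z h * d z (incl y)) ->
  form_word d r 1 = 1 /\
  forall y h, form_word d r (incl y * incl (iota_ h)) = (\sum_(z <- r) w z h) * form_word d r (incl y).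
Proof.
move=> dl d1 dw; have [el e1 eM ei] := uepsP g; have [il i1 iM ii] := inclP K n.
elim: r => [|z r [IH1 IH]] /=.
  by split=> // y h; rewrite big_nil mul0r eM ii ei mulr0.
have fl := form_word_linear dl r.
split=> [|y h]; first by rewrite fmul1 // d1 IH1 mulr1.
rewrite big_cons mulrDl ii (fmul_gen _ (dl z) fl (even_incl_homog h)) /=.
have l0 : linear (0 : form) by move=> k u v; rewrite scaler0 addr0.
have fZl a b k : linear a -> linear b -> fmul (k *: a + 0) b (incl y) = k * fmul a b (incl y).
  move=> al bl; have z0 : fmul 0 b (incl y) = 0 by apply: restr_fmul0 => //; left.
  by rewrite fmul_linearl // -[LHS]/(k *: _ + fmul 0 b _) z0 addr0.
have fZr a b k : linear a -> linear b -> fmul a (k *: b + 0) (incl y) = k * fmul a b (incl y).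
  move=> al bl; have z0 : fmul a 0 (incl y) = 0 by apply: restr_fmul0 => //; right.
  by rewrite fmul_linearr // -[LHS]/(k *: _ + fmul a 0 _) z0 addr0.
rewrite -fZl // -fZr //; congr (_ + _); apply: restr_fmul_ext => //;
  try exact: fshiftr_linear; try exact: form_lin_linear.
- by move=> y'; rewrite /fshiftr -ii dw addr0.
- by move=> y'; rewrite /fshiftr -ii IH addr0.
Qed.

End OddFiltration.

(** * Non-vanishing of the super integral *)

Section Nonvanishing.
Variables (C : numClosedFieldType) (n : nat).
Local Notation N := (n + n)%N.
Local Notation g := (osp2 C n).
Local Notation g0 := (osp2_even C n).
Local Notation U := (env g).
Local Notation U0 := (env g0).
Local Notation form := (env (osp2 C n) -> C^o).
Local Notation incl := (@U_even_incl C n).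
Local Notation A := (fun_alg C n).
Local Notation Ae := (fun_alg_even C n).
Local Notation mx x := (vsval (x : subvs_of (osp_space (osp2_form C n)))).
Local Notation top s := (\prod_(0 <= j < N) gen C n s j).
Local Notation lo s := (lshift N (s : 'I_2)).
Local Notation hi j := (rshift 2 (j : 'I_N)).
Local Opaque mbr sbr mpar osp_def.
Let A_hopf := fun_alg_sub_hopf C n.

Lemma defrep_par (x : U) : defrep (upar x) = mpar (defrep x).
Proof.
have [[rl r1 rM] ri] := defrep_rep C n.
elim/env_ind: x => [|x|k u v hu hv|u v hu hv].
- by rewrite upar1 r1 (scalar_mx_block 2 N 1) mpar_block !oppr0.
- by rewrite upar_iota !ri osp_val_par.
- by rewrite upar_linear !rl mpar_linear hu hv.
- by rewrite uparM !rM mparM hu hv.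
Qed.

Lemma t_linear i j : linear (t_ i j : form).
Proof. by apply: (sub_hopf_linear A_hopf); apply: fun_alg_t. Qed.

Lemma t_odd_incl s j y : t_ (lo s) (hi j) (incl y) = 0 :> C.
Proof.
rewrite /t_; have := defrep_par (incl y); rewrite upar_incl.
rewrite -[defrep (incl y)]submxK mpar_block => /eq_block_mx[_ h _ _].
rewrite block_mxEur; move/matrixP: h => /(_ s j); rewrite [RHS]mxE.
by move=> /eqP; rewrite -addr_eq0 -mulr2n mulrn_eq0 => /eqP.
Qed.

Definition so2_weight (s : 'I_2) (h : g0) : C := ulsubmx (mx (even_incl h : g)) s s.

Lemma mul_so2 (X D : 'M[C]_2) (s s' : 'I_2) :
  D^T *m form_sym C + form_sym C *m D = 0 -> (X *m D) s s' = D s' s' * X s s'.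
Proof.
move=> hD; rewrite mxE (bigD1 s') //= big1 ?addr0; first by rewrite mulrC.
move=> c cs; suff -> : D c s' = 0 by rewrite mulr0.
have [D01 D10 _] := so2P hD; case: c s' cs => [[|[|c]] hc] [[|[|s'']] hs'] //= _.
  by rewrite -[RHS]D01; congr (D _ _); apply: val_inj.
by rewrite -[RHS]D10; congr (D _ _); apply: val_inj.
Qed.

Lemma mul_so2_block (Y : 'M[C]_(2 + N)) D (Z : 'M[C]_N) (s s' : 'I_2) :
  D^T *m form_sym C + form_sym C *m D = 0 ->
  (Y *m block_mx D 0 0 Z) (lo s) (lo s') = D s' s' * Y (lo s) (lo s').
Proof.
by move=> hD; rewrite -[Y]submxK mulmx_block !block_mxEul mulmx0 addr0 mul_so2.
Qed.

Lemma mul_odd_row_block (Y : 'M[C]_(2 + N)) (s s' : 'I_2) (j : 'I_N) (w : 'rV[C]_N) :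
  (Y *m odd_row s' w) (lo s) (hi j) = Y (lo s) (lo s') * w 0 j.
Proof.
rewrite /odd_row /oddmx -[Y]submxK mulmx_block.
by rewrite block_mxEur block_mxEul mulmx0 addr0 mulmxA mxE big_ord1 -colE !mxE.
Qed.

Lemma t_even_incl s s' y h : t_ (lo s) (lo s') (incl y * incl (iota_ h)) =
  so2_weight s' h * t_ (lo s) (lo s') (incl y) :> C.
Proof.
have [[rl r1 rM] ri] := defrep_rep C n; have [_ _ _ ii] := inclP C n.
rewrite /t_ rM ii ri /so2_weight.
have hh := even_incl_homog h; set X := mx (even_incl h : g).
have [D [Z [XE hD _]]] := osp_evenP (subvsP (even_incl h)) ((osp_homogP _ _).1 hh).
have -> : X = block_mx D 0 0 Z := XE.
rewrite block_mxKul; exact: mul_so2_block hD.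
Qed.

Lemma t_one i j : t_ i j (1 : U) = (i == j)%:R :> C.
Proof. by have [[rl r1 rM] ri] := defrep_rep C n; rewrite /t_ r1 mxE. Qed.

Lemma t_offdiag_incl s s' y : s != s' -> t_ (lo s) (lo s') (incl y) = 0 :> C.
Proof.
have [il i1 iM ii] := inclP C n.
move=> ss; elim/env_rgen_ind: y => [|k u v hu hv|p u h _ hu].
- by rewrite i1 t_one (inj_eq (@lshift_inj _ _)) (negPf ss).
- by rewrite il t_linear hu hv scaler0 addr0.
- by rewrite iM t_even_incl hu mulr0.
Qed.

(** The upper right block of odd_row s' has only its row of index s'. *)
Lemma t_odd_shift s s' (j j' : 'I_N) (u : U) :
  t_ (lo s) (hi j) (u * gen C n s' j') = t_ (lo s) (lo s') u * (j == j')%:R :> C.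
Proof.
have [[rl r1 rM] ri] := defrep_rep C n.
by rewrite /t_ rM ri val_odd_elt mul_odd_row_block mxE.
Qed.

Definition odd_word : seq ('I_2 * 'I_N) :=
  rev ([seq (0, j) | j <- index_enum 'I_N] ++ [seq (1, j) | j <- index_enum 'I_N]).

Definition odd_th (z : 'I_2 * 'I_N) : form := t_ (lo z.1) (hi z.2).
Definition odd_diag (z : 'I_2 * 'I_N) : form := t_ (lo z.1) (lo z.1).
Definition odd_X (z : 'I_2 * 'I_N) : g := odd_elt z.1 (unit_row C n z.2).

Lemma odd_word_top : env_word odd_X odd_word = top 0 * top 1.
Proof.
have rE (I : Type) (X : I -> g) r : env_word X r = \prod_(z <- rev r) iota_ (X z).
  elim: r => [|z r IH] /=; first by rewrite big_nil.
  by rewrite rev_cons -cats1 big_cat big_seq1 IH.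
by rewrite rE /odd_word revK big_cat !big_map !big_mkord.
Qed.

Lemma odd_word_uniq : uniq odd_word.
Proof.
rewrite rev_uniq cat_uniq !map_inj_uniq ?index_enum_uniq ?andbT //=.
  by apply/hasPn => _ /mapP[j _ ->]; apply/mapP => -[j' _ []].
all: by move=> i j [].
Qed.

(** Each of the 4n odd factors of Gamma hits one of the 4n odd matrix elements; what
    remains is the product of the diagonal elements of SO(2), each 2n times, and their
    weights cancel. *)
Lemma odd_word_value y :
  form_word odd_th odd_word (incl y * (top 0 * top 1)) = ueps y.
Proof.
have [il i1 iM ii] := inclP C n; have [el e1 eM ei] := uepsP g0.
rewrite -odd_word_top (@form_word_env_word C n _ odd_X odd_th odd_diag).
- have [|||f1 fh] := @form_word_char C n _ odd_diag (fun z => so2_weight z.1) odd_word.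
  + by move=> z; apply: t_linear.
  + by move=> z; rewrite /odd_diag t_one eqxx.
  + by move=> z u h; apply: t_even_incl.
  have fl : linear (form_word odd_diag odd_word) by apply: form_word_linear => z; apply: t_linear.
  elim/env_rgen_ind: y => [|k u v hu hv|p u h _ hu].
  + by rewrite i1 f1 e1.
  + by rewrite il fl hu hv el.
  rewrite iM fh eM ei mulr0 /odd_word (perm_big _ (permEl (perm_rev _))) big_cat !big_map /=.
  have w1 : so2_weight 1 h = - so2_weight 0 h := so2_opposite_weights (even_incl_homog h).
  by rewrite w1 sumrN subrr mul0r.
- by move=> z; apply: odd_elt_homog.
- by move=> z; apply: t_linear.
- by move=> z; apply: t_linear.
- by move=> z; split=> // u; apply: t_odd_incl.
- exact: odd_word_uniq.
- move=> [s' j'] [s j] zz; split=> // u.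
  rewrite /fshiftr; apply: etrans (t_odd_shift s s' j j' _) _.
  have [ss|ss] := eqVneq s s'; last by rewrite t_offdiag_incl ?mul0r.
  suff -> : (j == j') = false by rewrite mulr0.
  by apply: contraNF zz => /eqP ->; rewrite ss.
- move=> [s j] u; apply: etrans (t_odd_shift s s j j _) _.
  by rewrite eqxx mulr1.
Qed.

Lemma odd_word_fun_alg : A (form_word odd_th odd_word).
Proof.
elim: odd_word => [|z r IH] /=; first exact: sub_hopf_unit A_hopf.
by apply: (sub_hopf_mul A_hopf) IH; apply: fun_alg_t.
Qed.

Variables (k : C) (Gamma : U) (int0 : (U0 -> C^o) -> C).
Hypothesis GammaE : Gamma = k *: (top 0 * top 1).
Hypothesis k_neq0 : k != 0.
Hypothesis int0_left : left_integral Ae int0.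
Hypothesis int0_nz : nonzero_on Ae int0.

(** By odd_word_value, the integral of the product of the odd matrix elements is a nonzero
    multiple of the integral of the unit, which is nonzero by int0_unit_neq0. *)
Lemma conv_nonzero : nonzero_on A (conv A (nu Gamma) (fun a => int0 (restr a))).
Proof.
exists (form_word odd_th odd_word); first exact: odd_word_fun_alg.
have Ab := odd_word_fun_alg; have bl := sub_hopf_linear A_hopf Ab.
rewrite (convE int0_left GammaE Ab) (int_shiftl_Gamma _ GammaE) /int_shiftr.
have -> : restr (fshiftr Gamma (form_word odd_th odd_word)) = k *: (@ueps C g0 : U0 -> C^o).
  apply/funext => y; rewrite form_scaleE /restr /fshiftr GammaE -scalerAr.
  by rewrite (linearZ' _ _ bl) odd_word_value.
rewrite (linear_onZ (@fun_alg_even0 C n) int0_left.1 _ (fun_alg_even_unit C n)).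
by rewrite mulf_neq0 // int0_unit_neq0.
Qed.

End Nonvanishing.

Theorem theorem4 (R : realType) (n : nat) (n_ge1 : (1 <= n)%N)
    (int0 : (env (osp2_even R[i] n) -> R[i]^o) -> R[i])
    (int0_left : left_integral (fun_alg_even R[i] n) int0)
    (int0_nz : nonzero_on (fun_alg_even R[i] n) int0)
    (E F : env (osp2 R[i] n))
    (E_top : top_degree (1 : R[i]) E) (E_nz : E <> 0)
    (F_top : top_degree (-1 : R[i]) F) (F_nz : F <> 0) :
  let Gamma : env (osp2 R[i] n) := E * F in
  let int := conv (fun_alg R[i] n) (nu Gamma) (fun a => int0 (restr a)) in
  [/\ nonzero_on (fun_alg R[i] n) int,
      left_integral (fun_alg R[i] n) int
    & right_integral (fun_alg R[i] n) int].
Proof.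
have [c cE] := @top_degreeP _ n 0 E E_top.
have [d dE] := @top_degreeP _ n 1 F F_top.
have c0 : c != 0 by apply: contra_not_neq E_nz => c0; rewrite cE c0 scale0r.
have d0 : d != 0 by apply: contra_not_neq F_nz => d0; rewrite dE d0 scale0r.
move=> Gamma int.
have GammaE : Gamma = (c * d) *:
    (\prod_(0 <= j < n + n) gen R[i] n 0 j * \prod_(0 <= j < n + n) gen R[i] n 1 j).
  by rewrite /Gamma cE dE -scalerAl -scalerAr scalerA.
split.
- exact: conv_nonzero GammaE (mulf_neq0 c0 d0) int0_left int0_nz.
- exact: (@conv_left_integral R[i] n int0 int0_left _ Gamma GammaE).
- exact: (@conv_right_integral R[i] n int0 int0_left _ Gamma GammaE).
Qed.
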